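(* Let $N\in\mathbb{Z}_{\ge1}$, $r_n\in\mathbb{Z}$ for $n\mid N$, $\mathbf r=(r_n)_{n\mid N}$, $k'=\frac12\sum_{n\mid N}r_n$, $x_N=\sum_{n\mid N}nr_n$, $\varpi=\prod_{n\mid N}(N/n)^{|r_n|}$, and let $\chi_{\mathbf r}$ be the character of $\prod_{n\mid N}\eta(n\tau)^{r_n}$ on $\widetilde{\Gamma_0(N)}$. Let $f$ be a meromorphic modular form on $\Gamma_0(N)$ of weight $k\in k'+2\mathbb{Z}$ with character $\chi_{\mathbf r}$, and let $l\in L_{\mathbf r}$. Then: (a) there are $Y_0\ge0$ and uniquely determined $c_f(n),c_{T_lf}(n)\in\mathbb{C}$ such that on $\operatorname{Im}\tau>Y_0$ $$f(\tau)=\sum_{n\in\frac{x_N}{24}+\mathbb{Z}}c_f(n)q^n,\qquad T_lf(\tau)=\sum_{n\in\frac{x_N}{24}+\mathbb{Z}}c_{T_lf}(n)q^n,$$ where $T_l=T_{l;\chi_{\mathbf r},\chi_{\mathbf r}}$; (b) for $n\in\frac{x_N}{24}+\mathbb{Z}$, $$c_{T_lf}(n)=l^{-\frac k2}\sum_{\substack{a\mid l,\ d=l/a\\(a,N)=1}}\Big(\frac a\varpi\Big)a^k\,c_f\Big(\frac{ln}{a^2}\Big)\sum_{\substack{0\le b<d\\(a,b,d)=1}}\Big(\frac{-Nb}{(a,d)}\Big)^{2k}e\Big(bd\Big(\frac nl-\frac{x_N}{24}\Big)\Big)\psi_{l,\mathbf r}(a,b),$$ with the convention $c_f(\frac{ln}{a^2})=0$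 if $\frac{ln}{a^2}\notin\frac{x_N}{24}+\mathbb{Z}$, where $\psi_{l,\mathbf r}(a,b)=e\big(-\frac{k+\delta}4(d-1)+\frac{(k+\delta)(l-1)(N-1)}4\big)$ if $2\nmid l$; $=e\big(-\frac{k+\delta}4(a-1)-\frac{N(k+\delta)(1+\delta_1)}4b\big)$ if $2\mid l$, $2\mid N$; $=1$ if $2\mid l$, $2\nmid N$; here $\delta=0$ (resp. $1$) if $\varpi=2^\alpha(4m+1)$ (resp. $2^\alpha(4m+3)$) with $\alpha,m\in\mathbb{Z}_{\ge0}$, and $\delta_1=1$ if $2\mid l$, $4\mid N$, $k\in\frac12+\mathbb{Z}$ and $v_2(\varpi)$ is odd, $\delta_1=0$ otherwise.
   Context: $e(x)=\exp(2\pi ix)$, $q=e(\tau)$, $\eta(\tau)=q^{1/24}\prod(1-q^n)$. $\widetilde{\Gamma_0(N)}$: pairs $(\gamma,\varepsilon(c\tau+d)^{1/2})$, $\gamma=\begin{pmatrix}a&b\\c&d\end{pmatrix}\in\Gamma_0(N)$, $\varepsilon=\pm1$ (principal square root), product $(\gamma_1,\phi_1)(\gamma_2,\phi_2)=(\gamma_1\gamma_2,\phi_1(\gamma_2\tau)\phi_2(\tau))$; $\widetilde\gamma=(\gamma,(c\tau+d)^{1/2})$; $(g|_k(\gamma,\phi))(\tau)=\phi(\tau)^{-2k}g(\gamma\tau)$. $\chi_{\mathbf r}(\gamma,\varepsilon(c\tau+d)^{1/2})=\varepsilon^{-2k'}e\big(\frac1{24}\sum_{n\mid N}r_n\Psi\begin{pmatrix}a&bn\\c/n&d\end{pmatrix}\big)$,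 $\Psi\begin{pmatrix}a&b\\c&d\end{pmatrix}=\frac{a+d}c+12s(-d,c)-3$ ($c>0$), $\frac{a+d}c+12s(d,-c)+3$ ($c<0$), $b$ ($c=0,a>0$), $-b-6$ ($c=0,a<0$), $s(h,c)=\sum_{r\bmod c}((r/c))((hr/c))$, $((x))=x-\lfloor x\rfloor-\frac12$ ($x\notin\mathbb{Z}$), else $0$. Meromorphic modular form of weight $k$ with character $\chi$: meromorphic $g$ on $\mathbb{H}$ with $g|_k\gamma=\chi(\gamma)g$ for $\gamma\in\widetilde{\Gamma_0(N)}$ and, for all $\gamma\in\mathrm{SL}_2(\mathbb{Z})$, $g|_k\widetilde\gamma=\sum_{n\in\frac1h\mathbb{Z}}c_nq^n$ for $\operatorname{Im}\tau$ large with finitely many $n<0$ having $c_n\ne0$. $m_{\mathbf r}=24/\gcd(24,\sum_n(N/n)r_n,\sum_n nr_n)$; $L_{\mathbf r}=\{l\ge1:l\equiv1\bmod m_{\mathbf r}\}$ if $k'\in\mathbb{Z}$, and additionally $l$ a perfect square if $k'\in\frac12+\mathbb{Z}$. $T_{l;\chi,\chi}g(\tau)=l^{-k/2}\sum_{a\mid l,(N,a)=1}a^k\sum_{0\le b<d,(a,b,d)=1}\chi(\widetilde{\begin{pmatrix}-Nb+ax&z\\-Nd&y\end{pmatrix}})^{-1}\chi(\widetilde{\begin{pmatrix}ay&by-dz\\N&x\end{pmatrix}})^{-1}g(\frac{a\tau+b}d)$, $d=l/a$, with integers $x,y,z$ satisfying $(-Nb+ax)y+Ndz=1$ (independent of the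 choice for such $l$). $(\frac mn)$ is the Kronecker–Jacobi symbol, with $(\frac m0)=0$ for $m\ne\pm1$ and $(\frac{\pm1}0)=1$; $(a,d)=\gcd(a,d)$; $v_2$ is the 2-adic valuation. *)

(* Defs.v *)
From Stdlib Require Import Reals ZArith ClassicalEpsilon.
From Coquelicot Require Import Coquelicot.
From mathcomp Require Import ssreflect ssrbool ssrfun eqtype ssrnat seq div prime fintype.

Set Implicit Arguments.
Unset Strict Implicit.

Definition sumR (s : seq nat) (F : nat -> R) : R := foldr (fun n acc => (F n + acc)%R) 0%R s.
Definition sumC (s : seq nat) (F : nat -> C) : C := foldr (fun n acc => (F n + acc)%C) (RtoC 0) s.
Definition sumZ (s : seq nat) (F : nat -> Z) : Z := foldr (fun n acc => (F n + acc)%Z) 0%Z s.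
Definition prodN (s : seq nat) (F : nat -> nat) : nat := foldr (fun n acc => (F n * acc)%N) 1%N s.

Definition cexp (z : C) : C := (exp (Re z) * cos (Im z), exp (Re z) * sin (Im z))%R.
Definition e (z : C) : C := cexp (RtoC (2 * PI) * Ci * z)%C.
Definition eR (x : R) : C := e (RtoC x).
(* principal square root (argument in (-pi/2, pi/2]) *)
Definition Csqrt (w : C) : C :=
  (sqrt ((Cmod w + Re w) / 2),
   (if Rlt_dec (Im w) 0 then (-1)%R else 1%R) * sqrt ((Cmod w - Re w) / 2))%R.
Definition Cpowz (w : C) (n : Z) : C :=
  match n with
  | Z0 => RtoC 1
  | Zpos p => Cpow w (Pos.to_nat p)
  | Zneg p => Cinv (Cpow w (Pos.to_nat p))
  end.

Definition inH (tau : C) : Prop := (0 < Im tau)%R.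
Definition mob (a b c d : Z) (tau : C) : C :=
  ((RtoC (IZR a) * tau + RtoC (IZR b)) / (RtoC (IZR c) * tau + RtoC (IZR d)))%C.
(* weight k = K/2 ; (g |_k (gamma, eps (c tau + d)^(1/2)))(tau) *)
Definition slash (K : Z) (a b c d eps : Z) (g : C -> C) (tau : C) : C :=
  (Cpowz (RtoC (IZR eps) * Csqrt (RtoC (IZR c) * tau + RtoC (IZR d))) (- K) * g (mob a b c d tau))%C.

Definition SL2Z (a b c d : Z) : Prop := (a * d - b * c = 1)%Z.
Definition Gamma0 (N : nat) (a b c d : Z) : Prop := SL2Z a b c d /\ (Z.of_nat N | c)%Z.

Definition saw (p q : Z) : R :=
  if (p mod q =? 0)%Z then 0%R else (IZR (p mod q) / IZR q - 1 / 2)%R.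
Definition dedekind_s (h c : Z) : R :=
  sumR (iota 0 (Z.to_nat c))
       (fun r => saw (Z.of_nat r) c * saw (h * Z.of_nat r) c)%R.
Definition Psi (a b c d : Z) : R :=
  if (0 <? c)%Z then (IZR (a + d) / IZR c + 12 * dedekind_s (- d) c - 3)%R
  else if (c <? 0)%Z then (IZR (a + d) / IZR c + 12 * dedekind_s d (- c) + 3)%R
  else if (0 <? a)%Z then IZR b else (- IZR b - 6)%R.

(* sum_{n | N} r_n  (= 2 k') *)
Definition sumr (N : nat) (r : nat -> Z) : Z := sumZ (divisors N) r.
Definition xN (N : nat) (r : nat -> Z) : Z := sumZ (divisors N) (fun n => Z.of_nat n * r n)%Z.
Definition varpi (N : nat) (r : nat -> Z) : nat :=
  prodN (divisors N) (fun n => ((N %/ n) ^ Z.abs_nat (r n))%N).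

(* chi_r(gamma, eps (c tau + d)^(1/2)) = eps^(-2k')
      e( 1/24 sum_{n|N} r_n Psi(a, b n; c/n, d) ) *)
Definition chi (N : nat) (r : nat -> Z) (a b c d eps : Z) : C :=
  (Cpowz (RtoC (IZR eps)) (- sumr N r) *
   eR (/ 24 * sumR (divisors N)
          (fun n => IZR (r n) * Psi a (b * Z.of_nat n) (c / Z.of_nat n) d))%R)%C.

Definition discrete_in_H (P : C -> Prop) : Prop :=
  (forall p, P p -> inH p) /\
  (forall tau, inH tau -> exists eps : R, (0 < eps)%R /\
     forall p, P p -> p <> tau -> (eps <= Cmod (p - tau))%R).
(* g is meromorphic on H with (possible) pole set P; values of g on P are irrelevant *)
Definition meromorphic_H (g : C -> C) (P : C -> Prop) : Prop :=
  discrete_in_H P /\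
  (forall tau, inH tau -> ~ P tau -> ex_derive g tau) /\
  (forall p, P p -> exists (m : nat) (h : C -> C) (eps : R), (0 < eps)%R /\
     (forall w, (Cmod (w - p) < eps)%R -> ex_derive h w) /\
     (forall w, (0 < Cmod (w - p) < eps)%R -> h w = (Cpow (w - p) m * g w)%C)).

Definition cusp_expansion (G : C -> C) : Prop :=
  exists (h : nat) (c : Z -> C) (M : Z) (Y : R), (0 < h)%nat /\
    (forall j, (j < - M)%Z -> c j = RtoC 0) /\
    forall tau, (Y < Im tau)%R ->
      is_series (fun i : nat => (c (Z.of_nat i - M)%Z *
                   e (RtoC (IZR (Z.of_nat i - M) / INR h) * tau))%C) (G tau).

Definition merom_modform (N : nat) (r : nat -> Z) (K : Z) (f : C -> C) : Prop :=
  exists P : C -> Prop, meromorphic_H f P /\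
  (forall a b c d eps, Gamma0 N a b c d -> (eps = 1 \/ eps = -1)%Z ->
     forall tau, inH tau -> ~ P tau -> ~ P (mob a b c d tau) ->
       slash K a b c d eps f tau = (chi N r a b c d eps * f tau)%C) /\
  (forall a b c d, SL2Z a b c d -> cusp_expansion (slash K a b c d 1 f)).

Definition m_r (N : nat) (r : nat -> Z) : Z :=
  (24 / Z.gcd 24 (Z.gcd (sumZ (divisors N) (fun n => Z.of_nat (N %/ n) * r n)%Z)
                        (xN N r)))%Z.
Definition in_Lr (N : nat) (r : nat -> Z) (l : nat) : Prop :=
  (1 <= l)%N /\ ((Z.of_nat l - 1) mod m_r N r = 0)%Z /\
  (Z.odd (sumr N r) = true -> exists s : nat, l = (s * s)%N).

(* integers x, y, z with (-Nb + a x) y + N d z = 1 (chosen; independent of choice) *)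
Definition xyz (N a b d : Z) : Z * Z * Z :=
  epsilon (inhabits (0%Z, 0%Z, 0%Z))
    (fun t => let '(x, y, z) := t in ((- N * b + a * x) * y + N * d * z = 1)%Z).

Definition hecke (N : nat) (r : nat -> Z) (K : Z) (l : nat) (g : C -> C) (tau : C) : C :=
  let k := (IZR K / 2)%R in
  let NZ := Z.of_nat N in
  (RtoC (Rpower (INR l) (- k / 2)) *
   sumC [seq a <- divisors l | coprime a N]
     (fun a => let d := l %/ a in
        let aZ := Z.of_nat a in let dZ := Z.of_nat d in
        RtoC (Rpower (INR a) k) *
        sumC [seq b <- iota 0 d | gcdn (gcdn a b) d == 1%N]
          (fun b => let bZ := Z.of_nat b in
             let '(x, y, z) := xyz NZ aZ bZ dZ in
             Cinv (chi N r (- NZ * bZ + aZ * x)%Z z (- NZ * dZ)%Z y 1%Z) *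
             Cinv (chi N r (aZ * y)%Z (bZ * y - dZ * z)%Z NZ x 1%Z) *
             g ((RtoC (IZR aZ) * tau + RtoC (IZR bZ)) / RtoC (IZR dZ)))))%C.

(* ---------- q-expansions indexed by n = x_N/24 + m, m in Z ---------- *)
Definition qexp (N : nat) (r : nat -> Z) (g : C -> C) (c : Z -> C) (Y : R) : Prop :=
  exists M : Z, (forall j, (j < - M)%Z -> c j = RtoC 0) /\
    forall tau, (Y < Im tau)%R ->
      is_series (fun i : nat => (c (Z.of_nat i - M)%Z *
                   e (RtoC (IZR (xN N r) / 24 + IZR (Z.of_nat i - M)) * tau))%C) (g tau).

Definition kron_p (m : Z) (p : nat) : Z :=
  if p == 2%N then
    (if Z.even m then 0%Z
     else if ((m mod 8 =? 1) || (m mod 8 =? 7))%Z then 1%Z else (-1)%Z)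
  else if (m mod Z.of_nat p =? 0)%Z then 0%Z
  else if [exists x : 'I_p, ((x * x) %% p)%N == Z.to_nat (m mod Z.of_nat p)] then 1%Z
  else (-1)%Z.
Definition kron (m : Z) (n : nat) : Z :=
  if n == 0%N then (if ((m =? 1) || (m =? -1))%Z then 1%Z else 0%Z)
  else foldr (fun p acc => (kron_p m p ^ Z.of_nat (logn p n) * acc)%Z) 1%Z (primes n).

Definition delta (N : nat) (r : nat -> Z) : R :=
  let w := varpi N r in
  if ((w %/ 2 ^ logn 2 w) %% 4 == 3)%N then 1%R else 0%R.
Definition delta1 (N : nat) (r : nat -> Z) (K : Z) (l : nat) : R :=
  if [&& ~~ odd l, (4 %| N)%N, Z.odd K & odd (logn 2 (varpi N r))] then 1%R else 0%R.
Definition psi (N : nat) (r : nat -> Z) (K : Z) (l a b : nat) : C :=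
  let k := (IZR K / 2)%R in
  let dl := delta N r in
  let d := l %/ a in
  if odd l then
    eR (- (k + dl) / 4 * (INR d - 1) + (k + dl) * (INR l - 1) * (INR N - 1) / 4)%R
  else if ~~ odd N then
    eR (- (k + dl) / 4 * (INR a - 1)
        - INR N * (k + dl) * (1 + delta1 N r K l) / 4 * INR b)%R
  else RtoC 1.

(* c_f(l n / a^2) with n = x_N/24 + m, zero if l n/a^2 not in x_N/24 + Z *)
Definition cf_at (N : nat) (r : nat -> Z) (cf : Z -> C) (l a : nat) (m : Z) : C :=
  let x := xN N r in
  let num := (Z.of_nat l * (x + 24 * m) - Z.of_nat a ^ 2 * x)%Z in
  let den := (24 * Z.of_nat a ^ 2)%Z in
  if (num mod den =? 0)%Z then cf (num / den)%Z else RtoC 0.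

Definition hecke_coeff (N : nat) (r : nat -> Z) (K : Z) (l : nat) (cf : Z -> C) (m : Z) : C :=
  let k := (IZR K / 2)%R in
  let NZ := Z.of_nat N in
  let nR := (IZR (xN N r) / 24 + IZR m)%R in
  (RtoC (Rpower (INR l) (- k / 2)) *
   sumC [seq a <- divisors l | coprime a N]
     (fun a => let d := l %/ a in
        RtoC (IZR (kron (Z.of_nat a) (varpi N r))) * RtoC (Rpower (INR a) k) *
        cf_at N r cf l a m *
        sumC [seq b <- iota 0 d | gcdn (gcdn a b) d == 1%N]
          (fun b =>
             RtoC (powerRZ (IZR (kron (- NZ * Z.of_nat b)%Z (gcdn a d))) K) *
             eR (INR b * INR d * (nR / INR l - IZR (xN N r) / 24)) *
             psi N r K l a b)))%C.

(* Main.v *)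
(** Each coefficient of T_l is a product of two values of the eta multiplier.
    Dedekind reciprocity and Gauss's lemma express Psi modulo 24 through Kronecker
    symbols, and summing over n | N reduces the product of the two values to
    congruences modulo 3 and 8 between the moments of r; the condition l in L_r is
    what makes them hold.  The q-expansion of f comes from the expansion at the
    cusp infinity, where invariance under translation forces the exponents into
    x_N/24 + Z, and coefficients are unique because a power series vanishing along
    a sequence tending to 0 is zero.  In T_l f the contribution of a fixed divisor a
    is a Gauss-type sum over b; shifting b by gcd(a,d) shows that it vanishes
    unless the resulting exponent lies again in x_N/24 + Z. *)

Require Import Defs.
From HB Require Import structures.
From Stdlib Require Import Reals ZArith Lra Nsatz.
From Stdlib Require Import ClassicalEpsilon FunctionalExtensionality.
From Coquelicot Require Import Coquelicot.
From mathcomp Require Import all_boot ssralg finalg zmodp fingroup cyclic finfield.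
From mathcomp Require Import zify.
Delimit Scope R_scope with R.

Set Implicit Arguments.
Unset Strict Implicit.
Unset Printing Implicit Defensive.

Local Open Scope nat_scope.
Local Arguments Z.mul : simpl never.
Local Arguments Z.add : simpl never.
Local Arguments Z.sub : simpl never.
Local Arguments Z.of_nat : simpl never.

#[local] Existing Instances eqm_setoid Zplus_eqm Zminus_eqm Zmult_eqm Zopp_eqm.

Notation "u ≡ v %[mod k ]" := (eqm k u v)
  (at level 70, v at next level, format "u  ≡  v  %[mod  k ]") : Z_scope.

Lemma eqm_divide k u v : (u ≡ v %[mod k])%Z <-> exists w, (u = v + w * k)%Z.
Proof.
split=> [E|[w ->]]; last by rewrite /eqm Z_mod_plus_full.
exists (u / k - v / k)%Z; have := Z_div_mod_eq_full u k; have := Z_div_mod_eq_full v k.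
by move: E; rewrite /eqm => ->; nia.
Qed.

Lemma eqm_sub0 k u v : (u - v ≡ 0 %[mod k])%Z -> (u ≡ v %[mod k])%Z.
Proof. by rewrite !eqm_divide => -[w E]; exists w; lia. Qed.

(* For constant moduli; nonlinear monomials are treated as atoms. *)
Ltac zmod_lia :=
  intros;
  repeat match goal with H : eqm _ _ _ |- _ => apply eqm_divide in H; destruct H as [? H] end;
  try (apply eqm_sub0; unfold eqm);
  Z.to_euclidean_division_equations; lia.

(** * Dedekind sums *)

Lemma sum_ord_id n : 2 * (\sum_(r < n) r) + n = n * n.
Proof.
elim: n => [|n]; first by rewrite big_ord0.
by rewrite big_ord_recr /=; move: (\sum_(r < n) _) => s; lia.
Qed.

Lemma sum_ord_sqr n : 6 * (\sum_(r < n) r * r) + 3 * (n * n) = 2 * (n * n * n) + n.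
Proof.
elim: n => [|n]; first by rewrite big_ord0.
by rewrite big_ord_recr /=; move: (\sum_(r < n) _) => s; lia.
Qed.

Lemma sum_mulmod h k (F : nat -> nat) : 0 < k -> coprime h k ->
  \sum_(r < k) F (h * r %% k) = \sum_(r < k) F r.
Proof.
move=> k0 chk; pose mulh (r : 'I_k) := Ordinal (ltn_pmod (h * r) k0).
suff mulh_inj : injective mulh by rewrite [RHS](reindex_inj mulh_inj).
move=> r1 r2 /(congr1 val) /= /eqP.
wlog le12 : r1 r2 / r1 <= r2.
  move=> W E; case/orP: (leq_total r1 r2) => L; first exact: W.
  by symmetry; apply: W => //; rewrite eq_sym.
rewrite eq_sym eqn_mod_dvd ?leq_mul // -mulnBr Gauss_dvdr 1?coprime_sym // => D.
apply: val_inj => /=; case: (posnP (r2 - r1)) => [|P]; first lia.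
by have := dvdn_leq P D; have := ltn_ord r2; lia.
Qed.

Definition floorsum h k := \sum_(r < k) r * (h * r %/ k).

Section FloorSumReciprocity.
Variables h k : nat.
Hypotheses (h0 : 0 < h) (k0 : 0 < k) (chk : coprime h k).

Lemma sum_floor :
  h * (\sum_(r < k) r) = k * (\sum_(r < k) (h * r %/ k)) + \sum_(r < k) r.
Proof.
rewrite -{2}(sum_mulmod id k0 chk) !big_distrr -big_split /=.
by apply: eq_bigr => r _; rewrite {1}(divn_eq (h * r) k) mulnC.
Qed.

Lemma sum_floor_sqr :
  h * h * (\sum_(r < k) r * r)
    + k * k * (\sum_(r < k) (h * r %/ k) * (h * r %/ k))
  = 2 * (h * k) * floorsum h k + \sum_(r < k) r * r.
Proof.
rewrite -{2}(sum_mulmod (fun x => x * x) k0 chk) /floorsum !big_distrr -!big_split /=.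
by apply: eq_bigr => r _; have := divn_eq (h * r) k; nia.
Qed.

Lemma sum_gt_ord c m : c < m -> \sum_(r < m) (c < r) = m - 1 - c.
Proof.
elim: m => [//|m IH] cm; rewrite big_ord_recr /=.
case: (ltngtP c m) => [L|L|->]; [by rewrite IH //; lia | lia |].
rewrite big1; first lia.
by move=> i _; have := ltn_ord i; case: ltnP => //; lia.
Qed.

Lemma sum_ord_leq q : q < h -> 2 * (\sum_(v < h) v * (v <= q)) = q * q.+1.
Proof.
elim: h q => [//|m IH] q; rewrite big_ord_recr /= ltnS leq_eqVlt => /orP[/eqP->|L].
  rewrite leqnn muln1.
  under eq_bigr => i _ do rewrite (ltnW (ltn_ord i)) muln1.
  by have := sum_ord_id m; move: (\sum_(r < m) _) => s; nia.
by rewrite mulnDr IH // leqNgt L muln0 addn0.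
Qed.

Lemma leq_floor_ord (v : 'I_h) (r : 'I_k) : 0 < v ->
  (v <= h * r %/ k) = (k * v %/ h < r).
Proof.
move=> v0; rewrite leq_divRL // ltn_divLR //.
suff : v * k != r * h by lia.
apply/eqP => E; have : h %| v * k by rewrite E dvdn_mull.
by rewrite Gauss_dvdl // => /(dvdn_leq v0); have := ltn_ord v; lia.
Qed.

(* Both sides count the lattice points under the line of slope [h / k], weighted by
   their ordinate. *)
Lemma sum_floor_lattice :
  \sum_(r < k) (h * r %/ k) * (h * r %/ k).+1 + 2 * floorsum k h
  = 2 * (k.-1 * \sum_(v < h) v).
Proof.
have -> : \sum_(r < k) (h * r %/ k) * (h * r %/ k).+1
        = 2 * \sum_(v < h) \sum_(r < k) v * (v <= h * r %/ k).
  rewrite exchange_big /= big_distrr /=; apply: eq_bigr => r _.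
  by rewrite sum_ord_leq // ltn_divLR // ltn_pmul2l.
rewrite -mulnDr; congr (_ * _); rewrite /floorsum -big_split big_distrr /=.
apply: eq_bigr => v _; rewrite -big_distrr /= -mulnDr mulnC.
case: (posnP v) => [->|v0]; first by rewrite !muln0.
congr (_ * _); under eq_bigr => r _ do rewrite leq_floor_ord //.
have L : k * v %/ h < k by rewrite ltn_divLR // ltn_pmul2l.
by rewrite sum_gt_ord //; lia.
Qed.

Lemma floorsum_reciprocity :
  (12 * Z.of_nat h * Z.of_nat (floorsum h k) + 12 * Z.of_nat k * Z.of_nat (floorsum k h)
   = (Z.of_nat h - 1) * (Z.of_nat k - 1)
     * (8 * Z.of_nat h * Z.of_nat k - Z.of_nat h - Z.of_nat k - 1))%Z.
Proof.
have floor1 := f_equal Z.of_nat sum_floor.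
have floor2 := f_equal Z.of_nat sum_floor_sqr.
have lattice := f_equal Z.of_nat sum_floor_lattice.
have idk := f_equal Z.of_nat (sum_ord_id k).
have sqrk := f_equal Z.of_nat (sum_ord_sqr k).
have idh := f_equal Z.of_nat (sum_ord_id h).
have floorS : \sum_(r < k) (h * r %/ k) * (h * r %/ k).+1 =
    \sum_(r < k) (h * r %/ k) * (h * r %/ k) + \sum_(r < k) (h * r %/ k).
  by rewrite -big_split /=; apply: eq_bigr => r _; rewrite mulnS addnC.
have predk : Z.of_nat k.-1 = (Z.of_nat k - 1)%Z by lia.
rewrite floorS in lattice.
rewrite !(Nat2Z.inj_add, Nat2Z.inj_mul, predk) in floor1 floor2 lattice idk sqrk idh.
apply: (Z.mul_reg_l _ _ (Z.of_nat k)); first lia.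
move: floor1 floor2 lattice idk sqrk idh; clear; nsatz.
Qed.
End FloorSumReciprocity.

(* [12 k s(h, k)] as an integer. *)
Definition dedekindN h k : Z :=
  (2 * Z.of_nat h * (Z.of_nat k - 1) * (2 * Z.of_nat k - 1)
   - 12 * Z.of_nat (floorsum h k) - 3 * Z.of_nat k * (Z.of_nat k - 1))%Z.

Lemma dedekindN_reciprocity h k : 0 < h -> 0 < k -> coprime h k ->
  (Z.of_nat h * dedekindN h k + Z.of_nat k * dedekindN k h =
   Z.of_nat h * Z.of_nat h + Z.of_nat k * Z.of_nat k + 1 - 3 * Z.of_nat h * Z.of_nat k)%Z.
Proof.
move=> h0 k0 chk; have := floorsum_reciprocity h0 k0 chk; rewrite /dedekindN; nsatz.
Qed.

Lemma mul_dedekindN h k :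
  (Z.of_nat k * dedekindN h k = 12 * Z.of_nat (\sum_(r < k) r * (h * r %% k))
    - 3 * Z.of_nat k * Z.of_nat k * (Z.of_nat k - 1))%Z.
Proof.
have /(f_equal Z.of_nat) : \sum_(r < k) r * (h * r %% k) + k * floorsum h k
    = h * \sum_(r < k) r * r.
  rewrite /floorsum !big_distrr -big_split /=; apply: eq_bigr => r _.
  by have := divn_eq (h * r) k; nia.
have := f_equal Z.of_nat (sum_ord_sqr k).
rewrite !(Nat2Z.inj_add, Nat2Z.inj_mul) /dedekindN; nsatz.
Qed.

Lemma dedekindN_modn h k : 0 < k -> dedekindN (h %% k) k = dedekindN h k.
Proof.
move=> k0; apply: (Z.mul_reg_l _ _ (Z.of_nat k)); first lia.
rewrite !mul_dedekindN //.
by under eq_bigr => r _ do rewrite modnMml.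
Qed.

Lemma dedekindN_opp h h' k : 0 < k -> coprime h k -> k %| h + h' ->
  dedekindN h' k = (- dedekindN h k)%Z.
Proof.
move=> k0 chk D; apply: (Z.mul_reg_l _ _ (Z.of_nat k)); first lia.
have /(f_equal Z.of_nat) :
    \sum_(r < k) r * (h' * r %% k) + \sum_(r < k) r * (h * r %% k) = k * \sum_(r < k) r.
  rewrite -big_split big_distrr /=; apply: eq_bigr => r _.
  case: (posnP r) => [->|r0]; first by rewrite !muln0.
  rewrite -mulnDr mulnC; congr (_ * _).
  have : k %| h' * r %% k + h * r %% k.
    by rewrite /dvdn modnDm -mulnDl addnC -/(dvdn _ _) dvdn_mulr.
  have : 0 < h * r %% k.
    rewrite lt0n -/(dvdn k (h * r)) Gauss_dvdr 1?coprime_sym //.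
    by apply/negP => /(dvdn_leq r0); have := ltn_ord r; lia.
  have := ltn_pmod (h * r) k0; have := ltn_pmod (h' * r) k0.
  by move=> L1 L2 P /dvdnP[[|[|q]]] Eq; nia.
have := f_equal Z.of_nat (sum_ord_id k).
rewrite Z.mul_opp_r !mul_dedekindN !(Nat2Z.inj_add, Nat2Z.inj_mul); nsatz.
Qed.

(** * Gauss's lemma *)

Lemma Zof_nat_modn m d : 0 < d -> (Z.of_nat m mod Z.of_nat d)%Z = Z.of_nat (m %% d).
Proof.
move=> d0; symmetry; apply: (Z.mod_unique_pos _ _ (Z.of_nat (m %/ d))).
  by have := ltn_pmod m d0; lia.
by have := divn_eq m d; lia.
Qed.

Section OddPrime.
Import GRing.Theory.
Local Open Scope ring_scope.
Variable p : nat.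
Hypotheses (p_pr : prime p) (p_odd : odd p).
Let m := p./2.

Let pE : p = m.*2.+1.
Proof. by rewrite -[LHS]odd_double_half p_odd. Qed.

Let p_gt0 : (0 < p)%N := prime_gt0 p_pr.

Lemma natFp_eq0 n : (n%:R == 0 :> 'F_p) = (p %| n)%N.
Proof. by rewrite (dvdn_pcharf (pchar_Fp p_pr)). Qed.

Lemma natFp_eq (n1 n2 : nat) : (n1%:R == n2%:R :> 'F_p) = (n1 == n2 %[mod p])%N.
Proof.
apply/eqP/eqP => [/(congr1 (@nat_of_ord _))|E]; first by rewrite !val_Fp_nat.
by apply: val_inj; rewrite /= !val_Fp_nat.
Qed.

Lemma natFp_modn n : (n %% p)%:R = n%:R :> 'F_p.
Proof. by apply/eqP; rewrite natFp_eq modn_mod. Qed.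

Lemma Fp_oppr1_neq1 : -1 != 1 :> 'F_p.
Proof.
rewrite -subr_eq0 -opprD oppr_eq0 -(natrD _ 1 1) natFp_eq0.
by apply/negP => /dvdn_leq; rewrite pE; have := prime_gt1 p_pr; lia.
Qed.

Lemma card_oddFp : #|'F_p| = m.*2.+1.
Proof. by rewrite card_Fp. Qed.

Lemma expf_double_half (u : 'F_p) : u != 0 -> u ^+ m.*2 = 1.
Proof.
by move=> u0; apply: (mulfI u0); rewrite mulr1 -exprS -card_oddFp expf_card.
Qed.

Lemma expf_half_sqr (u : 'F_p) :
  u != 0 -> (u ^+ m == 1) = [exists y : 'F_p, y ^+ 2 == u].
Proof.
move=> u0; apply/eqP/existsP => [E|[y /eqP yu]]; last first.
  have y0 : y != 0 by apply: contraNneq u0 => y0; rewrite -yu y0 expr0n.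
  by rewrite -yu -exprM mul2n expf_double_half.
have /cyclicP[g Eg] := field_unit_group_cyclic [set: {unit 'F_p}]%G.
have uu : u \is a GRing.unit by rewrite unitfE.
have : FinRing.unit 'F_p uu \in <[g]>%g by rewrite -Eg inE.
case/cycleP => i Ei; have Eu : u = val g ^+ i by rewrite -FinRing.val_unitX -Ei.
have og : #[g]%g = m.*2.
  have := card_finField_unit 'F_p; rewrite card_oddFp /= => <-.
  by rewrite -[LHS]/(#|<[g]>%g|) -Eg.
have D : (m.*2 %| i * m)%N.
  rewrite -og order_dvdn; apply/eqP; apply: val_inj.
  by rewrite FinRing.val_unitX exprM -Eu E.
have m0 : (0 < m)%N by move: (prime_gt1 p_pr); rewrite pE; case: (m).
have ei : (2 %| i)%N by move: D; rewrite -muln2 mulnC dvdn_pmul2r.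
by exists (val g ^+ (i %/ 2)); rewrite -exprM divnK // Eu.
Qed.

Lemma expf_half (u : 'F_p) :
  u != 0 -> u ^+ m = (-1) ^+ ~~ [exists y : 'F_p, y ^+ 2 == u].
Proof.
move=> u0; rewrite -expf_half_sqr //; case: eqP => [->//|/eqP ne] /=.
have : (u ^+ m) ^+ 2 == 1 by rewrite -exprM muln2 expf_double_half.
by rewrite sqrf_eq1 (negPf ne) /= => /eqP.
Qed.

Lemma exists_sqr_modp (h : nat) :
  [exists x : 'I_p, ((x * x) %% p)%N == (h %% p)%N] = [exists y : 'F_p, y ^+ 2 == h%:R].
Proof.
apply/existsP/existsP => [[x xP]|[y yP]].
  by exists x%:R; rewrite -natrX natFp_eq.
have yp : (y < p)%N by have := ltn_ord y; rewrite [X in (_ < X)%N -> _](Fp_cast p_pr).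
exists (Ordinal yp); rewrite /= -natFp_eq natrM.
by rewrite -[X in X * _]/((y : nat)%:R) natr_Zp -expr2.
Qed.

Definition residueF (z : Z) : 'F_p := (Z.to_nat (z mod Z.of_nat p)%Z)%:R.

Lemma residueF_nat n : residueF (Z.of_nat n) = n%:R.
Proof. by rewrite /residueF Zof_nat_modn // Nat2Z.id natFp_modn. Qed.

Lemma residueFM z1 z2 : residueF (z1 * z2)%Z = residueF z1 * residueF z2.
Proof.
have pos z : (0 <= z mod Z.of_nat p)%Z by apply: (proj1 (Z.mod_pos_bound _ _ _)); lia.
rewrite /residueF -natrM -(natFp_modn (_ * _)%N) -(Nat2Z.id ((_ * _) %% p)%N) -Zof_nat_modn //.
by rewrite Nat2Z.inj_mul !Z2Nat.id // -Zmult_mod.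
Qed.

Lemma kron_p_residueF z : kron_p z p =
  if residueF z == 0 then 0%Z else if residueF z ^+ m == 1 then 1%Z else (-1)%Z.
Proof.
have bound : (0 <= z mod Z.of_nat p < Z.of_nat p)%Z by apply: Z.mod_pos_bound; lia.
have p2 : (p == 2)%N = false by apply/negbTE; apply: contraTneq p_odd => ->.
have -> : (residueF z == 0) = (z mod Z.of_nat p =? 0)%Z.
  rewrite natFp_eq0; apply/idP/idP => [|/Z.eqb_eq -> //].
  by case: (posnP (Z.to_nat (z mod Z.of_nat p))) => [E _|P /(dvdn_leq P)]; lia.
rewrite /kron_p p2; case: ifP => // /negbT nz.
rewrite expf_half_sqr -?exists_sqr_modp ?modn_small //; first lia.
rewrite natFp_eq0; apply: contra nz.
by case: (posnP (Z.to_nat (z mod Z.of_nat p))) => [E _|P /(dvdn_leq P)]; lia.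
Qed.

Lemma kron_p_mul_odd z1 z2 : kron_p (z1 * z2) p = (kron_p z1 p * kron_p z2 p)%Z.
Proof.
rewrite !kron_p_residueF residueFM mulf_eq0.
case: (eqVneq (residueF z1) 0) => // u1; case: (eqVneq (residueF z2) 0) => //= [_|u2].
  by rewrite Z.mul_0_r.
have := expf_half u2; have := expf_half u1; rewrite exprMn.
by do 2![case: existsP => _ /= ->];
  rewrite ?expr0 ?expr1 ?mulrNN ?mulr1 ?mul1r ?eqxx ?(negPf Fp_oppr1_neq1).
Qed.

Lemma kron_p_oppr1 : kron_p (-1) p = (1 - 2 * Z.of_nat (odd m))%Z.
Proof.
have E : residueF (-1) = -1.
  have p1 := prime_gt1 p_pr.
  have -> : residueF (-1) = p.-1%:R.
    by rewrite /residueF -(Z.mod_unique_pos (-1) _ (-1) (Z.of_nat p.-1)) ?Nat2Z.id //; lia.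
  by apply/eqP; rewrite -addr_eq0 -(natrD _ _ 1) natFp_eq0 addn1 prednK.
rewrite kron_p_residueF E oppr_eq0 oner_eq0 -signr_odd.
by case: odd; rewrite ?expr1 ?expr0 ?eqxx ?(negPf Fp_oppr1_neq1).
Qed.

Section GaussLemma.
Variable h : nat.
Hypothesis ph : ~~ (p %| h)%N.
Let rho (j : nat) := (h * j.*2.+1 %% p)%N.

Let rho_gt0 j : (j < m)%N -> (0 < rho j)%N.
Proof.
move=> jm; rewrite lt0n -/(dvdn _ _) Euclid_dvdM // negb_or ph /=.
by apply/negP => /dvdn_leq; rewrite pE; lia.
Qed.

Let rho_lt j : (rho j < p)%N.
Proof. by rewrite ltn_pmod. Qed.

Let odd_rep_lt (j : 'I_m) : ((if odd (rho j) then rho j else p - rho j)%N./2 < m)%N.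
Proof.
by have := rho_gt0 (ltn_ord j); have := rho_lt j; rewrite pE; case: ifP; lia.
Qed.

(* Up to sign, [h (2 j + 1)] is congruent to exactly one odd number [2 i + 1 < p]. *)
Definition odd_rep (j : 'I_m) : 'I_m := Ordinal (odd_rep_lt j).

Let odd_repE (j : 'I_m) :
  ((odd_rep j).*2.+1 = if odd (rho j) then rho j else p - rho j)%N.
Proof. by rewrite /=; have := rho_lt j; rewrite pE; case: ifP; lia. Qed.

Lemma natFp_odd_rep (j : 'I_m) :
  (h * j.*2.+1)%:R = (-1) ^+ (~~ odd (rho j)) * ((odd_rep j).*2.+1)%:R :> 'F_p.
Proof.
rewrite odd_repE -natFp_modn -/(rho j).
case: odd; first by rewrite mul1r.
rewrite natrB ?(ltnW (rho_lt j)) // pchar_Fp_0 //.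
by rewrite sub0r mulrNN mul1r.
Qed.

Lemma odd_rep_inj : injective odd_rep.
Proof.
move=> i j E; have Ei := natFp_odd_rep i; have Ej := natFp_odd_rep j; rewrite E in Ei.
have h0 : h%:R != 0 :> 'F_p by rewrite natFp_eq0.
have : exists b : bool, (i.*2.+1)%:R = (-1) ^+ b * (j.*2.+1)%:R :> 'F_p.
  exists ((~~ odd (rho i)) (+) (~~ odd (rho j))).
  apply: (mulfI h0); rewrite mulrCA -!natrM Ei Ej mulrA; congr (_ * _).
  by rewrite -signr_addb -addbA addbb addbF.
have Li := ltn_ord i; have Lj := ltn_ord j.
case=> [] [] Eb; last first.
  apply: val_inj; move: Eb; rewrite mul1r => /eqP; rewrite natFp_eq => /eqP.
  by rewrite !modn_small /= ; have := pE; lia.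
have : (i.*2.+1 + j.*2.+1)%:R == 0 :> 'F_p by rewrite natrD Eb mulN1r addNr.
by rewrite natFp_eq0 => /dvdnP[[|[|q]]]; have := pE; nia.
Qed.

Lemma gauss_lemma : h%:R ^+ m = (-1) ^+ (\sum_(j < m) ~~ odd (rho j))%N :> 'F_p.
Proof.
have nz : \prod_(j < m) (j.*2.+1)%:R != 0 :> 'F_p.
  apply/prodf_neq0 => j _; rewrite natFp_eq0; apply/negP => /dvdn_leq.
  by have := ltn_ord j; have := pE; lia.
apply: (mulIf nz); rewrite -prodrXr {2}(reindex_inj odd_rep_inj) -big_split /=.
have -> : h%:R ^+ m = \prod_(j < m) (h%:R : 'F_p) by rewrite prodr_const card_ord.
by rewrite -big_split /=; apply: eq_bigr => j _; rewrite -natFp_odd_rep natrM.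
Qed.

Lemma kron_p_gauss :
  kron_p (Z.of_nat h) p = (1 - 2 * Z.of_nat (odd (\sum_(j < m) ~~ odd (rho j))))%Z.
Proof.
rewrite kron_p_residueF residueF_nat natFp_eq0 (negPf ph) gauss_lemma -signr_odd.
by case: odd; rewrite ?expr1 ?expr0 ?eqxx ?(negPf Fp_oppr1_neq1).
Qed.
End GaussLemma.
End OddPrime.

Lemma odd_sum_mul_index (F : nat -> nat) p m : p = m.*2.+1 ->
  odd (\sum_(r < p) r * F r) = odd (\sum_(j < m) F j.*2.+1).
Proof.
move=> ->; elim: m => [|m IH]; first by rewrite big_ord_recr /= !big_ord0 mul0n.
rewrite doubleS big_ord_recr big_ord_recr /= [in RHS]big_ord_recr /=.
rewrite !oddD IH !oddM /= odd_double /=.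
by case: (odd (F m.*2.+2)); rewrite ?addbF.
Qed.

Lemma odd_sum_even_residues h p m : p = m.*2.+1 ->
  odd (\sum_(j < m) ~~ odd (h * j.*2.+1 %% p)) = odd (floorsum h p + m * h.+1).
Proof.
move=> pE; rewrite /floorsum oddD (odd_sum_mul_index (fun r => h * r %/ p) pE) -oddD.
have -> : m * h.+1 = \sum_(j < m) h.+1 by rewrite sum_nat_const card_ord.
rewrite -big_split /= !(big_morph odd oddD (erefl _)).
apply: eq_bigr => j _.
have p_odd : odd p by rewrite pE /= odd_double.
have := congr1 odd (divn_eq (h * j.*2.+1) p).
rewrite oddD !oddM p_odd /= !odd_double /= oddb oddD /=.
by case: (odd h); case: (odd (_ %/ _)); case: (odd (_ %% _)).
Qed.

Lemma eqm_mul_odd_nat (c : nat) : (4 * Z.of_nat (odd c) ≡ 4 * Z.of_nat c %[mod 8])%Z.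
Proof. by have := odd_double_half c; case: odd => E; zmod_lia. Qed.

Lemma Zmul_succ_even n : (n * (n + 1) ≡ 0 %[mod 2])%Z.
Proof.
rewrite /eqm Zmult_mod Zplus_mod.
by have [->|->] : (n mod 2 = 0 \/ n mod 2 = 1)%Z by zmod_lia.
Qed.

Lemma dedekindN_prime p h : prime p -> odd p -> ~~ (p %| h) ->
  (dedekindN h p ≡ Z.of_nat p + 1 - 2 * kron_p (Z.of_nat h) p %[mod 8])%Z.
Proof.
move=> p_pr p_odd ph; rewrite kron_p_gauss //.
have pE : p = p./2.*2.+1 by rewrite -[LHS]odd_double_half p_odd.
set m := p./2 in pE *; rewrite (odd_sum_even_residues h pE).
have parity := eqm_mul_odd_nat (floorsum h p + m * h.+1); have even := Zmul_succ_even (Z.of_nat m).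
have pZ : Z.of_nat p = (2 * Z.of_nat m + 1)%Z by lia.
rewrite Nat2Z.inj_add Nat2Z.inj_mul Nat2Z.inj_succ in parity.
rewrite /dedekindN pZ; move: parity even.
move: (Z.of_nat m) (Z.of_nat h) (Z.of_nat (floorsum h p)) (Z.of_nat (odd _)) => M H A c.
by clear; rewrite /eqm; Z.to_euclidean_division_equations; lia.
Qed.

(** * The Kronecker symbol *)

Lemma eqm_mull i j u v : (u ≡ v %[mod i * j])%Z -> (u ≡ v %[mod j])%Z.
Proof.
move=> /eqm_divide [w ->].
by apply/eqm_divide; exists (w * i)%Z; ring.
Qed.

HB.instance Definition _ :=
  Monoid.isComLaw.Build Z 1%Z Z.mul Z.mul_assoc Z.mul_comm Z.mul_1_l.

Lemma kron_bigprod m n B : 0 < n -> n < B ->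
  kron m n = \big[Z.mul/1%Z]_(0 <= p < B) (kron_p m p ^ Z.of_nat (logn p n))%Z.
Proof.
move=> n0 nB; rewrite /kron eqn0Ngt n0 /=.
transitivity (\big[Z.mul/1%Z]_(p <- primes n) (kron_p m p ^ Z.of_nat (logn p n))%Z).
  by elim: (primes n) => [|p s IH]; rewrite ?big_nil ?big_cons //= IH.
have primesE : perm_eq (primes n) [seq p <- index_iota 0 B | p \in primes n].
  apply: uniq_perm; rewrite ?primes_uniq ?filter_uniq ?iota_uniq // => p.
  rewrite mem_filter mem_index_iota andbC.
  case: (boolP (p \in primes n)) => [|_]; last by rewrite andbF.
  by rewrite mem_primes => /and3P[_ _ /(dvdn_leq n0)]; lia.
rewrite (perm_big _ primesE) big_filter big_mkcond /=.
apply: eq_bigr => p _; case: ifP => // /negbT.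
by rewrite -logn_gt0 -eqn0Ngt => /eqP ->; rewrite Z.pow_0_r.
Qed.

Lemma kronMr m n1 n2 : 0 < n1 -> 0 < n2 ->
  kron m (n1 * n2) = (kron m n1 * kron m n2)%Z.
Proof.
move=> p1 p2; have p12 : 0 < n1 * n2 by rewrite muln_gt0 p1.
have L1 : n1 < (n1 * n2).+1 by nia.
have L2 : n2 < (n1 * n2).+1 by nia.
rewrite (kron_bigprod _ p12 (leqnn _)) (kron_bigprod _ p1 L1) (kron_bigprod _ p2 L2).
rewrite -big_split /=; apply: eq_bigr => p _.
by rewrite lognM // Nat2Z.inj_add Z.pow_add_r; lia.
Qed.

Lemma kron_prime m p : prime p -> kron m p = kron_p m p.
Proof.
move=> p_pr; rewrite /kron eqn0Ngt prime_gt0 // primes_prime //= logn_prime // eqxx.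
by rewrite Z.mul_1_r Z.pow_1_r.
Qed.

Lemma prime_mul_ind (P : nat -> Prop) : P 1 ->
  (forall p n, prime p -> 0 < n -> P n -> P (p * n)) -> forall n, 0 < n -> P n.
Proof.
move=> P1 PM; elim/ltn_ind => n IH n0.
case: (ltngtP n 1) => [|n1|->//]; first lia.
have p_pr := pdiv_prime n1.
have q0 : 0 < n %/ pdiv n by rewrite divn_gt0 ?pdiv_gt0 // dvdn_leq // pdiv_dvd.
have qn : n %/ pdiv n < n by rewrite ltn_Pdiv // prime_gt1.
rewrite -(divnK (pdiv_dvd n)) mulnC; exact: PM p_pr q0 (IH _ qn q0).
Qed.

Lemma kron1n n : 0 < n -> kron 1 n = 1%Z.
Proof.
move=> n0; elim/prime_mul_ind: n / n0 => [//|p n p_pr n0 IH].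
rewrite kronMr ?(prime_gt0 p_pr) // IH Z.mul_1_r (kron_prime _ p_pr) /kron_p.
case: eqP => // _; have p1 := prime_gt1 p_pr; rewrite Z.mod_1_l /=; last lia.
by case: existsP => // - []; exists (Ordinal p1); rewrite /= mul1n modn_small.
Qed.

Definition is_sign (u : Z) : Prop := (u = 1 \/ u = -1)%Z.

Lemma is_signM u v : is_sign u -> is_sign v -> is_sign (u * v).
Proof. by case=> ->; case=> ->; [left|right|right|left]. Qed.

Lemma is_sign_sqr u : is_sign u -> (u * u = 1)%Z.
Proof. by case=> ->. Qed.

Lemma is_sign_inv u v : is_sign u -> (u * v = 1)%Z -> u = v.
Proof. by case=> ->; lia. Qed.

(* For a sign [u], [2 (1 - u)] is 4 times the bit [b] such that [u = (-1) ^ b]. *)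
Lemma two_sub_signM u v : is_sign u -> is_sign v ->
  (2 * (1 - u * v) ≡ 2 * (1 - u) + 2 * (1 - v) %[mod 8])%Z.
Proof. by case=> ->; case=> ->. Qed.

Lemma Zmod_nat_eq0 m p : 0 < p -> (m mod Z.of_nat p =? 0)%Z = (p %| Z.abs_nat m).
Proof.
move=> p0; apply/idP/idP => [/Z.eqb_eq H|/dvdnP[q E]].
  have [q Eq] : (Z.of_nat p | m)%Z by apply/Z.mod_divide => //; lia.
  by apply/dvdnP; exists (Z.abs_nat q); nia.
apply/Z.eqb_eq/Z.mod_divide; first lia.
exists (if (0 <=? m)%Z then Z.of_nat q else - Z.of_nat q)%Z.
by case: Z.leb_spec => ?; nia.
Qed.

Lemma odd_abs_nat m : odd (Z.abs_nat m) = Z.odd m.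
Proof.
have := Zabs2Nat.id_abs m; have := odd_double_half (Z.abs_nat m); rewrite Zodd_mod.
by case: odd => /= E1 E2; symmetry; [apply/Z.eqb_eq|apply/Z.eqb_neq]; zmod_lia.
Qed.

Lemma ZOdd_abs_nat m : Z.Odd m <-> odd (Z.abs_nat m).
Proof. by rewrite odd_abs_nat -Z.odd_spec. Qed.

Lemma ZOdd_of_nat n : odd n -> Z.Odd (Z.of_nat n).
Proof. by move=> on; apply/ZOdd_abs_nat; rewrite Zabs2Nat.id. Qed.

Lemma ZOdd_sqr_eqm8 m : Z.Odd m -> (m * m ≡ 1 %[mod 8])%Z.
Proof. by case=> u ->; have := Zmul_succ_even u; zmod_lia. Qed.

Lemma kron_p2_odd m : Z.Odd m ->
  kron_p m 2 = (if ((m mod 8 =? 1) || (m mod 8 =? 7))%Z then 1 else -1)%Z.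
Proof. by move/Z.odd_spec => om; rewrite /kron_p /= -Z.negb_odd om. Qed.

Lemma is_sign_kron m n : 0 < n -> coprime (Z.abs_nat m) n -> is_sign (kron m n).
Proof.
move=> n0; elim/prime_mul_ind: n / n0 => [|p n p_pr n0 IH]; first by left.
rewrite coprimeMr => /andP[cp /IH sn]; rewrite kronMr ?(prime_gt0 p_pr) // (kron_prime _ p_pr).
apply: is_signM sn; move: cp; rewrite coprime_sym prime_coprime //.
case: (eqVneq p 2) => [->|p2] nd.
  by rewrite kron_p2_odd; [case: orb; [left|right]|apply/ZOdd_abs_nat; rewrite dvdn2 negbK in nd].
rewrite /kron_p (negPf p2) Zmod_nat_eq0 ?prime_gt0 // (negPf nd).
by case: existsP; [left|right].
Qed.

Lemma kron_p_mul m1 m2 p : prime p -> kron_p (m1 * m2) p = (kron_p m1 p * kron_p m2 p)%Z.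
Proof.
move=> p_pr; case: (eqVneq p 2) => [->|p2]; last first.
  by apply: kron_p_mul_odd => //; case: (even_prime p_pr) => // E; rewrite E in p2.
case: (Z.Even_or_Odd m1) => [|o1]; first by rewrite -Z.even_spec /kron_p /= Z.even_mul => ->.
case: (Z.Even_or_Odd m2) => [|o2].
  by rewrite -Z.even_spec /kron_p /= Z.even_mul orbC => ->; rewrite Z.mul_0_r.
have o12 : Z.Odd (m1 * m2) by case: o1 o2 => u -> [v ->]; exists (2 * u * v + u + v)%Z; ring.
rewrite !kron_p2_odd // Zmult_mod.
have class m : Z.Odd m -> (m mod 8 = 1 \/ m mod 8 = 3 \/ m mod 8 = 5 \/ m mod 8 = 7)%Z.
  by case=> u ->; zmod_lia.
by case: (class _ o1) => [|[|[|]]] ->; case: (class _ o2) => [|[|[|]]] ->.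
Qed.

Lemma kronMl m1 m2 n : 0 < n -> kron (m1 * m2) n = (kron m1 n * kron m2 n)%Z.
Proof.
move=> n0; elim/prime_mul_ind: n / n0 => [//|p n p_pr n0 IH].
by rewrite !kronMr ?(prime_gt0 p_pr) // IH !(kron_prime _ p_pr) kron_p_mul //; ring.
Qed.

Lemma kron_opp m n : 0 < n -> kron (- m) n = (kron (-1) n * kron m n)%Z.
Proof. by move=> n0; rewrite -kronMl //; congr kron; ring. Qed.

Lemma kron_exp_r m p i : 0 < p -> kron m (p ^ i) = (kron m p ^ Z.of_nat i)%Z.
Proof.
move=> p0; elim: i => // i IH.
by rewrite expnS kronMr ?expn_gt0 ?p0 // IH (Nat2Z.inj_succ i) Z.pow_succ_r //; lia.
Qed.

Lemma kron_exp_l (m n i : nat) : 0 < n ->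
  kron (Z.of_nat (m ^ i)) n = (kron (Z.of_nat m) n ^ Z.of_nat i)%Z.
Proof.
move=> n0; elim: i => [|i IH]; first exact: kron1n.
by rewrite expnS Nat2Z.inj_mul kronMl // IH (Nat2Z.inj_succ i) Z.pow_succ_r //; lia.
Qed.

Lemma kron_eqm m m' n : odd n -> (m ≡ m' %[mod Z.of_nat n])%Z -> kron m n = kron m' n.
Proof.
move=> on; have n0 := odd_gt0 on; move: on.
elim/prime_mul_ind: n / n0 => [//|p n p_pr n0 IH].
rewrite oddM => /andP[op on]; have p0 := prime_gt0 p_pr.
have {}op : (p == 2) = false by apply/negbTE; apply: contraTneq op => ->.
rewrite Nat2Z.inj_mul => E; rewrite !kronMr // IH //; last first.
  exact: eqm_mull E.
rewrite !(kron_prime _ p_pr) /kron_p op (_ : m mod _ = m' mod Z.of_nat p)%Z //.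
by apply: (@eqm_mull (Z.of_nat n)); rewrite 1?Z.mul_comm.
Qed.

Lemma kron_oppr1 n : odd n -> (kron (-1) n ≡ Z.of_nat n %[mod 4])%Z.
Proof.
move=> on; have n0 := odd_gt0 on; move: on.
elim/prime_mul_ind: n / n0 => [//|p n p_pr n0 IH].
rewrite oddM => /andP[op /IH En].
rewrite kronMr ?(prime_gt0 p_pr) // (kron_prime _ p_pr) kron_p_oppr1 // Nat2Z.inj_mul En.
apply: Zmult_eqm => //; have := odd_double_half p; rewrite op.
by have := odd_double_half (p./2); case: (odd p./2) => /= E1 E2; zmod_lia.
Qed.

Lemma kron_n_2 m : Z.Odd m -> (4 * (1 - kron m 2) ≡ m * m - 1 %[mod 16])%Z.
Proof.
move=> om; rewrite kron_prime // kron_p2_odd //.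
have [u [|[|[|]]] ->] : exists u,
    (m = 8 * u + 1 \/ m = 8 * u + 3 \/ m = 8 * u + 5 \/ m = 8 * u + 7)%Z.
- by exists (m / 8)%Z; case: om => v ->; zmod_lia.
all: by rewrite (Z.mul_comm 8) Z.add_comm Z_mod_plus_full /=; zmod_lia.
Qed.

(** * Quadratic reciprocity from Dedekind reciprocity *)

Section ReciprocityModEight.
Local Open Scope Z_scope.
Variables h k S S' x x' : Z.
Hypotheses (oh : Z.Odd h) (ok : Z.Odd k) (sx : is_sign x) (sx' : is_sign x').
Hypothesis reciprocity : h * S + k * S' = h * h + k * k + 1 - 3 * h * k.
Hypothesis S'E : S' ≡ h + 1 - 2 * x' %[mod 8].

Lemma reciprocity_mod8 : S ≡ k + 1 - 2 * x %[mod 8] <->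
  2 * (1 - x) ≡ 2 * (1 - x') + (h - 1) * (k - 1) %[mod 8].
Proof.
have hh := ZOdd_sqr_eqm8 oh; have kk := ZOdd_sqr_eqm8 ok.
have SE : S ≡ h * (3 - 3 * h * k - k * S') %[mod 8].
  have E : h * S = h * h + k * k + 1 - 3 * h * k - k * S' by lia.
  have -> : S = h * (h * S) - (h * h - 1) * S by ring.
  by rewrite E hh kk; zmod_lia.
rewrite S'E in SE; rewrite SE.
case: oh hh => u hE; case: ok kk => v kE; rewrite hE kE => _ _.
have eu := Zmul_succ_even u; have ev := Zmul_succ_even v.
by case: sx sx' => -> [] ->; split; move: eu ev; clear; zmod_lia.
Qed.
End ReciprocityModEight.

Definition kron_reciprocal (h k : nat) : Prop :=
  (2 * (1 - kron (Z.of_nat h) k) ≡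
   2 * (1 - kron (Z.of_nat k) h) + (Z.of_nat h - 1) * (Z.of_nat k - 1) %[mod 8])%Z.

Lemma is_sign_kron_nat (m n : nat) : 0 < n -> coprime m n -> is_sign (kron (Z.of_nat m) n).
Proof. by move=> n0 c; apply: is_sign_kron; rewrite ?Zabs2Nat.id. Qed.

Lemma kron_reciprocal_sym h k : odd h -> odd k ->
  kron_reciprocal h k -> kron_reciprocal k h.
Proof.
rewrite /kron_reciprocal => /ZOdd_of_nat [u ->] /ZOdd_of_nat [v ->] ->.
move: (kron _ _); clear; zmod_lia.
Qed.

Lemma kron_reciprocal_prime p1 p2 : prime p1 -> prime p2 -> odd p1 -> odd p2 ->
  coprime p1 p2 -> kron_reciprocal p1 p2.
Proof.
move=> p1_pr p2_pr o1 o2 c12; have c21 : coprime p2 p1 by rewrite coprime_sym.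
have p1_gt0 := prime_gt0 p1_pr; have p2_gt0 := prime_gt0 p2_pr.
apply/(reciprocity_mod8 (ZOdd_of_nat o1) (ZOdd_of_nat o2) _ _
  (dedekindN_reciprocity p1_gt0 p2_gt0 c12)); try exact: is_sign_kron_nat.
  by rewrite kron_prime //; apply: dedekindN_prime; rewrite -?prime_coprime.
by rewrite kron_prime //; apply: dedekindN_prime; rewrite -?prime_coprime.
Qed.

Lemma kron_reciprocal_mulr h k : odd h -> 0 < k -> odd k -> coprime h k ->
  (forall p, prime p -> odd p -> coprime h p -> kron_reciprocal h p) -> kron_reciprocal h k.
Proof.
move=> oh k0 ok chk prime_case; have h0 := odd_gt0 oh; move: ok chk.
elim/prime_mul_ind: k / k0 => [_ _|p n p_pr n0 IH].
  by rewrite /kron_reciprocal kron1n // -[kron _ 1]/1%Z; zmod_lia.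
rewrite oddM coprimeMr => /andP[op on] /andP[chp chn].
have p0 := prime_gt0 p_pr.
have := prime_case p p_pr op chp; have {IH} := IH on chn; rewrite /kron_reciprocal.
rewrite Nat2Z.inj_mul kronMr // kronMl // !two_sub_signM; try exact: is_sign_kron_nat.
all: try by apply: is_sign_kron_nat; rewrite 1?coprime_sym.
move=> -> ->; case: (ZOdd_of_nat oh) => u ->; case: (ZOdd_of_nat op) => v ->.
case: (ZOdd_of_nat on) => w ->; clear; zmod_lia.
Qed.

Lemma kron_reciprocity h k : odd h -> odd k -> coprime h k -> kron_reciprocal h k.
Proof.
move=> oh ok chk; apply: kron_reciprocal_mulr => // [|p p_pr op chp]; first exact: odd_gt0.
apply: kron_reciprocal_sym => //; apply: kron_reciprocal_mulr => //.
- exact: odd_gt0.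
- by rewrite coprime_sym.
by move=> p' p'_pr op' cpp'; exact: kron_reciprocal_prime.
Qed.

Lemma coprime_subl h k : h <= k -> coprime (k - h) k = coprime h k.
Proof. by move=> hk; rewrite /coprime -{2}(subnKC hk) gcdnDr gcdnC -gcdnDr subnK. Qed.

Lemma dedekindN_kron k h : odd k -> coprime h k ->
  (dedekindN h k ≡ Z.of_nat k + 1 - 2 * kron (Z.of_nat h) k %[mod 8])%Z.
Proof.
elim/ltn_ind: k h => k IH h ok chk; have k0 := odd_gt0 ok.
case: (ltngtP k 1) => [|k1|->]; [lia| |]; last first.
  by rewrite /dedekindN /floorsum big_ord1 mul0n -[kron _ 1]/1%Z; zmod_lia.
wlog hk : h chk / h < k.
  move=> W; have := W (h %% k); rewrite coprime_modl ltn_pmod // dedekindN_modn //.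
  move=> /(_ chk isT) ->; rewrite (@kron_eqm _ (Z.of_nat h)) //.
  by rewrite -Zof_nat_modn // /eqm Zmod_mod.
have h0 : 0 < h by case: (posnP h) chk => // ->; rewrite /coprime gcd0n; lia.
wlog oh : h chk hk h0 / odd h.
  move=> W; case: (boolP (odd h)) => [|eh]; first exact: W.
  have {W} : (dedekindN (k - h) k
      ≡ Z.of_nat k + 1 - 2 * kron (Z.of_nat (k - h)) k %[mod 8])%Z.
    by apply: W; rewrite ?coprime_subl ?oddB ?ok ?(negPf eh) //; lia.
  have -> : dedekindN (k - h) k = (- dedekindN h k)%Z.
    by apply: dedekindN_opp => //; rewrite subnKC // ltnW.
  have -> : kron (Z.of_nat (k - h)) k = (kron (-1) k * kron (Z.of_nat h) k)%Z.
    rewrite -kron_opp //; apply: kron_eqm => //.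
    by rewrite /eqm -(Z_mod_plus_full (- Z.of_nat h) 1); congr (_ mod _)%Z; lia.
  have := kron_oppr1 ok; have : is_sign (kron (-1) k).
    by apply: is_sign_kron; rewrite ?coprime1n.
  move: (is_sign_kron_nat k0 chk); move: (kron _ _) (kron _ _) (Z.of_nat k) (dedekindN _ _).
  by move=> u v K D [] -> [] ->; clear; zmod_lia.
have ckh : coprime k h by rewrite coprime_sym.
apply/(reciprocity_mod8 (ZOdd_of_nat oh) (ZOdd_of_nat ok) (is_sign_kron_nat k0 chk)
  (is_sign_kron_nat h0 ckh) (dedekindN_reciprocity h0 k0 chk)); first exact: IH.
exact: kron_reciprocity.
Qed.

Lemma kron_reciprocity_abs (m : nat) (y : Z) : odd m -> Z.Odd y -> coprime m (Z.abs_nat y) ->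
  (2 * (1 - kron (Z.of_nat m) (Z.abs_nat y))
   ≡ 2 * (1 - kron y m) + (Z.of_nat m - 1) * (y - 1) %[mod 8])%Z.
Proof.
move=> om oy cmy; have oY : odd (Z.abs_nat y) by apply/ZOdd_abs_nat.
have := kron_reciprocity om oY cmy; rewrite /kron_reciprocal => ->.
case: (Z.abs_spec y) => -[s E]; rewrite Zabs2Nat.id_abs E // kron_opp ?odd_gt0 //.
have := kron_oppr1 om; have : is_sign (kron (-1) m).
  by apply: is_sign_kron; rewrite ?coprime1n ?odd_gt0.
have : is_sign (kron y m) by apply: is_sign_kron; rewrite ?odd_gt0 // coprime_sym.
move: (kron y m) (kron (-1) m) => u v; case: oy => w ->; case: (ZOdd_of_nat om) => m' ->.
by case=> -> [] ->; clear; zmod_lia.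
Qed.

Lemma kron_2_n n : odd n -> kron 2 n = kron (Z.of_nat n) 2.
Proof.
move=> on; have n0 := odd_gt0 on; have c2n : coprime 2 n by rewrite coprime2n.
have D2 : dedekindN n 2 = 0%Z.
  by rewrite -dedekindN_modn // modn2 on /dedekindN /floorsum !big_ord_recr big_ord0.
have := dedekindN_reciprocity (isT : 0 < 2) n0 c2n; rewrite D2.
have := kron_n_2 (ZOdd_of_nat on); have := dedekindN_kron on c2n.
have : is_sign (kron (Z.of_nat n) 2) by apply: is_sign_kron_nat; rewrite ?coprimen2.
have : is_sign (kron 2 n) by apply: (@is_sign_kron_nat 2).
have := Zmul_succ_even (Z.of_nat n./2).
move: (kron _ _) (kron _ _) => u v; rewrite -[Z.of_nat 2]/2%Z.
have -> : Z.of_nat n = (2 * Z.of_nat n./2 + 1)%Z.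
  by have := odd_double_half n; rewrite on; lia.
move: (Z.of_nat n./2) (dedekindN 2 n) => m D.
by move=> + [] -> [] ->; clear; zmod_lia.
Qed.

Lemma kron_2_abs m : Z.Odd m -> kron 2 (Z.abs_nat m) = kron m 2.
Proof.
move=> om; have oM : odd (Z.abs_nat m) by apply/ZOdd_abs_nat.
have sM : is_sign (kron (Z.of_nat (Z.abs_nat m)) 2).
  by apply: is_sign_kron_nat; rewrite ?coprimen2.
have sm : is_sign (kron m 2) by apply: is_sign_kron; rewrite ?coprimen2.
have := kron_n_2 om; have := kron_n_2 (ZOdd_of_nat oM).
rewrite kron_2_n // Zabs2Nat.id_abs Z.abs_square => <-; move: sM sm.
by rewrite Zabs2Nat.id_abs; case=> -> [] ->.
Qed.

(* The nontrivial character modulo 4 of the odd part of [n]. *)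
Definition chi4 (n : nat) : Z := if (n %/ 2 ^ logn 2 n) %% 4 == 3 then (-1)%Z else 1%Z.

Lemma is_sign_chi4 n : is_sign (chi4 n).
Proof. by rewrite /chi4; case: ifP; [right|left]. Qed.

Lemma odd_part n : 0 < n -> exists2 o, odd o & n = 2 ^ logn 2 n * o.
Proof.
move=> n0; have [o co E] := pfactor_coprime (isT : prime 2) n0.
by exists o; [rewrite -coprime2n|rewrite mulnC].
Qed.

Lemma logn2_odd n : odd n -> logn 2 n = 0.
Proof. by move=> on; rewrite lognE dvdn2 on !andbF. Qed.

Lemma logn2_exp2_mul i o : odd o -> logn 2 (2 ^ i * o) = i.
Proof.
by move=> oo; rewrite lognM ?expn_gt0 ?(odd_gt0 oo) // pfactorK // logn2_odd // addn0.
Qed.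

Lemma chi4_exp2_mul i o : odd o -> (chi4 (2 ^ i * o) ≡ Z.of_nat o %[mod 4])%Z.
Proof.
move=> oo; rewrite /chi4 logn2_exp2_mul // mulKn ?expn_gt0 //.
by have [E|E] : o %% 4 = 1 \/ o %% 4 = 3; [lia | |]; rewrite E /=; zmod_lia.
Qed.

Lemma chi4M u v : 0 < u -> 0 < v -> chi4 (u * v) = (chi4 u * chi4 v)%Z.
Proof.
move=> u0 v0; have [o oo Eu] := odd_part u0; have [o' oo' Ev] := odd_part v0.
have : (chi4 (u * v) ≡ chi4 u * chi4 v %[mod 4])%Z.
  rewrite Eu Ev mulnACA -expnD !chi4_exp2_mul ?oddM ?oo //.
  by rewrite Nat2Z.inj_mul.
by case: (is_sign_chi4 (u * v)) (is_sign_chi4 u) (is_sign_chi4 v) => -> [] -> [] ->.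
Qed.

Lemma is_sign_pow u i : is_sign u -> is_sign (u ^ Z.of_nat i).
Proof.
move=> su; elim: i => [|i IH]; first by left.
by rewrite (Nat2Z.inj_succ i) Z.pow_succ_r; [apply: is_signM|lia].
Qed.

Lemma two_sub_sign_pow u i : is_sign u ->
  (2 * (1 - u ^ Z.of_nat i) ≡ Z.of_nat i * (2 * (1 - u)) %[mod 8])%Z.
Proof.
move=> su; elim: i => [//|i IH].
rewrite (Nat2Z.inj_succ i) Z.pow_succ_r ?two_sub_signM ?IH //; try lia.
  by rewrite /eqm; congr (_ mod _)%Z; lia.
exact: is_sign_pow.
Qed.

Lemma coprime_Zgcd h (c : nat) : coprime (Z.abs_nat h) c <-> Z.gcd h (Z.of_nat c) = 1%Z.
Proof. by rewrite -Z.gcd_abs_l /coprime; split; lia. Qed.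

Lemma coprime_bezout h (c : nat) : coprime (Z.abs_nat h) c <->
  exists u v, (u * h + v * Z.of_nat c = 1)%Z.
Proof.
rewrite coprime_Zgcd; split=> [/Z.gcd_bezout //|[u [v E]]].
by apply/Z.bezout_1_gcd; exists u, v.
Qed.

Lemma coprime_eqm1 u v (m : nat) : 0 < m -> (u * v ≡ 1 %[mod Z.of_nat m])%Z ->
  coprime (Z.abs_nat u) m.
Proof.
move=> m0 /eqm_divide [w E].
by apply/coprime_bezout; exists v, (- w)%Z; lia.
Qed.

Lemma kron_inverse_mod u v m : odd m -> (u * v ≡ 1 %[mod Z.of_nat m])%Z -> kron u m = kron v m.
Proof.
move=> om uv; have m0 := odd_gt0 om.
apply: is_sign_inv; first exact: is_sign_kron (coprime_eqm1 m0 uv).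
by rewrite -kronMl // (kron_eqm om uv) kron1n.
Qed.

(* For [a q ≡ 1] modulo [m], inverting the roles of [m] and [q] costs a quadratic
   reciprocity sign on the odd part of [m] and a symbol at 2 on its 2-part. *)
Lemma kron_flip (m : nat) (a q : Z) : 0 < m -> Z.Odd a -> Z.Odd q ->
  (a * q ≡ 1 %[mod Z.of_nat m])%Z ->
  (2 * (1 - kron (Z.of_nat m) (Z.abs_nat q))
   ≡ 2 * (1 - kron a m) + Z.of_nat (logn 2 m) * (2 * (1 - kron (a * q) 2))
     + (1 - chi4 m) * (q - 1) %[mod 8])%Z.
Proof.
move=> m0 oa oq aq; have [o oo mE] := odd_part m0; set i := logn 2 m in mE *.
have o0 := odd_gt0 oo; have oQ : odd (Z.abs_nat q) by apply/ZOdd_abs_nat.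
have q0 := odd_gt0 oQ; have i0 : 0 < 2 ^ i by rewrite expn_gt0.
have aqo : (a * q ≡ 1 %[mod Z.of_nat o])%Z.
  by move: aq; rewrite {1}mE Nat2Z.inj_mul; exact: eqm_mull.
have cqo : coprime (Z.abs_nat q) o by apply: (coprime_eqm1 (v := a)); rewrite 1?Z.mul_comm.
have sq2 : is_sign (kron q 2) by apply: is_sign_kron; rewrite ?coprimen2.
have sa2 : is_sign (kron a 2) by apply: is_sign_kron; rewrite ?coprimen2 //; apply/ZOdd_abs_nat.
have sao : is_sign (kron a o) by apply: is_sign_kron (coprime_eqm1 o0 aqo).
have soq : is_sign (kron (Z.of_nat o) (Z.abs_nat q)).
  by apply: is_sign_kron_nat; rewrite 1?coprime_sym.
have E2 : kron (Z.of_nat (2 ^ i)) (Z.abs_nat q) = (kron q 2 ^ Z.of_nat i)%Z.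
  by rewrite kron_exp_l // kron_2_abs.
rewrite {1 2 3}mE Nat2Z.inj_mul (kronMl _ _ q0) E2 kronMr // kron_exp_r // kronMl //.
have chi := chi4_exp2_mul i oo.
have coq : coprime o (Z.abs_nat q) by rewrite coprime_sym.
rewrite (two_sub_signM (is_sign_pow i sq2) soq) (two_sub_signM (is_sign_pow i sa2) sao).
rewrite (two_sub_signM sa2 sq2) (two_sub_sign_pow i sq2) (two_sub_sign_pow i sa2).
rewrite (kron_reciprocity_abs oo oq coq) -(kron_inverse_mod oo aqo).
move: chi; case: (ZOdd_of_nat oo) => v ->.
move: (chi4 _) (kron a o) (Z.of_nat i) => c u I.
by case: sa2 => ->; case: sq2 => ->; case: (oq) => w ->; clear; zmod_lia.
Qed.

(** * Petersson's congruences for the eta multiplier *)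

Lemma sqr_eqm1_mod3 u : ~ (u ≡ 0 %[mod 3])%Z -> (u * u ≡ 1 %[mod 3])%Z.
Proof.
move=> u3; have [v [->|->]] : exists v, (u = 3 * v + 1 \/ u = 3 * v + 2)%Z.
  by exists (u / 3)%Z; move: u3; rewrite /eqm; zmod_lia.
all: by zmod_lia.
Qed.

Definition dedekindZ (h : Z) (c : nat) : Z := dedekindN (Z.to_nat (h mod Z.of_nat c)) c.

Lemma dedekindZ_of_nat h c : 0 < c -> dedekindZ (Z.of_nat h) c = dedekindN h c.
Proof. by move=> c0; rewrite /dedekindZ Zof_nat_modn // Nat2Z.id dedekindN_modn. Qed.

Section DedekindZ.
Variables (h : Z) (c : nat).
Hypotheses (c0 : 0 < c) (chc : coprime (Z.abs_nat h) c).

Let modn_bound : (0 <= h mod Z.of_nat c < Z.of_nat c)%Z.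
Proof. by apply: Z.mod_pos_bound; lia. Qed.

Lemma coprime_to_nat_mod : coprime (Z.to_nat (h mod Z.of_nat c)) c.
Proof.
rewrite -(Zabs2Nat.id (Z.to_nat _)) Z2Nat.id; last lia.
apply/coprime_Zgcd; rewrite Z.gcd_mod; last lia.
by rewrite Z.gcd_comm; apply/coprime_Zgcd.
Qed.

Lemma mul_dedekindZ_abs :
  (h * dedekindZ h c = Z.abs h * dedekindN (Z.abs_nat h) c)%Z.
Proof.
case: (Z.abs_spec h) => -[s ->].
  have hE : Z.of_nat (Z.abs_nat h) = h by lia.
  by rewrite -{2}hE dedekindZ_of_nat.
rewrite /dedekindZ (@dedekindN_opp (Z.abs_nat h)) //; first lia.
have E := Z.div_mod h (Z.of_nat c) ltac:(lia).
apply/dvdnP; exists (Z.to_nat (- (h / Z.of_nat c))).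
have : (h / Z.of_nat c <= 0)%Z by apply: Z.div_le_upper_bound; lia.
by nia.
Qed.

Lemma dedekindZ_opp : dedekindZ (- h) c = (- dedekindZ h c)%Z.
Proof.
apply: dedekindN_opp; rewrite ?coprime_to_nat_mod //.
apply/dvdnP; have := Z.div_mod h (Z.of_nat c); have := Z.div_mod (- h) (Z.of_nat c).
have : (0 <= - h mod Z.of_nat c < Z.of_nat c)%Z by apply: Z.mod_pos_bound; lia.
exists (Z.to_nat (- (h / Z.of_nat c) - (- h / Z.of_nat c))); nia.
Qed.

Lemma dedekindZ_odd_modulus : odd c ->
  (dedekindZ h c ≡ Z.of_nat c + 1 - 2 * kron h c %[mod 8])%Z.
Proof.
move=> oc; rewrite /dedekindZ dedekindN_kron ?coprime_to_nat_mod // Z2Nat.id; last lia.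
by rewrite (@kron_eqm _ h) // /eqm Zmod_mod.
Qed.

Lemma dedekindZ_reciprocity : h <> 0%Z ->
  (h * dedekindZ h c + Z.of_nat c * dedekindN c (Z.abs_nat h)
   = h * h + Z.of_nat c * Z.of_nat c + 1 - 3 * Z.abs h * Z.of_nat c)%Z.
Proof.
move=> h0; have abs_h0 : 0 < Z.abs_nat h by lia.
rewrite mul_dedekindZ_abs -Zabs2Nat.id_abs dedekindN_reciprocity //.
by rewrite Zabs2Nat.id_abs Z.abs_square.
Qed.

Lemma dedekindZ_odd : Z.Odd h -> (h * dedekindZ h c
  ≡ h * h + 1 + Z.of_nat c * Z.of_nat c + 3 * Z.of_nat c
    + 2 * Z.of_nat c * kron (Z.of_nat c) (Z.abs_nat h) %[mod Z.of_nat c * 8])%Z.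
Proof.
move=> oh; have oH : odd (Z.abs_nat h) by apply/ZOdd_abs_nat.
have h0 : h <> 0%Z by case: oh; lia.
have cch : coprime c (Z.abs_nat h) by rewrite coprime_sym.
have := dedekindZ_reciprocity h0; have := dedekindN_kron oH cch; rewrite Zabs2Nat.id_abs.
move=> /eqm_divide [w ->] E.
have [v Ev] : Z.Odd (Z.abs h) by rewrite -Zabs2Nat.id_abs; exact: ZOdd_of_nat.
apply/eqm_divide.
exists (- w - v - 1)%Z; move: E; rewrite Ev; clear; nsatz.
Qed.

Lemma dedekindZ_modulus : (h * dedekindZ h c ≡ h * h + 1 %[mod Z.of_nat c])%Z.
Proof.
apply/eqm_divide.
case: (Z.eq_dec h 0) => [hE|h0]; last first.
  exists (Z.of_nat c - 3 * Z.abs h - dedekindN c (Z.abs_nat h))%Z.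
  by have := dedekindZ_reciprocity h0; lia.
have -> : c = 1 by apply/eqP; move: chc; rewrite hE /coprime gcd0n.
by exists (h * dedekindZ h 1 - (h * h + 1))%Z; lia.
Qed.

Lemma dedekindZ_modulus3 : (Z.of_nat c ≡ 0 %[mod 3])%Z ->
  (h * dedekindZ h c ≡ h * h + 1 %[mod 3 * Z.of_nat c])%Z.
Proof.
move=> c3; have h0 : h <> 0%Z.
  by move=> hE; move: chc c3; rewrite hE /coprime gcd0n => /eqP ->.
have := dedekindZ_reciprocity h0.
have : (dedekindN c (Z.abs_nat h) ≡ 0 %[mod 3])%Z.
  by rewrite /dedekindN c3; clear; zmod_lia.
move: c3 => /eqm_divide [v Ev] /eqm_divide [w ->] E.
apply/eqm_divide.
have cc : (Z.of_nat c * Z.of_nat c = 3 * v * Z.of_nat c)%Z by rewrite {1}Ev; ring.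
by exists (v - Z.abs h - w)%Z; move: E cc; clear; lia.
Qed.

Lemma dedekindZ_coprime3 : ~ (Z.of_nat c ≡ 0 %[mod 3])%Z -> (dedekindZ h c ≡ 0 %[mod 3])%Z.
Proof.
move=> /sqr_eqm1_mod3; rewrite /dedekindZ /dedekindN.
move: (Z.of_nat c) (Z.of_nat (Z.to_nat _)) (Z.of_nat (floorsum _ _)) => C H F CC.
have -> : (2 * H * (C - 1) * (2 * C - 1) = 2 * H * (2 * (C * C) - 3 * C + 1))%Z by ring.
by rewrite CC; clear; zmod_lia.
Qed.
End DedekindZ.

Lemma sumR_iotaS n F : sumR (iota 0 n.+1) F = (sumR (iota 0 n) F + F n)%R.
Proof.
rewrite /sumR -addn1 iotaD foldr_cat /= add0n Rplus_0_r.
elim: (iota 0 n) => /= [|x s ->]; ring.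
Qed.

Section SawtoothSum.
Variables (h : Z) (c : nat).
Hypotheses (c0 : 0 < c) (chc : coprime (Z.abs_nat h) c).
Let cZ := Z.of_nat c.
Let res r := (Z.to_nat (h mod cZ) * r) %% c.

Lemma mul_mod_res r : ((h * Z.of_nat r) mod cZ = Z.of_nat (res r))%Z.
Proof.
rewrite /res -Zof_nat_modn // Nat2Z.inj_mul Z2Nat.id ?Z.mul_mod_idemp_l //; try lia.
by apply: (proj1 (Z.mod_pos_bound _ _ _)); lia.
Qed.

Lemma res_gt0 r : 0 < r < c -> 0 < res r.
Proof.
case/andP=> r0 rc; rewrite lt0n -/(dvdn c _) Gauss_dvdr.
  by apply/negP => /(dvdn_leq r0); lia.
by rewrite coprime_sym coprime_to_nat_mod.
Qed.

Lemma mul_saw_prefix n : n < c ->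
  (IZR cZ * (12 * IZR cZ
     * sumR (iota 0 n.+1) (fun r => saw (Z.of_nat r) cZ * saw (h * Z.of_nat r) cZ))
   = IZR (12 * Z.of_nat (\sum_(r < n.+1) r * res r) - 6 * cZ * Z.of_nat (\sum_(r < n.+1) r)
          - 6 * cZ * Z.of_nat (\sum_(r < n.+1) res r) + 3 * cZ * cZ * Z.of_nat n))%R.
Proof.
have cR : IZR cZ <> 0%R by apply: not_0_IZR; lia.
elim: n => [|n IH] nc.
  rewrite !big_ord_recr !big_ord0 /= /saw Zmod_0_l /= /res muln0 mod0n.
  by rewrite (_ : (12 * _ - _ - _ + _ = 0)%Z); [ring|lia].
have := IH (ltnW nc); rewrite (sumR_iotaS n.+1); move: (sumR _ _) => s Es.
rewrite !Rmult_plus_distr_l Es !(big_ord_recr n.+1) /=.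
have r0 : 0 < res n.+1 by apply: res_gt0; rewrite nc.
rewrite /saw mul_mod_res Z.mod_small; last lia.
have -> : (Z.of_nat n.+1 =? 0)%Z = false by lia.
have -> : (Z.of_nat (res n.+1) =? 0)%Z = false by lia.
rewrite !(Nat2Z.inj_add, Nat2Z.inj_mul) (Nat2Z.inj_succ n) /Z.succ.
by rewrite !(plus_IZR, minus_IZR, mult_IZR); field.
Qed.

Lemma mul_dedekind_s : (12 * IZR cZ * dedekind_s h cZ = IZR (dedekindZ h c))%R.
Proof.
have cR : IZR cZ <> 0%R by apply: not_0_IZR; lia.
rewrite /dedekind_s Nat2Z.id.
have /mul_saw_prefix : c.-1 < c by rewrite prednK.
rewrite prednK // /res (sum_mulmod (fun r => r) c0 (coprime_to_nat_mod c0 chc)).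
have := f_equal Z.of_nat (sum_ord_id c); rewrite !(Nat2Z.inj_add, Nat2Z.inj_mul).
have := mul_dedekindN (Z.to_nat (h mod cZ)) c.
rewrite -/(dedekindZ h c) => DE idE E; apply: (Rmult_eq_reg_l (IZR cZ)) => //.
rewrite E -mult_IZR DE; congr IZR; rewrite (_ : Z.of_nat c.-1 = (cZ - 1)%Z); last lia.
by move: idE; rewrite -/cZ; clear; nsatz.
Qed.
End SawtoothSum.

Definition psiZ (A : Z) (C : nat) (D : Z) : Z :=
  ((A + D - dedekindZ D C - 3 * Z.of_nat C) / Z.of_nat C)%Z.

(* The part of Petersson's formulas common to odd and even [C]. *)
Definition eta_poly (A B C D : Z) : Z := ((A + D) * C - B * D * (C * C - 1))%Z.

Section Petersson.
Variables (A B D : Z) (C : nat).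
Hypotheses (C0 : 0 < C) (det : (A * D - B * Z.of_nat C = 1)%Z).
Let CZ := Z.of_nat C.
Let P := psiZ A C D.

Lemma coprime_lower_row : coprime (Z.abs_nat D) C.
Proof.
apply/coprime_bezout; exists A, (- B)%Z; rewrite -det; ring.
Qed.

Lemma mul_psiZ : (CZ * P = A + D - dedekindZ D C - 3 * CZ)%Z.
Proof.
have [Q QE] : (CZ | A + D - dedekindZ D C - 3 * CZ)%Z; last first.
  by rewrite /P /psiZ QE Z.div_mul; lia.
apply: (Z.gauss _ D); last by rewrite Z.gcd_comm; apply/coprime_Zgcd/coprime_lower_row.
have /eqm_divide [w E] := dedekindZ_modulus C0 coprime_lower_row.
by exists (B - w - 3 * D)%Z; move: E det; rewrite /CZ; clear; nsatz.
Qed.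

Lemma psiZ_mod3 : (P ≡ eta_poly A B CZ D %[mod 3])%Z.
Proof.
case: (Z.eq_dec (CZ mod 3) 0) => [C3|C3].
  have /eqm_divide [w E] := dedekindZ_modulus3 C0 coprime_lower_row C3.
  have DP : (D * P = B - 3 * (w + D))%Z.
    apply: (Z.mul_reg_l _ _ CZ); first lia.
    by move: E det mul_psiZ; rewrite /CZ; clear; nsatz.
  have DD : (D * D ≡ 1 %[mod 3])%Z.
    apply: sqr_eqm1_mod3 => D3; have : (A * D - B * CZ ≡ 0 %[mod 3])%Z.
      by rewrite D3 (_ : (CZ ≡ 0 %[mod 3])%Z) // !Z.mul_0_r.
    by rewrite det.
  have -> : (P = D * (D * P) - (D * D - 1) * P)%Z by ring.
  rewrite DP DD /eta_poly (_ : (CZ ≡ 0 %[mod 3])%Z) //; zmod_lia.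
have dedekind0 := dedekindZ_coprime3 D C3.
have CC := sqr_eqm1_mod3 C3.
have -> : (P = CZ * (CZ * P) - (CZ * CZ - 1) * P)%Z by ring.
by rewrite mul_psiZ dedekind0 /eta_poly CC; zmod_lia.
Qed.

Lemma psiZ_mod8_odd_left : odd C ->
  (P ≡ eta_poly A B CZ D - 3 * CZ + 2 * (1 - kron D C) %[mod 8])%Z.
Proof.
move=> oC; have CC := ZOdd_sqr_eqm8 (ZOdd_of_nat oC); rewrite -/CZ in CC.
have -> : (P = CZ * (CZ * P) - (CZ * CZ - 1) * P)%Z by ring.
rewrite mul_psiZ (dedekindZ_odd_modulus C0 coprime_lower_row oC) /eta_poly CC -/CZ.
have -> : (CZ * (A + D - (CZ + 1 - 2 * kron D C) - 3 * CZ)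
  = CZ * (A + D) - 4 * (CZ * CZ) - CZ + 2 * CZ * kron D C)%Z by ring.
rewrite CC; case: (is_sign_kron C0 coprime_lower_row) => ->;
  case: (ZOdd_of_nat oC); rewrite -/CZ => v ->; zmod_lia.
Qed.

Lemma psiZ_mod8_odd_right : Z.Odd D ->
  (P ≡ eta_poly A B CZ D + 3 * D - 3 - 3 * CZ * D + 2 * (1 - kron CZ (Z.abs_nat D)) %[mod 8])%Z.
Proof.
move=> oD; have DD := ZOdd_sqr_eqm8 oD.
have /eqm_divide [w E] := dedekindZ_odd C0 coprime_lower_row oD.
set u := kron CZ (Z.abs_nat D); rewrite -/CZ -/u in E.
have DP : (D * P = B - CZ - 3 - 2 * u - 3 * D - 8 * w)%Z.
  apply: (Z.mul_reg_l _ _ CZ); first by rewrite /CZ; lia.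
  by move: E det mul_psiZ; rewrite -/CZ; clear; nsatz.
have -> : (P = D * (D * P) - (D * D - 1) * P)%Z by ring.
have -> : eta_poly A B CZ D = (CZ * (D + A * (D * D) - A * (D * D - 1)) - B * D * CZ * CZ + B * D)%Z.
  by rewrite /eta_poly; ring.
have -> : (A * (D * D) = D + B * CZ * D)%Z by move: det; rewrite -/CZ; clear; nsatz.
rewrite DP DD; have su : is_sign u.
  by apply: is_sign_kron_nat; [apply: odd_gt0; apply/ZOdd_abs_nat|rewrite coprime_sym coprime_lower_row].
by case: su => ->; case: oD => v ->; have := Zmul_succ_even v; clear; zmod_lia.
Qed.

Lemma Psi_psiZ : Psi A B CZ D = IZR P.
Proof.
have C_pos : (0 < CZ)%Z by rewrite /CZ; lia.
have cR : IZR CZ <> 0%R by apply: not_0_IZR; lia.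
have cop := coprime_lower_row; have copN : coprime (Z.abs_nat (- D)) C by case: (D) cop.
rewrite /Psi (proj2 (Z.ltb_lt 0 CZ) C_pos).
apply: (Rmult_eq_reg_l (IZR CZ)) => //; rewrite -mult_IZR mul_psiZ.
have := mul_dedekind_s C0 copN; rewrite dedekindZ_opp // opp_IZR -/CZ.
move: (dedekindZ D C) (dedekind_s _ _) => S s E.
rewrite !(plus_IZR, minus_IZR, mult_IZR).
by rewrite (_ : IZR S = - (12 * IZR CZ * s))%R; [field|lra].
Qed.

Lemma Psi_opp_psiZ : Psi A (- B) (- CZ) D = (- IZR P)%R.
Proof.
have C_pos : (0 < CZ)%Z by rewrite /CZ; lia.
have cR : IZR CZ <> 0%R by apply: not_0_IZR; lia.
have -> : Psi A (- B) (- CZ) D = (IZR (A + D) / IZR (- CZ) + 12 * dedekind_s D CZ + 3)%R.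
  rewrite /Psi Z.opp_involutive.
  by rewrite (proj2 (Z.ltb_ge 0 (- CZ))) ?(proj2 (Z.ltb_lt (- CZ) 0)) //; lia.
apply: (Rmult_eq_reg_l (IZR CZ)) => //; rewrite Ropp_mult_distr_r_reverse -mult_IZR mul_psiZ.
have := mul_dedekind_s C0 coprime_lower_row; rewrite -/CZ.
move: (dedekindZ D C) (dedekind_s _ _) => S s E.
by rewrite !(opp_IZR, plus_IZR, minus_IZR, mult_IZR) -E; field.
Qed.
End Petersson.

(** * Moments of the exponents [r] *)

HB.instance Definition _ :=
  Monoid.isComLaw.Build Z 0%Z Z.add Z.add_assoc Z.add_comm Z.add_0_l.

Lemma sumZE s F : sumZ s F = \big[Z.add/0%Z]_(n <- s) F n.
Proof. by rewrite /sumZ; elim: s => [|n s IH]; rewrite ?big_nil ?big_cons //= IH. Qed.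

Lemma prodNE s F : prodN s F = \prod_(n <- s) F n.
Proof. by rewrite /prodN; elim: s => [|n s IH]; rewrite ?big_nil ?big_cons //= IH. Qed.

Definition moment (N : nat) (r f : nat -> Z) : Z := sumZ (divisors N) (fun n => f n * r n)%Z.

Lemma momentD N r f g : (moment N r (fun n => f n + g n) = moment N r f + moment N r g)%Z.
Proof. by rewrite /moment !sumZE -big_split; apply: eq_bigr => n _ /=; ring. Qed.

Lemma momentZ N r c f : (moment N r (fun n => c * f n) = c * moment N r f)%Z.
Proof.
rewrite /moment !sumZE (big_morph (Z.mul c) (Z.mul_add_distr_l c) (Z.mul_0_r c)).
by apply: eq_bigr => n _; ring.
Qed.

Lemma moment_const N r c : (moment N r (fun _ => c) = c * sumr N r)%Z.
Proof.
by rewrite /moment /sumr !sumZE (big_morph (Z.mul c) (Z.mul_add_distr_l c) (Z.mul_0_r c)).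
Qed.

Lemma eqm_moment k N r f g : 0 < N -> (forall n, n %| N -> (f n ≡ g n %[mod k])%Z) ->
  (moment N r f ≡ moment N r g %[mod k])%Z.
Proof.
move=> N0 fg; rewrite /moment !sumZE !big_seq.
apply: (big_ind2 (eqm k)) => // [u u' v v' -> -> //|n].
by rewrite -dvdn_divisors // => /fg ->.
Qed.

Lemma divn_gt0_dvd N n : 0 < N -> n %| N -> 0 < N %/ n.
Proof. by move=> N0 D; rewrite divn_gt0 ?(dvdn_leq N0 D) // (dvdn_gt0 N0 D). Qed.

Lemma Zof_nat_cofactor N n : n %| N -> Z.of_nat N = (Z.of_nat n * Z.of_nat (N %/ n))%Z.
Proof. by move=> D; rewrite -{1}(divnK D) Nat2Z.inj_mul Z.mul_comm. Qed.

Section Varpi.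
Variables (N : nat) (r : nat -> Z) (Q : nat -> Prop).
Hypotheses (N0 : 0 < N) (Q1 : Q 1) (QM : forall u v, Q u -> Q v -> Q (u * v)).
Hypothesis Q_cofactor : forall n, n %| N -> Q (N %/ n).

Let QX u i : Q u -> Q (u ^ i).
Proof. by move=> Qu; elim: i => // i IH; rewrite expnS; apply: QM. Qed.

Lemma varpi_closed : Q (varpi N r).
Proof.
rewrite /varpi prodNE big_seq; apply: big_ind => // n.
by rewrite -dvdn_divisors // => /Q_cofactor; apply: QX.
Qed.

Lemma moment_varpi k (h : nat -> Z) : h 1 = 0%Z ->
  (forall u v, Q u -> Q v -> (h (u * v)%N ≡ h u + h v %[mod k])%Z) ->
  (forall u, Q u -> (2 * h u ≡ 0 %[mod k])%Z) ->
  (moment N r (fun n => h (N %/ n)%N) ≡ h (varpi N r) %[mod k])%Z.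
Proof.
move=> h1 hM h2; have hX u i : Q u -> (h (u ^ i)%N ≡ Z.of_nat i * h u %[mod k])%Z.
  move=> Qu; elim: i => [|i IH]; first by rewrite h1.
  by rewrite expnS hM ?IH; [rewrite Nat2Z.inj_succ /eqm; congr (_ mod _)%Z; ring|done|apply: QX].
have habs u i : Q u -> (Z.of_nat (Z.abs_nat i) * h u ≡ h u * i %[mod k])%Z.
  move=> /h2 /eqm_divide [w E]; rewrite Zabs2Nat.id_abs.
  case: (Z.abs_spec i) => -[_ ->]; apply/eqm_divide; first by exists 0%Z; ring.
  by exists (- i * w)%Z; nia.
suff [] : Q (varpi N r) /\
    (moment N r (fun n => h (N %/ n)%N) ≡ h (varpi N r) %[mod k])%Z by [].
rewrite /varpi /moment sumZE prodNE !big_seq.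
apply: (big_ind2 (fun (s : Z) u => Q u /\ (s ≡ h u %[mod k])%Z)) => [|s u s' u'|n].
- by rewrite h1.
- by move=> [Qu Es] [Qu' Es']; split; [exact: QM|rewrite hM // Es Es'].
by rewrite -dvdn_divisors // => /Q_cofactor Qn; split; [exact: QX|rewrite hX // habs].
Qed.
End Varpi.

(* The exponent sum of the image of the eta quotient under the Fricke involution. *)
Definition xN_dual (N : nat) (r : nat -> Z) : Z :=
  moment N r (fun n => Z.of_nat (N %/ n)).

Lemma xN_moment N r : xN N r = moment N r Z.of_nat.
Proof. by []. Qed.

(* With the notation of the theorem, [2 (k' + delta)]. *)
Definition twice_weight_delta (N : nat) (r : nat -> Z) : Z :=
  (sumr N r + (1 - chi4 (varpi N r)))%Z.

Section MomentRelations.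
Variables (N : nat) (r : nat -> Z).
Hypothesis N0 : 0 < N.
Local Notation S := (xN_dual N r).
Local Notation X := (xN N r).
Local Notation rho := (twice_weight_delta N r).
Local Notation v2 := (Z.of_nat (logn 2 (varpi N r))).

Lemma moment_chi4 :
  (moment N r (fun n => 2 * (1 - chi4 (N %/ n))) ≡ 2 * (1 - chi4 (varpi N r)) %[mod 8])%Z.
Proof.
apply: (@moment_varpi _ _ (leq 1) _ _ _ _ 8 (fun u => 2 * (1 - chi4 u))%Z) => //.
- by move=> u v; rewrite muln_gt0 => -> ->.
- by move=> n; exact: divn_gt0_dvd.
- by move=> u v u0 v0; rewrite chi4M // two_sub_signM //; exact: is_sign_chi4.
by move=> u _; case: (is_sign_chi4 u) => ->.
Qed.

Lemma moment_logn2 : (moment N r (fun n => Z.of_nat (logn 2 (N %/ n))) ≡ v2 %[mod 2])%Z.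
Proof.
apply: (@moment_varpi _ _ (leq 1) _ _ _ _ 2 (fun u => Z.of_nat (logn 2 u))) => //.
- by move=> u v; rewrite muln_gt0 => -> ->.
- by move=> n; exact: divn_gt0_dvd.
- by move=> u v u0 v0; rewrite lognM // Nat2Z.inj_add.
by move=> u _; clear; zmod_lia.
Qed.

Lemma moment_kron a : coprime a N ->
  (moment N r (fun n => 2 * (1 - kron (Z.of_nat a) (N %/ n)))
   ≡ 2 * (1 - kron (Z.of_nat a) (varpi N r)) %[mod 8])%Z.
Proof.
move=> caN; pose Q u := 0 < u /\ coprime a u.
have sign u : Q u -> is_sign (kron (Z.of_nat a) u) by case=> u0 cu; exact: is_sign_kron_nat.
apply: (@moment_varpi _ _ Q _ _ _ _ 8 (fun u => 2 * (1 - kron (Z.of_nat a) u))%Z) => //.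
- by split=> //; exact: coprimen1.
- by move=> u v [u0 cu] [v0 cv]; rewrite /Q muln_gt0 u0 coprimeMr cu.
- move=> n Dn; split; first exact: divn_gt0_dvd.
  exact: coprime_dvdr (dvdn_div Dn) caN.
- by move=> u v Qu Qv; rewrite kronMr ?two_sub_signM; [|exact: sign|exact: sign|case: Qu|case: Qv].
by move=> u /sign [] ->.
Qed.

Lemma xN_dual_eqm k : (forall n, n %| N -> (Z.of_nat n * Z.of_nat n ≡ 1 %[mod k])%Z) ->
  (S ≡ Z.of_nat N * X %[mod k])%Z.
Proof.
move=> sqr1; rewrite xN_moment -momentZ; apply: eqm_moment => // n Dn.
rewrite (Zof_nat_cofactor Dn).
have -> : (Z.of_nat n * Z.of_nat (N %/ n) * Z.of_nat n
  = Z.of_nat n * Z.of_nat n * Z.of_nat (N %/ n))%Z by ring.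
by rewrite sqr1 // Z.mul_1_l.
Qed.

Lemma xN_dual_odd : odd N -> (S ≡ Z.of_nat N * X %[mod 8])%Z.
Proof.
move=> oN; apply: xN_dual_eqm => n Dn; apply/ZOdd_sqr_eqm8/ZOdd_of_nat.
exact: dvdn_odd Dn oN.
Qed.

Lemma xN_dual_odd_mod4 : odd N -> (S ≡ rho %[mod 4])%Z.
Proof.
move=> oN; have : (2 * S ≡ 2 * rho %[mod 8])%Z; last by clear; zmod_lia.
rewrite Z.mul_add_distr_l -moment_chi4 -moment_const -momentD -momentZ.
apply: eqm_moment => // n Dn.
have := @chi4_exp2_mul 0 (N %/ n) (dvdn_odd (dvdn_div Dn) oN); rewrite mul1n.
have := ZOdd_of_nat (dvdn_odd (dvdn_div Dn) oN).
by case: (is_sign_chi4 (N %/ n)) => -> [m ->]; clear; zmod_lia.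
Qed.

Lemma cofactor_exp2 i N1 n : odd N1 -> N = 2 ^ i * N1 -> n %| N -> exists j j' o o',
  [/\ j + j' = i, odd o, odd o', N1 = o * o' & n = 2 ^ j * o /\ N %/ n = 2 ^ j' * o'].
Proof.
move=> oN1 NE Dn; have n0 := dvdn_gt0 N0 Dn; have m0 := divn_gt0_dvd N0 Dn.
have [o oo nE] := odd_part n0; have [o' oo' mE] := odd_part m0.
have logE : logn 2 n + logn 2 (N %/ n) = i.
  by rewrite -lognM // mulnC divnK // NE logn2_exp2_mul.
exists (logn 2 n), (logn 2 (N %/ n)), o, o'; split=> //.
have : n * (N %/ n) = 2 ^ i * N1 by rewrite mulnC divnK.
rewrite {1}nE {1}mE mulnACA -expnD logE => /eqP.
by rewrite eqn_pmul2l ?expn_gt0 // => /eqP.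
Qed.

Lemma twice_weight_delta_2odd N1 : odd N1 -> N = 2 * N1 ->
  (rho + Z.of_nat N1 * X + S ≡ 0 %[mod 4])%Z.
Proof.
move=> oN1 NE; suff : (2 * (rho + Z.of_nat N1 * X + S) ≡ 0 %[mod 8])%Z by clear; zmod_lia.
have -> : (2 * (rho + Z.of_nat N1 * X + S) = 2 * sumr N r + 2 * (1 - chi4 (varpi N r))
    + 2 * Z.of_nat N1 * X + 2 * S)%Z by rewrite /twice_weight_delta; ring.
rewrite -moment_chi4 -moment_const xN_moment -!momentZ -!momentD.
rewrite -(Z.mul_0_l (sumr N r)) -moment_const; apply: eqm_moment => // n Dn.
have [j [j' [o [o' [jj' oo oo' -> [-> ->]]]]]] := @cofactor_exp2 1 N1 n oN1 NE Dn.
have := chi4_exp2_mul j' oo'; move: (chi4 _) => c.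
have := ZOdd_sqr_eqm8 (ZOdd_of_nat oo); have := ZOdd_of_nat oo'.
have [[-> ->]|[-> ->]] : j = 0 /\ j' = 1 \/ j = 1 /\ j' = 0 by lia.
all: rewrite !Nat2Z.inj_mul; move: (Z.of_nat o) (Z.of_nat o') => u u' odd' uu cu.
- have -> : (2 * (u * u') * (Z.of_nat (2 ^ 0) * u) = 2 * (u * u) * u')%Z by lia.
  by rewrite uu; case: odd' cu => w -> ; clear; zmod_lia.
have -> : (2 * (u * u') * (Z.of_nat (2 ^ 1) * u) = 4 * (u * u) * u')%Z by lia.
by rewrite uu; case: odd' cu => w -> ; clear; zmod_lia.
Qed.

Lemma logn2_varpi_2odd N1 : odd N1 -> N = 2 * N1 -> (v2 ≡ X %[mod 2])%Z.
Proof.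
move=> oN1 NE; rewrite -moment_logn2; apply: eqm_moment => // n Dn.
have [j [j' [o [o' [jj' oo oo' _ [-> ->]]]]]] := @cofactor_exp2 1 N1 n oN1 NE Dn.
rewrite logn2_exp2_mul //; case: (ZOdd_of_nat oo) => u E.
have [[-> ->]|[-> ->]] : j = 0 /\ j' = 1 \/ j = 1 /\ j' = 0 by lia.
all: by rewrite Nat2Z.inj_mul E; clear; zmod_lia.
Qed.

Lemma sumr_4odd N2 : odd N2 -> N = 4 * N2 -> (sumr N r + X + S + v2 ≡ 0 %[mod 2])%Z.
Proof.
move=> oN2 NE; rewrite -moment_logn2 -(Z.mul_1_l (sumr N r)) -moment_const xN_moment -!momentD.
rewrite -(Z.mul_0_l (sumr N r)) -moment_const; apply: eqm_moment => // n Dn.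
have [j [j' [o [o' [jj' oo oo' _ [-> ->]]]]]] := @cofactor_exp2 2 N2 n oN2 NE Dn.
rewrite logn2_exp2_mul //; case: (ZOdd_of_nat oo) => u E; case: (ZOdd_of_nat oo') => u' E'.
have [[-> ->]|[[-> ->]|[-> ->]]] :
  j = 0 /\ j' = 2 \/ j = 1 /\ j' = 1 \/ j = 2 /\ j' = 0 by lia.
all: by rewrite !Nat2Z.inj_mul E E'; clear; zmod_lia.
Qed.
End MomentRelations.

(** * The product of two values of the eta multiplier *)

Definition psi_pair (N a b x y : Z) (m d : nat) : Z :=
  (psiZ (a * y) m x - psiZ (- N * b + a * x) (m * d) y)%Z.

(* The contribution of [eta_poly] to [psi_pair] is
   [m * pair_coeff_dual + (N / m) * pair_coeff]. *)
Definition pair_coeff_dual (N a b d x y z : Z) : Z :=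
  (a * y + x - (b * y - d * z) * x * N - d * (a * x - N * b + y) - z * y * d * d * N)%Z.
Definition pair_coeff (b d x y z : Z) : Z := ((b * y - d * z) * x + z * y)%Z.

Section Pair.
Variables (N n a b x y z : Z) (m d : nat).
Hypotheses (NE : N = (n * Z.of_nat m)%Z) (m0 : 0 < m) (d0 : 0 < d).
Hypothesis xyzE : ((- N * b + a * x) * y + N * Z.of_nat d * z = 1)%Z.
Local Notation M := (Z.of_nat m).
Local Notation D := (Z.of_nat d).
Local Notation t := (b * y - D * z)%Z.
Local Notation E := (psi_pair N a b x y m d).
Local Notation poly :=
  (M * pair_coeff_dual N a b D x y z + n * pair_coeff b D x y z)%Z.

Let md0 : 0 < m * d. Proof. by rewrite muln_gt0 m0. Qed.

Let det1 : ((- N * b + a * x) * y - (- (z * n)) * Z.of_nat (m * d) = 1)%Z.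
Proof. by rewrite Nat2Z.inj_mul -xyzE NE; ring. Qed.

Let det2 : (a * y * x - (t * n) * M = 1)%Z.
Proof. by rewrite -xyzE NE; ring. Qed.

Lemma eta_poly_pair : (eta_poly (a * y) (t * n) M x
  - eta_poly (- N * b + a * x) (- (z * n)) (Z.of_nat (m * d)) y = poly)%Z.
Proof.
by rewrite /eta_poly /pair_coeff_dual /pair_coeff Nat2Z.inj_mul NE; ring.
Qed.

Lemma Psi_pair : (0 < n)%Z ->
  (Psi (- N * b + a * x) (z * n) (- N * D / n) y + Psi (a * y) (t * n) (N / n) x = IZR E)%R.
Proof.
move=> n0.
have -> : (- N * D / n = - Z.of_nat (m * d))%Z.
  have -> : (- N * D = - Z.of_nat (m * d) * n)%Z by rewrite NE Nat2Z.inj_mul; ring.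
  by rewrite Z.div_mul //; lia.
have -> : (N / n = M)%Z by rewrite NE Z.mul_comm Z.div_mul //; lia.
rewrite (Psi_psiZ m0 det2) -(Z.opp_involutive (z * n)) (Psi_opp_psiZ md0 det1).
by rewrite /psi_pair minus_IZR; ring.
Qed.

Lemma psi_pair_mod3 : (E ≡ poly %[mod 3])%Z.
Proof. by rewrite -eta_poly_pair /psi_pair (psiZ_mod3 md0 det1) (psiZ_mod3 m0 det2). Qed.

Let sign_y : is_sign (kron y m) /\ is_sign (kron y d).
Proof.
have := coprime_lower_row det1; rewrite coprimeMr => /andP[cm cd].
by split; exact: is_sign_kron.
Qed.

Let sign_x : is_sign (kron x m).
Proof. exact: is_sign_kron (coprime_lower_row det2). Qed.

Let sign_absx : Z.Odd x -> is_sign (kron M (Z.abs_nat x)).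
Proof.
move=> /ZOdd_abs_nat ox; apply: is_sign_kron_nat; first exact: odd_gt0.
by rewrite coprime_sym; exact: coprime_lower_row det2.
Qed.

Let sign_absy : Z.Odd y -> is_sign (kron M (Z.abs_nat y)) /\ is_sign (kron D (Z.abs_nat y)).
Proof.
move=> /ZOdd_abs_nat oy; have := coprime_lower_row det1.
rewrite coprimeMr => /andP[cm cd].
by split; apply: is_sign_kron_nat; rewrite 1?coprime_sym ?odd_gt0.
Qed.

Let axy : (a * (x * y) ≡ 1 %[mod M])%Z.
Proof. by apply/eqm_divide; exists (t * n)%Z; rewrite -det2; ring. Qed.

Lemma two_sub_kron_axy : odd m ->
  (2 * (1 - kron x m) + 2 * (1 - kron y m) ≡ 2 * (1 - kron a m) %[mod 8])%Z.
Proof.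
move=> om; rewrite -two_sub_signM; [|exact: sign_x|by case: sign_y].
by rewrite -kronMl // (kron_inverse_mod om axy).
Qed.

Lemma psi_pair_mod8_odd : odd m -> odd d ->
  (E ≡ poly + 3 * M * (D - 1) + 2 * (1 - kron a m) + 2 * (1 - kron y d) %[mod 8])%Z.
Proof.
move=> om od; have omd : odd (m * d) by rewrite oddM om.
case: sign_y => sym syd.
rewrite -two_sub_kron_axy // -eta_poly_pair /psi_pair.
rewrite (psiZ_mod8_odd_left md0 det1 omd) (psiZ_mod8_odd_left m0 det2 om).
move: (eta_poly _ _ _ _) (eta_poly _ _ _ _) => p1 p2.
rewrite kronMr // (two_sub_signM sym syd) Nat2Z.inj_mul; move: (kron x m) => u.
by case: sym => ->; case: syd => ->; clear; zmod_lia.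
Qed.

Lemma psi_pair_mod8_odd_y : odd m -> Z.Odd y ->
  (E ≡ poly + 3 * M * (D * y + y - 2) + 3 * (2 - 2 * y)
     + 2 * (1 - kron a m) + 2 * (1 - kron D (Z.abs_nat y)) %[mod 8])%Z.
Proof.
move=> om oy; case: sign_y => sym _; case: (sign_absy oy) => sMy sDy.
have cmy : coprime m (Z.abs_nat y).
  by rewrite coprime_sym; have := coprime_lower_row det1; rewrite coprimeMr => /andP[].
rewrite -two_sub_kron_axy // -eta_poly_pair /psi_pair.
rewrite (psiZ_mod8_odd_right md0 det1 oy) (psiZ_mod8_odd_left m0 det2 om).
move: (eta_poly _ _ _ _) (eta_poly _ _ _ _) => p1 p2.
rewrite Nat2Z.inj_mul kronMl; last by apply/odd_gt0/ZOdd_abs_nat.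
rewrite (two_sub_signM sMy sDy) (kron_reciprocity_abs om oy cmy); move: (kron x m) => u.
case: sym => ->; case: sDy => ->; case: (oy) => v ->; case: (ZOdd_of_nat om) => w ->.
all: by clear; zmod_lia.
Qed.

Lemma psi_pair_mod8_odd_xy : Z.Odd a -> Z.Odd x -> Z.Odd y ->
  (E ≡ poly + 3 * (x - y) + 3 * M * (D * y - x)
     + 2 * (1 - kron a m) + Z.of_nat (logn 2 m) * (2 * (1 - kron (a * (x * y)) 2))
     + (1 - chi4 m) * (x * y - 1) + 2 * (1 - kron D (Z.abs_nat y)) %[mod 8])%Z.
Proof.
move=> oa ox oy; case: (sign_absy oy) => sMy sDy; have sMx := sign_absx ox.
have oxy : Z.Odd (x * y) by case: ox oy => u -> [v ->]; exists (2 * u * v + u + v)%Z; ring.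
have gt0 u : Z.Odd u -> 0 < Z.abs_nat u by move=> ?; apply/odd_gt0/ZOdd_abs_nat.
have := kron_flip m0 oa oxy axy.
rewrite Zabs2Nat.inj_mul kronMr ?gt0 // (two_sub_signM sMx sMy) => flip.
rewrite -eta_poly_pair /psi_pair.
rewrite (psiZ_mod8_odd_right md0 det1 oy) (psiZ_mod8_odd_right m0 det2 ox).
move: (eta_poly _ _ _ _) (eta_poly _ _ _ _) => p1 p2.
rewrite Nat2Z.inj_mul (kronMl M) ?gt0 // (two_sub_signM sMy sDy); move: flip.
move: (kron a m) => u.
move: (_ * (2 * (1 - kron _ 2)))%Z ((1 - chi4 _) * _)%Z => s c.
by case: sMx => ->; case: sMy => ->; case: sDy => ->; clear; zmod_lia.
Qed.
End Pair.

(** * The product modulo 24 *)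

Lemma coprime_mul_sqr u v w : coprime u v -> u * v = w * w -> u = gcdn u w * gcdn u w.
Proof.
move=> cuv E; rewrite muln_gcdl !muln_gcdr.
have -> : gcdn (gcdn (u * u) (u * w)) (gcdn (w * u) (w * w)) = gcdn (u * gcdn u w) (u * gcdn w v).
  by rewrite -E (mulnC w u) !muln_gcdr -!gcdnA.
rewrite -muln_gcdr; have -> : gcdn (gcdn u w) (gcdn w v) = 1; last by rewrite muln1.
apply/eqP; rewrite -dvdn1 -(eqP cuv) dvdn_gcd.
by rewrite (dvdn_trans (dvdn_gcdl _ _) (dvdn_gcdl _ _)) (dvdn_trans (dvdn_gcdr _ _) (dvdn_gcdr _ _)).
Qed.

Lemma mul_sqr_gcd a d s : 0 < a -> a * d = s * s ->
  exists a1 d1, a = gcdn a d * (a1 * a1) /\ d = gcdn a d * (d1 * d1).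
Proof.
move=> a0 E; set g := gcdn a d; have g0 : 0 < g by rewrite gcdn_gt0 a0.
have [a' Ea] := dvdnP (dvdn_gcdl a d); have [d' Ed] := dvdnP (dvdn_gcdr a d).
rewrite -/g in Ea Ed.
have cad : coprime a' d' by rewrite /coprime -(eqn_pmul2r g0) mul1n muln_gcdl -Ea -Ed.
have [s' Es] : exists s', s = s' * g.
  apply/dvdnP; rewrite -(@dvdn_pexp2r _ _ 2) // -!mulnn -E {1}Ea {1}Ed mulnACA.
  exact: dvdn_mull.
have E' : a' * d' = s' * s'.
  apply/eqP; rewrite -(eqn_pmul2r (_ : 0 < g * g)) ?muln_gt0 ?g0 //.
  by rewrite -!(mulnACA _ g) -Ea -Ed -Es E.
exists (gcdn a' s'), (gcdn d' s'); rewrite -(coprime_mul_sqr cad E').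
rewrite -(@coprime_mul_sqr d' a' s') 1?coprime_sym 1?mulnC //.
by rewrite !(mulnC g).
Qed.

Lemma kron_mul_sqrr m u n : 0 < u -> 0 < n -> coprime (Z.abs_nat m) n ->
  kron m (u * (n * n)) = kron m u.
Proof.
move=> u0 n0 cmn; rewrite !kronMr ?muln_gt0 ?n0 //.
by rewrite (is_sign_sqr (is_sign_kron n0 cmn)) Z.mul_1_r.
Qed.

Lemma kron_mul_sqrl (u n m : nat) : 0 < m -> coprime n m ->
  kron (Z.of_nat (u * (n * n))) m = kron (Z.of_nat u) m.
Proof.
move=> m0 cnm; rewrite !Nat2Z.inj_mul !kronMl //.
by rewrite (is_sign_sqr (is_sign_kron_nat m0 cnm)) Z.mul_1_r.
Qed.

Definition delta1Z (N : nat) (r : nat -> Z) (K : Z) (l : nat) : Z :=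
  if [&& ~~ odd l, 4 %| N, Z.odd K & odd (logn 2 (varpi N r))] then 1%Z else 0%Z.

(* [psi_{l, r}(a, b) = e(psi24 / 24)] for [l = a d]. *)
Definition psi24 (N : nat) (r : nat -> Z) (K : Z) (a b d : nat) : Z :=
  let kd := (K + (1 - chi4 (varpi N r)))%Z in
  if odd (a * d) then
    (3 * kd * ((Z.of_nat a * Z.of_nat d - 1) * (Z.of_nat N - 1) - (Z.of_nat d - 1)))%Z
  else if ~~ odd N then
    (- (3 * kd * (Z.of_nat a - 1))
     - 3 * (Z.of_nat N * kd * (1 + delta1Z N r K (a * d)) * Z.of_nat b))%Z
  else 0%Z.

Lemma even_index_eqm0 (a d : nat) v :
  ~~ odd (a * d) -> ((Z.of_nat a * Z.of_nat d - 1) * v ≡ 0 %[mod 8])%Z ->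
  (v ≡ 0 %[mod 8])%Z.
Proof.
move=> el E; have oAD : Z.Odd (Z.of_nat a * Z.of_nat d - 1).
  by exists (Z.of_nat ((a * d) %/ 2) - 1)%Z; lia.
rewrite -(Z.mul_1_l v) -(ZOdd_sqr_eqm8 oAD) -Z.mul_assoc E.
by rewrite Z.mul_0_r.
Qed.

Section HeckeIndex.
Variables (N a d : nat) (r : nat -> Z) (K : Z).
Local Notation A := (Z.of_nat a).
Local Notation D := (Z.of_nat d).
Local Notation NZ := (Z.of_nat N).
Local Notation X := (xN N r).
Local Notation S := (xN_dual N r).
Local Notation R := (sumr N r).
Local Notation W := (varpi N r).
Local Notation kd := (K + (1 - chi4 W))%Z.
Local Notation rho := (twice_weight_delta N r).

Hypothesis weightE : (K ≡ R %[mod 4])%Z.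
Hypothesis sqr_index : Z.Odd R -> exists s, a * d = s * s.
Hypothesis index_X : ((A * D - 1) * X ≡ 0 %[mod 24])%Z.
Hypothesis index_S : ((A * D - 1) * S ≡ 0 %[mod 24])%Z.

Lemma weight_delta_eqm4 : (kd ≡ rho %[mod 4])%Z.
Proof. by rewrite /twice_weight_delta weightE. Qed.

Lemma index_X8 : ((A * D - 1) * X ≡ 0 %[mod 8])%Z.
Proof. exact: (@eqm_mull 3 8 _ _ index_X). Qed.

Lemma index_S8 : ((A * D - 1) * S ≡ 0 %[mod 8])%Z.
Proof. exact: (@eqm_mull 3 8 _ _ index_S). Qed.

Lemma odd_weight_index8 : odd (a * d) -> Z.Odd R -> (A * D ≡ 1 %[mod 8])%Z.
Proof.
move=> ol oR; have [s E] := sqr_index oR.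
have -> : (A * D = Z.of_nat s * Z.of_nat s)%Z by lia.
apply/ZOdd_sqr_eqm8/ZOdd_of_nat.
by move: ol; rewrite E oddM andbb.
Qed.

Lemma weight_delta_index8 u : odd (a * d) ->
  (2 * kd * ((A * D - 1) * u) ≡ 0 %[mod 8])%Z.
Proof.
move=> ol; have [w E] : Z.Odd (A * D) by rewrite -Nat2Z.inj_mul; exact: ZOdd_of_nat.
have [[v RE]|oR] := Z.Even_or_Odd R; last first.
  have -> : (A * D - 1 ≡ 0 %[mod 8])%Z by rewrite odd_weight_index8.
  by rewrite Z.mul_0_r.
rewrite E; move: weightE (is_sign_chi4 W); rewrite RE => KR2 [->|->]; move: KR2; clear; zmod_lia.
Qed.

Lemma weight_lower_odd : odd (a * d) -> (rho * ((A + 1) * (1 - D)) ≡ 0 %[mod 8])%Z.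
Proof.
move=> ol; have := ol; rewrite oddM => /andP[/ZOdd_of_nat oA /ZOdd_of_nat oD].
have [[w RE]|oR] := Z.Even_or_Odd R.
  rewrite /twice_weight_delta RE; case: oA oD => p -> [q ->].
  by case: (is_sign_chi4 W) => ->; clear; zmod_lia.
have AD := odd_weight_index8 ol oR; have DD := ZOdd_sqr_eqm8 oD.
have -> : ((A + 1) * (1 - D) = A * (1 - D * D) + (1 - A * D) * (1 - D))%Z by ring.
by rewrite AD DD /eqm; congr (_ mod _)%Z; ring.
Qed.

Hypothesis N0 : 0 < N.

Lemma even_weight_oddN : odd N -> ~~ odd (a * d) -> Z.Even R.
Proof.
move=> oN el; have : (rho ≡ 0 %[mod 4])%Z.
  by rewrite -(xN_dual_odd_mod4 r N0 oN) (@eqm_mull 2 4 _ _ (even_index_eqm0 el index_S8)).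
rewrite /twice_weight_delta; move: R => R'.
by case: (is_sign_chi4 W) => -> E; exists (R' / 2)%Z; move: E; clear; zmod_lia.
Qed.

Lemma psi24_oddN b : odd N -> odd d -> (3 * S * (D - 1) ≡ - psi24 N r K a b d %[mod 8])%Z.
Proof.
move=> oN od; rewrite /psi24 oN oddM od andbT; case: ifP => [oa|/negbT ea]; last first.
  have el : ~~ odd (a * d) by rewrite oddM negb_and ea.
  by rewrite (even_index_eqm0 el index_S8) Z.mul_0_r.
have := weight_delta_eqm4; rewrite -(xN_dual_odd_mod4 r N0 oN).
have [u NE] := ZOdd_of_nat oN; have := weight_delta_index8 u; rewrite NE oddM oa od => /(_ isT).
case: (ZOdd_of_nat od) => v ->; move: S (1 - chi4 W)%Z => S' k' E1 E2.
have -> : (- (3 * (K + k') * ((A * (2 * v + 1) - 1) * (2 * u + 1 - 1) - (2 * v + 1 - 1)))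
  = - (3 * (2 * (K + k') * ((A * (2 * v + 1) - 1) * u))) + 3 * (K + k') * (2 * v))%Z by ring.
by rewrite E1; move: E2; clear; zmod_lia.
Qed.

Section EvenLevel.
Variable N1 : nat.
Hypothesis NE : N = 2 * N1.
Local Notation M := (Z.of_nat N1).
Local Notation v2 := (Z.of_nat (logn 2 W)).

Let NZE : NZ = (2 * M)%Z.
Proof. by rewrite NE Nat2Z.inj_mul. Qed.

Lemma even_index_level_cases : ~~ odd (a * d) ->
  (rho ≡ 0 %[mod 4])%Z /\ (v2 ≡ 0 %[mod 2])%Z
  \/ exists N2, N1 = 2 * N2 /\ (Z.of_nat N2 * (rho + v2) ≡ 0 %[mod 2])%Z.
Proof.
move=> el; have X0 := even_index_eqm0 el index_X8; have S0 := even_index_eqm0 el index_S8.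
have X4 := @eqm_mull 2 4 _ _ X0; have S4 := @eqm_mull 2 4 _ _ S0.
have [oN1|eN1] := boolP (odd N1); [left; split|right].
- by have := twice_weight_delta_2odd r N0 oN1 NE; rewrite X4 S4 Z.mul_0_r !Z.add_0_r.
- by rewrite (logn2_varpi_2odd r N0 oN1 NE) (@eqm_mull 4 2 _ _ X0).
exists N1./2; split; first by lia.
have [oN2|eN2] := boolP (odd N1./2); last first.
  have -> : Z.of_nat N1./2 = (2 * Z.of_nat (N1./2)./2)%Z by lia.
  by clear; move: (rho + v2)%Z; zmod_lia.
have -> : (rho + v2 ≡ 0 %[mod 2])%Z; last by rewrite Z.mul_0_r.
have NE4 : N = 4 * N1./2 by lia.
have := sumr_4odd r N0 oN2 NE4.
rewrite (@eqm_mull 4 2 _ _ X0) (@eqm_mull 4 2 _ _ S0) !Z.add_0_r => <-.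
rewrite /twice_weight_delta; case: (is_sign_chi4 W) => ->; clear; move: R v2; zmod_lia.
Qed.

(* The correction [delta1] makes [psi] periodic in [b]. *)
Lemma psi24_period : ~~ odd (a * d) ->
  (NZ * kd * (1 + delta1Z N r K (a * d)) ≡ 0 %[mod 8])%Z.
Proof.
move=> el; have k4 := weight_delta_eqm4; rewrite NZE.
have [[r4 v2E]|[N2 [N1E cond]]] := even_index_level_cases el.
  move: k4; rewrite r4; clear; move: kd M (delta1Z _ _ _ _) => k m s.
  by case/eqm_divide => w ->; zmod_lia.
have N4 : 4 %| N by rewrite NE N1E mulnA dvdn_mulr.
rewrite /delta1Z el N4 /=; have -> : M = (2 * Z.of_nat N2)%Z by rewrite N1E Nat2Z.inj_mul.
have : (kd ≡ K %[mod 2])%Z.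
  by case: (is_sign_chi4 W) => ->; clear; move: K; zmod_lia.
have : (kd ≡ rho %[mod 2])%Z := @eqm_mull 2 2 _ _ k4.
move: cond; clear; move: rho kd (Z.of_nat N2) => rho' k m cond E1 E2.
have {cond E1} : (m * (k + v2) ≡ 0 %[mod 2])%Z by rewrite E1.
case: (boolP (Z.odd K)) E2 => [_ _|/negbTE eK] /=; last first.
  have [i ->] : Z.Even K by apply/Z.even_spec; rewrite -Z.negb_odd eK.
  by case/eqm_divide => w -> _; clear; zmod_lia.
have [ov|ev] := boolP (odd (logn 2 W)); first by clear; move: k m; zmod_lia.
have -> : v2 = (2 * Z.of_nat (logn 2 W)./2)%Z by lia.
by move: (Z.of_nat _./2) => v; clear; zmod_lia.
Qed.

Lemma level_4odd_parity N2 : N1 = 2 * N2 -> (Z.of_nat N2 * (X + S + v2 + rho) ≡ 0 %[mod 2])%Z.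
Proof.
move=> N1E; have [oN2|eN2] := boolP (odd N2); last first.
  have -> : Z.of_nat N2 = (2 * Z.of_nat N2./2)%Z by lia.
  by clear; move: (_ + rho)%Z; zmod_lia.
have := sumr_4odd r N0 oN2 (_ : N = 4 * N2); rewrite NE N1E mulnA => /(_ erefl).
rewrite -mulnA -N1E -NE /twice_weight_delta => E.
have -> : (X + S + v2 + (R + (1 - chi4 W)) = R + X + S + v2 + (1 - chi4 W))%Z by ring.
by rewrite E; case: (is_sign_chi4 W) => ->; clear; zmod_lia.
Qed.
End EvenLevel.
End HeckeIndex.

Section HeckePair.
Variables (N a b d : nat) (r : nat -> Z) (K x y z : Z).
Local Notation A := (Z.of_nat a).
Local Notation B := (Z.of_nat b).
Local Notation D := (Z.of_nat d).
Local Notation NZ := (Z.of_nat N).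
Local Notation X := (xN N r).
Local Notation S := (xN_dual N r).
Local Notation R := (sumr N r).
Local Notation W := (varpi N r).
Local Notation g := (gcdn a d).
Local Notation t := (B * y - D * z)%Z.
Local Notation GS := (pair_coeff_dual NZ A B D x y z).
Local Notation GX := (pair_coeff B D x y z).
Local Notation kron_A := (2 * (1 - kron A W))%Z.
Local Notation kron_NB := (2 * (1 - kron (- NZ * B) g))%Z.

Hypotheses (N0 : 0 < N) (a0 : 0 < a) (d0 : 0 < d) (caN : coprime a N).
Hypothesis xyzE : ((- NZ * B + A * x) * y + NZ * D * z = 1)%Z.

Lemma mul_axy : (A * (x * y) = 1 + NZ * t)%Z.
Proof. by rewrite -xyzE; ring. Qed.

Lemma coprime_y_d : coprime (Z.abs_nat y) d.
Proof. by apply/coprime_bezout; exists (- NZ * B + A * x)%Z, (NZ * z)%Z; rewrite -xyzE; ring. Qed.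

Lemma mul_y_NB : (y * (- NZ * B) ≡ 1 %[mod Z.of_nat g])%Z.
Proof.
have [u U] := dvdnP (dvdn_gcdl a d); have [v V] := dvdnP (dvdn_gcdr a d).
apply/eqm_divide; exists (- Z.of_nat u * x * y - NZ * Z.of_nat v * z)%Z.
have AE : A = (Z.of_nat u * Z.of_nat g)%Z by rewrite {1}U Nat2Z.inj_mul.
have DE : D = (Z.of_nat v * Z.of_nat g)%Z by rewrite {1}V Nat2Z.inj_mul.
by move: xyzE AE DE; clear; nsatz.
Qed.

Lemma is_sign_kron_NB : is_sign (kron (- NZ * B) g).
Proof.
have g0 : 0 < g by rewrite gcdn_gt0 a0.
have NBy : (- NZ * B * y ≡ 1 %[mod Z.of_nat g])%Z by rewrite Z.mul_comm; exact: mul_y_NB.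
exact: is_sign_kron (coprime_eqm1 g0 NBy).
Qed.

Definition psi_pair_total : Z :=
  moment N r (fun n => psi_pair NZ A B x y (N %/ n) d).

Lemma psi_pair_total_mod3 : (psi_pair_total ≡ S * GS + X * GX %[mod 3])%Z.
Proof.
rewrite Z.mul_comm (Z.mul_comm X) /xN_dual xN_moment -!momentZ -momentD.
apply: eqm_moment => // n Dn.
rewrite (psi_pair_mod3 (Zof_nat_cofactor Dn) (divn_gt0_dvd N0 Dn) d0 xyzE).
by rewrite (Z.mul_comm GS) (Z.mul_comm GX).
Qed.

Lemma psi_pair_total_odd : odd N -> odd d ->
  (psi_pair_total ≡ S * (GS + 3 * (D - 1)) + X * GX
     + kron_A + R * (2 * (1 - kron y d)) %[mod 8])%Z.
Proof.
move=> oN od; rewrite -moment_kron // (Z.mul_comm R) -moment_const.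
rewrite Z.mul_comm (Z.mul_comm X) /xN_dual xN_moment -!momentZ -!momentD.
apply: eqm_moment => // n Dn; have om := dvdn_odd (dvdn_div Dn) oN.
rewrite (psi_pair_mod8_odd (Zof_nat_cofactor Dn) (divn_gt0_dvd N0 Dn) d0 xyzE om od).
by rewrite /eqm; congr (_ mod _)%Z; ring.
Qed.

Lemma psi_pair_total_odd_y : odd N -> Z.Odd y ->
  (psi_pair_total ≡ S * (GS + 3 * (D * y + y - 2)) + X * GX
     + kron_A + R * (3 * (2 - 2 * y) + 2 * (1 - kron D (Z.abs_nat y))) %[mod 8])%Z.
Proof.
move=> oN oy; rewrite -moment_kron // (Z.mul_comm R) -moment_const.
rewrite Z.mul_comm (Z.mul_comm X) /xN_dual xN_moment -!momentZ -!momentD.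
apply: eqm_moment => // n Dn; have om := dvdn_odd (dvdn_div Dn) oN.
rewrite (psi_pair_mod8_odd_y (Zof_nat_cofactor Dn) (divn_gt0_dvd N0 Dn) d0 xyzE om oy).
by rewrite /eqm; congr (_ mod _)%Z; ring.
Qed.

Lemma psi_pair_total_odd_xy : Z.Odd A -> Z.Odd x -> Z.Odd y ->
  (psi_pair_total ≡ S * (GS + 3 * (D * y - x)) + X * GX
     + kron_A + R * (3 * (x - y) + 2 * (1 - kron D (Z.abs_nat y)))
     + (1 - chi4 W) * (x * y - 1)
     + Z.of_nat (logn 2 W) * (2 * (1 - kron (A * (x * y)) 2)) %[mod 8])%Z.
Proof.
move=> oA ox oy.
have [w xyw] : Z.Odd (x * y) by case: ox oy => u -> [v ->]; exists (2 * u * v + u + v)%Z; ring.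
have -> : (psi_pair_total ≡ moment N r (fun n =>
    (GS + 3 * (D * y - x)) * Z.of_nat (N %/ n) + GX * Z.of_nat n
    + 2 * (1 - kron A (N %/ n)) + (3 * (x - y) + 2 * (1 - kron D (Z.abs_nat y)))
    + w * (2 * (1 - chi4 (N %/ n)))
    + 2 * (1 - kron (A * (x * y)) 2) * Z.of_nat (logn 2 (N %/ n))) %[mod 8])%Z.
  apply: eqm_moment => // n Dn.
  rewrite (psi_pair_mod8_odd_xy (Zof_nat_cofactor Dn) (divn_gt0_dvd N0 Dn) d0 xyzE oA ox oy).
  by rewrite xyw /eqm; congr (_ mod _)%Z; ring.
have logE : (2 * (1 - kron (A * (x * y)) 2) * moment N r (fun n => Z.of_nat (logn 2 (N %/ n)))
    ≡ Z.of_nat (logn 2 W) * (2 * (1 - kron (A * (x * y)) 2)) %[mod 8])%Z.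
  have : is_sign (kron (A * (x * y)) 2).
    apply: is_sign_kron => //; rewrite coprimen2; apply/ZOdd_abs_nat.
    by rewrite xyw; case: oA => u ->; exists (2 * u * w + u + w)%Z; ring.
  have := moment_logn2 r N0; move: (moment _ _ _) (kron _ 2) => v u vE.
  by case=> ->; move: vE; clear; zmod_lia.
rewrite !momentD moment_kron // (momentZ _ _ w) moment_chi4 // !momentZ !moment_const logE.
by rewrite xyw -xN_moment -/(xN_dual N r) /eqm; congr (_ mod _)%Z; ring.
Qed.

Hypothesis weightE : (K ≡ R %[mod 4])%Z.
Hypothesis sqr_index : Z.Odd R -> exists s, a * d = s * s.

Lemma mul_weight_sign u : is_sign u -> (R * (2 * (1 - u)) ≡ K * (2 * (1 - u)) %[mod 8])%Z.
Proof. by move: weightE; move: R => R' KR' [] ->; move: KR'; clear; zmod_lia. Qed.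

Lemma weight_kron_y_d : odd d -> (R * (2 * (1 - kron y d)) ≡ K * kron_NB %[mod 8])%Z.
Proof.
move=> od; rewrite -(mul_weight_sign is_sign_kron_NB).
have [[w ->]|oR] := Z.Even_or_Odd R.
  by case: (is_sign_kron d0 coprime_y_d) => ->; case: is_sign_kron_NB => ->; clear; zmod_lia.
have [s] := sqr_index oR; case/(mul_sqr_gcd a0) => a1 [d1 [_ dE]].
have og : odd g by apply: dvdn_odd (dvdn_gcdr a d) od.
have d10 : 0 < d1 by move: d0; rewrite {1}dE !muln_gt0 => /andP[_ /andP[]].
have cyd1 : coprime (Z.abs_nat y) d1.
  by have := coprime_y_d; rewrite {1}dE !coprimeMr => /andP[_ /andP[]].
have -> : kron y d = kron y g by rewrite {1}dE kron_mul_sqrr // odd_gt0.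
by rewrite (kron_inverse_mod og mul_y_NB).
Qed.

Lemma weight_kron_D_y : odd a -> Z.Odd y ->
  (R * (2 * (1 - kron D (Z.abs_nat y))) ≡ K * kron_NB + R * ((A - 1) * (y - 1)) %[mod 8])%Z.
Proof.
move=> oa oy; rewrite -(mul_weight_sign is_sign_kron_NB).
have y0 : 0 < Z.abs_nat y by apply/odd_gt0/ZOdd_abs_nat.
have cdy : coprime d (Z.abs_nat y) by rewrite coprime_sym coprime_y_d.
have [[w ->]|oR] := Z.Even_or_Odd R.
  move: oy; case: is_sign_kron_NB => ->; case: (is_sign_kron_nat y0 cdy) => ->.
  1-4: by case: (ZOdd_of_nat oa) => u -> [v ->]; clear; zmod_lia.
have [s] := sqr_index oR; case/(mul_sqr_gcd a0) => a1 [d1 [aE dE]].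
have og : odd g by apply: dvdn_odd (dvdn_gcdl a d) oa.
have [cgy cd1y] : coprime g (Z.abs_nat y) /\ coprime d1 (Z.abs_nat y).
  by have := cdy; rewrite {1}dE !coprimeMl => /andP[-> /andP[->]].
have -> : kron D (Z.abs_nat y) = kron (Z.of_nat g) (Z.abs_nat y).
  by rewrite {1}dE kron_mul_sqrl.
rewrite (kron_reciprocity_abs og oy cgy) (kron_inverse_mod og mul_y_NB).
have : (A ≡ Z.of_nat g %[mod 8])%Z.
  rewrite {1}aE !Nat2Z.inj_mul (ZOdd_sqr_eqm8 (ZOdd_of_nat _)) ?Z.mul_1_r //.
  by have := oa; rewrite {1}aE !oddM => /andP[_ /andP[]].
by move=> ->; rewrite /eqm; congr (_ mod _)%Z; ring.
Qed.

Local Notation defect := (X - NZ * S)%Z.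
Local Notation linear_part := (S * GS + X * GX)%Z.

Lemma pair_coeff_sum : (linear_part = B * D * X + defect * (GX - B * D)
  + ((A * D - 1) * S) * (D * y - x) + (1 - D * D) * (S * A * y + S * z * y * NZ))%Z.
Proof. by move: xyzE; rewrite /pair_coeff_dual /pair_coeff; move: S X; clear; nsatz. Qed.

Lemma mul_pair_coeff : (defect * (GX - B * D) = NZ * D * y * t * t * defect
  - ((A * D - 1) * defect) * x * y * y * t - defect * x * t * (y * y - 1)
  + defect * B * D * (y * y - 1) - defect * z * y * (D * D - 1))%Z.
Proof. by move: xyzE; rewrite /pair_coeff_dual /pair_coeff; move: S X; clear; nsatz. Qed.

Hypothesis index_X : ((A * D - 1) * X ≡ 0 %[mod 24])%Z.
Hypothesis index_S : ((A * D - 1) * S ≡ 0 %[mod 24])%Z.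

Let indexX8 : ((A * D - 1) * X ≡ 0 %[mod 8])%Z := index_X8 index_X.
Let indexS8 : ((A * D - 1) * S ≡ 0 %[mod 8])%Z := index_S8 index_S.

Lemma pair_coeff_sum_eqm k : ((A * D - 1) * S ≡ 0 %[mod k])%Z -> (D * D ≡ 1 %[mod k])%Z ->
  (linear_part ≡ B * D * X + defect * (GX - B * D) %[mod k])%Z.
Proof.
move=> kS DD; rewrite pair_coeff_sum kS DD.
by rewrite /eqm; congr (_ mod _)%Z; ring.
Qed.

Lemma mul_pair_coeff_eqm k : ((A * D - 1) * S ≡ 0 %[mod k])%Z ->
  ((A * D - 1) * X ≡ 0 %[mod k])%Z -> (D * D ≡ 1 %[mod k])%Z -> (y * y ≡ 1 %[mod k])%Z ->
  (defect * (GX - B * D) ≡ NZ * D * y * t * t * defect %[mod k])%Z.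
Proof.
move=> kS kX DD yy; rewrite mul_pair_coeff DD yy.
have -> : ((A * D - 1) * defect ≡ 0 %[mod k])%Z.
  have -> : ((A * D - 1) * defect = (A * D - 1) * X - NZ * ((A * D - 1) * S))%Z by ring.
  by rewrite kX kS Z.mul_0_r.
by rewrite /eqm; congr (_ mod _)%Z; ring.
Qed.

Lemma psi_pair_total_eqm3 : (psi_pair_total ≡ B * D * X %[mod 3])%Z.
Proof.
rewrite psi_pair_total_mod3.
have lX3 : ((A * D - 1) * X ≡ 0 %[mod 3])%Z := @eqm_mull 8 3 _ _ index_X.
have lS3 : ((A * D - 1) * S ≡ 0 %[mod 3])%Z := @eqm_mull 8 3 _ _ index_S.
have [AD|AD] := Z.eq_dec ((A * D - 1) mod 3) 0; last first.
  have cancel v : ((A * D - 1) * v ≡ 0 %[mod 3])%Z -> (v ≡ 0 %[mod 3])%Z.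
    move=> E; rewrite -(Z.mul_1_l v) -(sqr_eqm1_mod3 AD) -Z.mul_assoc E.
    by rewrite Z.mul_0_r.
  by rewrite (cancel _ lX3) (cancel _ lS3) Z.mul_0_r.
have unit3 u v : (u * v ≡ 1 %[mod 3])%Z -> (u * u ≡ 1 %[mod 3])%Z.
  by move=> E; apply: sqr_eqm1_mod3 => u3; move: E; rewrite u3.
have DD : (D * D ≡ 1 %[mod 3])%Z.
  by apply: (unit3 _ A); move: AD; rewrite Z.mul_comm; clear; move: (_ * _)%Z; zmod_lia.
rewrite (pair_coeff_sum_eqm lS3 DD).
have [N3|N3] := Z.eq_dec (NZ mod 3) 0.
  rewrite (mul_pair_coeff_eqm lS3 lX3 DD) ?(N3 : (NZ ≡ 0 %[mod 3])%Z).
    by rewrite -!Z.mul_assoc !Z.mul_0_l Z.add_0_r.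
  apply: (unit3 _ (A * x)%Z); rewrite -xyzE.
  have -> : (y * (A * x) = (A * (x * y)))%Z by ring.
  by rewrite mul_axy xyzE (N3 : (NZ ≡ 0 %[mod 3])%Z).
have -> : (defect ≡ 0 %[mod 3])%Z; last by rewrite Z.mul_0_l Z.add_0_r.
rewrite (@xN_dual_eqm N r N0 3) => [|n Dn].
  rewrite Z.mul_assoc (sqr_eqm1_mod3 N3); clear; move: X => X'; zmod_lia.
apply: sqr_eqm1_mod3; rewrite /eqm => n3; apply: N3.
by rewrite (Zof_nat_cofactor Dn) Z.mul_mod // n3.
Qed.

Local Notation kd := (K + (1 - chi4 W))%Z.
Local Notation rho := (twice_weight_delta N r).

Lemma psi_pair_total_oddN : odd N ->
  (psi_pair_total ≡ B * D * X - psi24 N r K a b d + kron_A + K * kron_NB %[mod 8])%Z.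
Proof.
move=> oN; have SE := xN_dual_odd r N0 oN.
have [od|ed] := boolP (odd d).
  have DD := ZOdd_sqr_eqm8 (ZOdd_of_nat od).
  have QE : (linear_part ≡ B * D * X %[mod 8])%Z.
    rewrite (pair_coeff_sum_eqm indexS8 DD) SE Z.mul_assoc (ZOdd_sqr_eqm8 (ZOdd_of_nat oN)).
    by rewrite Z.mul_1_l Z.sub_diag Z.mul_0_l Z.add_0_r.
  rewrite psi_pair_total_odd // weight_kron_y_d // -QE.
  rewrite -(Z.add_opp_r _ (psi24 _ _ _ _ _ _)) -(psi24_oddN weightE sqr_index index_S N0 b) //.
  by rewrite /eqm; congr (_ mod _)%Z; ring.
have el : ~~ odd (a * d) by rewrite oddM negb_and ed orbT.
have oy : Z.Odd y.
  by apply/ZOdd_abs_nat; rewrite -coprimen2; apply: coprime_dvdr coprime_y_d; rewrite dvdn2.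
have S0 := even_index_eqm0 el indexS8; have X0 := even_index_eqm0 el indexX8.
rewrite psi_pair_total_odd_y // -(mul_weight_sign is_sign_kron_NB) /psi24 (negPf el) oN S0 X0 /=.
have [w ->] := (even_weight_oddN index_S N0) oN el.
have cdy : coprime d (Z.abs_nat y) by rewrite coprime_sym coprime_y_d.
case: (is_sign_kron_nat (odd_gt0 (proj1 (ZOdd_abs_nat y) oy)) cdy) => ->.
  by case: is_sign_kron_NB => ->; case: oy => v ->; clear; zmod_lia.
by case: is_sign_kron_NB => ->; case: oy => v ->; clear; zmod_lia.
Qed.

Section EvenLevel.
Variable N1 : nat.
Hypothesis NE : N = 2 * N1.
Local Notation M := (Z.of_nat N1).
Local Notation v2 := (Z.of_nat (logn 2 W)).

Lemma odd_axy_evenN : [/\ odd a, Z.Odd A, Z.Odd x & Z.Odd y].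
Proof.
have oa : odd a by rewrite -coprimen2; apply: coprime_dvdr caN; rewrite NE dvdn_mulr.
have oAxy : Z.Odd (A * (x * y)) by rewrite mul_axy NE; exists (M * t)%Z; lia.
have [oA oxy] : Z.Odd A /\ Z.Odd (x * y).
  by move: oAxy; rewrite -!Z.odd_spec Z.odd_mul => /andP.
by split=> //; move: oxy; rewrite -!Z.odd_spec Z.odd_mul => /andP[].
Qed.

Lemma two_sub_kron_axy2 :
  (2 * (1 - kron (A * (x * y)) 2) ≡ 2 * (M * t * (1 + M * t)) %[mod 8])%Z.
Proof.
have -> : (A * (x * y) = 2 * (M * t) + 1)%Z by rewrite mul_axy NE Nat2Z.inj_mul; ring.
have := @kron_n_2 (2 * (M * t) + 1) (ex_intro _ _ erefl); move: (M * t)%Z => s; move: (kron _ _) => u.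
by clear; zmod_lia.
Qed.

Lemma psi_pair_total_evenN : (psi_pair_total ≡ linear_part + 3 * (S * (D * y - x))
  + 3 * rho * (NZ * t * (x + 2) + (A - 1)) + v2 * (2 * (M * t * (1 + M * t)))
  + kron_A + K * kron_NB %[mod 8])%Z.
Proof.
have [oa oA ox oy] := odd_axy_evenN.
rewrite psi_pair_total_odd_xy // two_sub_kron_axy2 Z.mul_add_distr_l (Z.mul_add_distr_l R).
rewrite weight_kron_D_y //.
have -> : (NZ * t * (x + 2) + (A - 1) ≡ x - y + (A - 1) * (y - 1) %[mod 8])%Z.
  have -> : (NZ * t = A * (x * y) - 1)%Z by rewrite mul_axy; ring.
  have xx := ZOdd_sqr_eqm8 ox.
  have -> : ((A * (x * y) - 1) * (x + 2) + (A - 1)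
     = A * y * (x * x) + 2 * A * x * y - x + A - 3)%Z by ring.
  by rewrite xx; case: oA ox oy => p -> [q ->] [s ->]; clear; zmod_lia.
move: (K * kron_NB)%Z (v2 * _)%Z kron_A => u1 u2 u3; move: GS GX (xN_dual N r) (xN N r).
rewrite /twice_weight_delta; move: R (is_sign_chi4 W) => R' sW gs gx S' X'.
case: oA ox oy => p -> [q ->] [s ->].
by case: sW => ->; clear; zmod_lia.
Qed.

Let NZE : NZ = (2 * M)%Z.
Proof. by rewrite NE Nat2Z.inj_mul. Qed.

Lemma even_index_remainder : ~~ odd (a * d) ->
  (3 * rho * (NZ * t * (x + 2)) + v2 * (2 * (M * t * (1 + M * t))) ≡ 0 %[mod 8])%Z.
Proof.
move=> el; have [_ _ ox _] := odd_axy_evenN; rewrite NZE.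
have [[r4 v2E]|[N2 [-> cond]]] := (even_index_level_cases index_X index_S N0 NE) el.
  have := Zmul_succ_even (M * t); move: r4 v2E; clear; move: rho v2 M t => rho' v' m s.
  move=> /eqm_divide [j ->] /eqm_divide [i ->] /eqm_divide [w]; rewrite (Z.add_comm _ 1) => ->.
  by zmod_lia.
move: cond ox; clear; rewrite Nat2Z.inj_mul; move: rho v2 (Z.of_nat N2) t => rho' v' m s.
case/eqm_divide => w E [p ->]; apply/eqm_divide.
exists (s * (m * rho' * (3 * p + 4) + m * m * s * v' + w))%Z.
by have := congr1 (Z.mul s) E; lia.
Qed.

Lemma psi_pair_total_evenN_even : ~~ odd (a * d) ->
  (psi_pair_total ≡ B * D * X - psi24 N r K a b d + kron_A + K * kron_NB %[mod 8])%Z.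
Proof.
move=> el; rewrite psi_pair_total_evenN /psi24 (negPf el) NE oddM /= -NE.
rewrite (psi24_period weightE index_X index_S N0 NE) //.
rewrite (even_index_eqm0 el indexX8) (even_index_eqm0 el indexS8).
have := even_index_remainder el; have := weight_delta_eqm4 weightE.
have [_ [p ->] _ _] := odd_axy_evenN.
move: (K * kron_NB)%Z kron_A => u1 u2; move: (v2 * _)%Z (NZ * t * (x + 2))%Z rho kd => u3 u4 rho' k.
by clear; zmod_lia.
Qed.

Lemma mul_Dy_eqm u : ((A * D - 1) * u ≡ 0 %[mod 8])%Z ->
  (u * (D * y) ≡ u * (x * (1 + NZ * t)) %[mod 8])%Z.
Proof.
move=> E; have [_ oA ox _] := odd_axy_evenN.
rewrite -mul_axy; apply: eqm_sub0.
have -> : (u * (D * y) - u * (x * (A * (x * y)))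
  = A * y * ((A * D - 1) * u) - u * D * y * (A * A - 1) - u * y * A * (x * x - 1))%Z by ring.
by rewrite E (ZOdd_sqr_eqm8 oA) (ZOdd_sqr_eqm8 ox) /eqm; congr (_ mod _)%Z; ring.
Qed.

Lemma odd_index_remainder_2odd : odd (a * d) -> odd N1 ->
  (t * (t * (X * (D * y)) - 2 * M * t * (S * (D * y)) + 3 * rho * (x + 2) + 3 * x * S
     + v2 * (1 + M * t)) ≡ 0 %[mod 4])%Z.
Proof.
move=> ol oN1; have [_ _ ox _] := odd_axy_evenN.
rewrite (@eqm_mull 2 4 _ _ (mul_Dy_eqm indexX8)).
rewrite (@eqm_mull 2 4 _ _ (mul_Dy_eqm indexS8)) NZE.
case/eqm_divide: (twice_weight_delta_2odd r N0 oN1 NE) => j rhoE.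
have -> : (rho = 4 * j - M * X - S)%Z by move: rhoE; clear; lia.
case/eqm_divide: (logn2_varpi_2odd r N0 oN1 NE) => i ->.
case: (ZOdd_of_nat oN1) => n ->; case: ox => p ->; clear; move: X S => X' S'.
by case: (Z.Even_or_Odd t) => -[s ->]; clear; zmod_lia.
Qed.

Lemma odd_index_remainder : odd (a * d) ->
  (NZ * D * y * t * t * defect + 3 * (S * (x * (NZ * t)))
    + 3 * (rho * (NZ * t * (x + 2) + A - D + (A * D - 1) * (NZ - 1)))
    + v2 * (2 * (M * t * (1 + M * t))) ≡ 0 %[mod 8])%Z.
Proof.
move=> ol; have [_ oA ox oy] := odd_axy_evenN.
have oD : Z.Odd D by apply: ZOdd_of_nat; move: ol; rewrite oddM => /andP[].
have [oN1|eN1] := boolP (odd N1).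
  have rhoAD : ((A * D - 1) * rho ≡ 0 %[mod 8])%Z.
    case/eqm_divide: (twice_weight_delta_2odd r N0 oN1 NE) => j rhoE.
    have -> : ((A * D - 1) * rho = 4 * j * (A * D - 1) - M * ((A * D - 1) * X)
      - (A * D - 1) * S)%Z by move: rhoE; clear; nsatz.
    by rewrite indexX8 indexS8; case: oA oD => p -> [q ->]; clear; zmod_lia.
  set rem := (_ + _ + _ + _)%Z.
  have -> : (rem = 2 * M * (t * (t * (X * (D * y)) - 2 * M * t * (S * (D * y))
     + 3 * rho * (x + 2) + 3 * x * S + v2 * (1 + M * t)))
     + 3 * (D + NZ - 1) * ((A * D - 1) * rho) - 3 * A * rho * (D * D - 1))%Z.
    by rewrite /rem NZE; ring.
  rewrite rhoAD (ZOdd_sqr_eqm8 oD).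
  have := odd_index_remainder_2odd ol oN1; move: (t * _)%Z => T.
  by clear; zmod_lia.
have [N2 N1E] : exists N2, N1 = 2 * N2 by exists N1./2; lia.
have := level_4odd_parity r N0 NE N1E; have := (weight_lower_odd sqr_index) ol.
have -> : NZ = (4 * Z.of_nat N2)%Z by lia.
have -> : M = (2 * Z.of_nat N2)%Z by lia.
move: t X S rho v2 (Z.of_nat N2) => t' X' S' rho' v m.
have -> : (4 * m * t' * (x + 2) + A - D + (A * D - 1) * (4 * m - 1)
  = 4 * m * (t' * (x + 2) + (A * D - 1)) + (A + 1) * (1 - D))%Z by ring.
rewrite (Z.mul_add_distr_l rho') => ->.
case: oA oD ox oy => [p ->] [q ->] [i ->] [j ->] E.
by move: E; clear; case: (Z.Even_or_Odd t') => -[s ->]; clear; zmod_lia.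
Qed.

Lemma psi_pair_total_evenN_odd : odd (a * d) ->
  (psi_pair_total ≡ B * D * X - psi24 N r K a b d + kron_A + K * kron_NB %[mod 8])%Z.
Proof.
move=> ol; have [_ oA ox oy] := odd_axy_evenN.
have oD : Z.Odd D by apply: ZOdd_of_nat; move: ol; rewrite oddM => /andP[].
have DD := ZOdd_sqr_eqm8 oD; have yy := ZOdd_sqr_eqm8 oy.
rewrite psi_pair_total_evenN (pair_coeff_sum_eqm indexS8 DD).
rewrite (mul_pair_coeff_eqm indexS8 indexX8 DD yy).
have SDy : (S * (D * y - x) ≡ S * (x * (NZ * t)) %[mod 8])%Z.
  by rewrite Z.mul_sub_distr_l (mul_Dy_eqm indexS8) /eqm; congr (_ mod _)%Z; ring.
have psiE : (psi24 N r K a b d ≡ 3 * (rho * ((A * D - 1) * (NZ - 1) - (D - 1))) %[mod 8])%Z.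
  rewrite /psi24 ol; have := (weight_delta_eqm4 weightE); case: oA oD => p -> [q ->].
  by move: kd rho; clear; zmod_lia.
rewrite SDy psiE; apply: eqm_sub0; rewrite -(odd_index_remainder ol).
by rewrite /eqm; congr (_ mod _)%Z; ring.
Qed.
End EvenLevel.

Lemma is_sign_kron_varpi : is_sign (kron A W).
Proof.
have [] : 0 < W /\ coprime a W; last exact: is_sign_kron_nat.
apply: (@varpi_closed N r (fun u => 0 < u /\ coprime a u) N0).
- by split=> //; exact: coprimen1.
- by move=> u v [u0 cu] [v0 cv]; rewrite muln_gt0 u0 coprimeMr cu.
move=> n Dn; split; first exact: divn_gt0_dvd.
exact: coprime_dvdr (dvdn_div Dn) caN.
Qed.

Lemma psi_pair_total_eqm24 : (psi_pair_total ≡ B * D * X - psi24 N r K a b d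
  + 6 * (1 - kron A W) + K * (6 * (1 - kron (- NZ * B) g)) %[mod 24])%Z.
Proof.
have : (psi_pair_total ≡ B * D * X - psi24 N r K a b d + kron_A + K * kron_NB %[mod 8])%Z.
  have [oN|eN] := boolP (odd N); first exact: psi_pair_total_oddN.
  have NE : N = 2 * N./2 by lia.
  have [ol|el] := boolP (odd (a * d)); first exact: psi_pair_total_evenN_odd NE ol.
  exact: psi_pair_total_evenN_even NE el.
have : (psi24 N r K a b d ≡ 0 %[mod 3])%Z.
  rewrite /psi24; move: kd (delta1Z _ _ _ _); clear => k v.
  by case: ifP => _; [|case: ifP => _]; zmod_lia.
have := psi_pair_total_eqm3; have := is_sign_kron_NB.
move: (B * D * X)%Z psi_pair_total (psi24 _ _ _ _ _ _) => u v w.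
by case: is_sign_kron_varpi => ->; case=> ->; clear; zmod_lia.
Qed.
End HeckePair.

(** * The exponential and the character values *)

Lemma cexp_add z w : cexp (z + w)%C = (cexp z * cexp w)%C.
Proof.
case: z w => [a b] [c d]; rewrite /cexp /Cplus /Cmult /=.
by rewrite exp_plus cos_plus sin_plus; f_equal; ring.
Qed.

Lemma e_add z w : e (z + w)%C = (e z * e w)%C.
Proof. by rewrite /e Cmult_plus_distr_l cexp_add. Qed.

Lemma eR_add x y : eR (x + y)%R = (eR x * eR y)%C.
Proof. by rewrite /eR RtoC_plus e_add. Qed.

Lemma eRE x : eR x = (cos (2 * PI * x), sin (2 * PI * x))%R.
Proof.
have E : (RtoC (2 * PI) * Ci * RtoC x)%C = (0%R, (2 * PI * x)%R).
  by rewrite /RtoC /Ci /Cmult /=; f_equal; ring.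
by rewrite /eR /e E /cexp /= exp_0; f_equal; ring.
Qed.

Lemma eR_0 : eR 0%R = RtoC 1%R.
Proof. by rewrite eRE Rmult_0_r cos_0 sin_0. Qed.

Lemma e_neq0 z : e z <> RtoC 0%R.
Proof.
move=> E; have := e_add z (- z)%C; rewrite E Cmult_0_l Cplus_opp_r.
by rewrite -/(eR 0) eR_0 => /RtoC_inj; lra.
Qed.

Lemma eR_oppM x : (eR (- x)%R * eR x = RtoC 1%R)%C.
Proof. by rewrite -eR_add Rplus_opp_l eR_0. Qed.

Lemma Cinv_eR x : Cinv (eR x) = eR (- x)%R.
Proof.
by rewrite -[LHS]Cmult_1_l -(eR_oppM x) -Cmult_assoc Cinv_r ?Cmult_1_r //; exact: e_neq0.
Qed.

Lemma eR_INR n : eR (INR n) = RtoC 1%R.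
Proof.
rewrite eRE; have -> : (2 * PI * INR n = 0 + 2 * INR n * PI)%R by ring.
by rewrite cos_period sin_period cos_0 sin_0.
Qed.

Lemma eR_IZR n : eR (IZR n) = RtoC 1%R.
Proof.
have := eR_INR (Z.abs_nat n); rewrite INR_IZR_INZ Zabs2Nat.id_abs.
case: (Z.abs_spec n) => -[_ ->] //; rewrite opp_IZR => E.
by have := eR_oppM (IZR n); rewrite E Cmult_1_l.
Qed.

Lemma eR_half : eR (1 / 2)%R = RtoC (-1)%R.
Proof. by rewrite eRE; have -> : (2 * PI * (1 / 2) = PI)%R by [field]; rewrite cos_PI sin_PI. Qed.

Lemma eR_eq1 w : eR w = RtoC 1%R -> exists n, w = IZR n.
Proof.
move=> E; have := E; rewrite eRE => - [_ /sin_eq_0_0 [k kE]].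
move: E; have {kE} -> : w = (IZR k / 2)%R.
  by apply: (Rmult_eq_reg_l (2 * PI)); [rewrite kE; field|have := PI_RGT_0; lra].
have [[j ->]|[j ->]] := Z.Even_or_Odd k; first by exists j; rewrite mult_IZR; field.
have -> : (IZR (2 * j + 1) / 2 = IZR j + 1 / 2)%R by rewrite plus_IZR mult_IZR; field.
by rewrite eR_add eR_IZR eR_half Cmult_1_l => /RtoC_inj; lra.
Qed.

(* The values of the eta multiplier are powers of [zeta24 1]. *)
Definition zeta24 (n : Z) : C := eR (IZR n / 24)%R.

Lemma zeta24_0 : zeta24 0 = RtoC 1%R.
Proof. by rewrite /zeta24 /Rdiv Rmult_0_l eR_0. Qed.

Lemma zeta24D m n : zeta24 (m + n) = (zeta24 m * zeta24 n)%C.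
Proof. by rewrite /zeta24 -eR_add plus_IZR; congr eR; field. Qed.

Lemma zeta24_eqm m n : (m ≡ n %[mod 24])%Z -> zeta24 m = zeta24 n.
Proof.
case/eqm_divide => w ->; rewrite zeta24D /zeta24 mult_IZR.
by have -> : (IZR w * 24 / 24 = IZR w)%R; [field|rewrite eR_IZR Cmult_1_r].
Qed.

Lemma powerRZ_oppr1_double j : powerRZ (-1) (2 * j) = 1%R.
Proof.
rewrite -Z.add_diag powerRZ_add; last lra.
by rewrite -powerRZ_mult (_ : -1 * -1 = 1)%R ?powerRZ_R1 //; ring.
Qed.

Lemma zeta24_sign u K : is_sign u -> zeta24 (- (K * (6 * (1 - u)))) = RtoC (powerRZ (IZR u) K).
Proof.
case=> ->; first by rewrite !Z.mul_0_r powerRZ_R1 zeta24_0.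
have [[j ->]|[j ->]] := Z.Even_or_Odd K.
  rewrite (zeta24_eqm (n := 0)) ?zeta24_0; last by clear; zmod_lia.
  by rewrite powerRZ_oppr1_double.
rewrite (zeta24_eqm (n := 12)); last by clear; zmod_lia.
rewrite powerRZ_add ?powerRZ_oppr1_double ?powerRZ_1 ?Rmult_1_l; last lra.
by rewrite /zeta24 -eR_half; congr eR; field.
Qed.

Lemma Cpowz_1 n : Cpowz (RtoC 1%R) n = RtoC 1%R.
Proof.
case: n => [//|p|p] /=; rewrite Cpow_1_l // -{1}(Cmult_1_l (/ RtoC 1%R)%C) Cinv_r //.
by move=> /RtoC_inj; lra.
Qed.

Lemma psi_zeta24 N r K a b d : 0 < a -> psi N r K (a * d) a b = zeta24 (psi24 N r K a b d).
Proof.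
move=> a0; rewrite /psi /psi24 /zeta24 mulKn //.
have -> : delta N r = ((1 - IZR (chi4 (varpi N r))) / 2)%R.
  by rewrite /delta /chi4; case: ifP => _; field.
have -> : delta1 N r K (a * d) = IZR (delta1Z N r K (a * d)).
  by rewrite /delta1 /delta1Z; case: ifP.
case: ifP => _; last case: ifP => _; last by rewrite /Rdiv Rmult_0_l eR_0.
- rewrite !INR_IZR_INZ Nat2Z.inj_mul !(mult_IZR, plus_IZR, minus_IZR).
  by congr eR; field.
rewrite !INR_IZR_INZ !(mult_IZR, plus_IZR, minus_IZR, opp_IZR).
by congr eR; field.
Qed.

Lemma dvdn_abs_nat p u : p %| Z.abs_nat u <-> (Z.of_nat p | u)%Z.
Proof.
split=> [/dvdnP[q E]|[q E]]; last by apply/dvdnP; exists (Z.abs_nat q); lia.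
by apply/Z.divide_abs_r; exists (Z.of_nat q); lia.
Qed.

Lemma coprime_prime m n : 0 < n ->
  (forall p, prime p -> p %| m -> p %| n -> False) -> coprime m n.
Proof.
move=> n0 no_prime; apply/negPn/negP => ncop.
have g1 : 1 < gcdn m n by rewrite ltn_neqAle eq_sym ncop gcdn_gt0 n0 orbT.
by apply: (no_prime _ (pdiv_prime g1)); apply: dvdn_trans (pdiv_dvd _) _; rewrite ?dvdn_gcdl ?dvdn_gcdr.
Qed.

(* The witness is the part of [n] prime to [u]. *)
Lemma exists_coprime_affine (u a : Z) (n : nat) : 0 < n ->
  coprime (Z.abs_nat (Z.gcd u a)) n -> exists x, coprime (Z.abs_nat (u + a * x)) n.
Proof.
move=> n0 cua; have [u0|u0] := posnP (Z.abs_nat u).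
  exists 1%Z; have uE : u = 0%Z by lia.
  by move: cua; rewrite uE Z.gcd_0_l Z.mul_1_r Z.add_0_l; congr coprime; lia.
exists (Z.of_nat n`_(\pi(Z.abs_nat u)^')).
apply: coprime_prime => // p p_pr /dvdn_abs_nat pux pn.
have pE : p %| n`_(\pi(Z.abs_nat u)^') = ~~ (p %| Z.abs_nat u).
  have := mem_primes p (n`_(\pi(Z.abs_nat u)^')).
  rewrite primes_part mem_filter !mem_primes p_pr part_gt0 n0 pn /= andbT => <-.
  by rewrite !inE /= mem_primes p_pr u0.
case: (boolP (p %| Z.abs_nat u)) pE => pu; last first.
  rewrite -{1}(Zabs2Nat.id (n`_ _)) => /dvdn_abs_nat px; move/negP: pu; apply; apply/dvdn_abs_nat.
  by apply: Z.divide_add_cancel_r (Z.divide_mul_r _ a _ px) _; rewrite Z.add_comm.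
have /dvdn_abs_nat := Z.divide_add_cancel_r _ _ _ (proj1 (dvdn_abs_nat _ _) pu) pux.
rewrite Zabs2Nat.inj_mul Zabs2Nat.id Euclid_dvdM // => /orP[/dvdn_abs_nat pa|-> //] _.
have /dvdn_abs_nat pg := Z.gcd_greatest _ _ _ (proj1 (dvdn_abs_nat _ _) pu) pa.
have : p %| gcdn (Z.abs_nat (Z.gcd u a)) n by rewrite dvdn_gcd pg.
by rewrite (eqP cua) Euclid_dvd1.
Qed.

Lemma in_Lr_index N r l : in_Lr N r l ->
  ((Z.of_nat l - 1) * xN N r ≡ 0 %[mod 24])%Z
  /\ ((Z.of_nat l - 1) * xN_dual N r ≡ 0 %[mod 24])%Z.
Proof.
case=> _ []; rewrite /m_r -/(xN_dual N r).
set G := Z.gcd 24 _.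
have [u uE] : (G | 24)%Z by exact: Z.gcd_divide_l.
have GXS : (G | Z.gcd (xN_dual N r) (xN N r))%Z by exact: Z.gcd_divide_r.
have [v ->] := Z.divide_trans _ _ _ GXS (Z.gcd_divide_l _ _).
have [w ->] := Z.divide_trans _ _ _ GXS (Z.gcd_divide_r _ _).
have G0 : (G <> 0)%Z by move=> E; rewrite E in uE; lia.
rewrite {1}uE Z.div_mul // => uD _.
have [q ->] : (u | Z.of_nat l - 1)%Z by apply/Z.mod_divide => // E; rewrite E in uE; lia.
by split; apply/eqm_divide; [exists (q * w)%Z|exists (q * v)%Z]; rewrite uE; ring.
Qed.

Lemma chi_eps1 N r u v w z :
  chi N r u v w z 1 =
  eR (/ 24 * sumR (divisors N)
    (fun n => IZR (r n) * Psi u (v * Z.of_nat n) (w / Z.of_nat n) z))%R.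
Proof. by rewrite /chi Cpowz_1 Cmult_1_l. Qed.

Section HeckeMultiplier.
Variables (N a b d : nat) (r : nat -> Z) (K : Z).
Local Notation A := (Z.of_nat a).
Local Notation B := (Z.of_nat b).
Local Notation D := (Z.of_nat d).
Local Notation NZ := (Z.of_nat N).
Hypotheses (N0 : 0 < N) (a0 : 0 < a) (d0 : 0 < d) (caN : coprime a N).

Lemma chi_inv_pair x y z : ((- NZ * B + A * x) * y + NZ * D * z = 1)%Z ->
  (Cinv (chi N r (- NZ * B + A * x) z (- NZ * D) y 1) *
   Cinv (chi N r (A * y) (B * y - D * z) NZ x 1)
   = zeta24 (- psi_pair_total N a b d r x y))%C.
Proof.
move=> xyzE; rewrite !chi_eps1 !Cinv_eR -eR_add /zeta24; congr eR.
rewrite opp_IZR -Ropp_plus_distr -Rmult_plus_distr_l Rmult_comm Ropp_mult_distr_l.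
congr (- _ * _)%R; rewrite /psi_pair_total /moment /sumR /sumZ.
have : {subset divisors N <= divisors N} by [].
elim: {1 3 4 5}(divisors N) => [|n s IH] sub /=; first by rewrite Rplus_0_r.
rewrite plus_IZR mult_IZR -IH => [|m ms]; last by apply: sub; rewrite inE ms orbT.
have Dn : n %| N by rewrite dvdn_divisors // sub ?mem_head.
have n0 : (0 < Z.of_nat n)%Z by have := dvdn_gt0 N0 Dn; lia.
rewrite -(Psi_pair (Zof_nat_cofactor Dn) (divn_gt0_dvd N0 Dn) d0 xyzE n0); ring.
Qed.

Hypothesis weightE : (K ≡ sumr N r %[mod 4])%Z.
Hypothesis l_in_Lr : in_Lr N r (a * d).

Lemma chi_inv_pairE x y z : ((- NZ * B + A * x) * y + NZ * D * z = 1)%Z ->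
  (Cinv (chi N r (- NZ * B + A * x) z (- NZ * D) y 1) *
   Cinv (chi N r (A * y) (B * y - D * z) NZ x 1)
   = RtoC (IZR (kron A (varpi N r))) *
     RtoC (powerRZ (IZR (kron (- NZ * B) (gcdn a d))) K) *
     zeta24 (- (B * D * xN N r)) * psi N r K (a * d) a b)%C.
Proof.
move=> xyzE; have := in_Lr_index l_in_Lr; rewrite Nat2Z.inj_mul => -[index_X index_S].
have sqr_index : Z.Odd (sumr N r) -> exists s, a * d = s * s.
  by move/Z.odd_spec; case: l_in_Lr => _ [].
have sNB := is_sign_kron_NB a0 xyzE.
have sA := is_sign_kron_varpi r N0 caN.
have totE := psi_pair_total_eqm24 N0 a0 d0 caN xyzE weightE sqr_index index_X index_S.
rewrite chi_inv_pair // psi_zeta24 // -(powerRZ_1 (IZR (kron A _))) -!zeta24_sign // -!zeta24D.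
by apply: zeta24_eqm; rewrite totE /eqm; congr (_ mod _)%Z; ring.
Qed.

Hypothesis cabd : gcdn (gcdn a b) d = 1.

Lemma xyz_exists : exists x y z, ((- NZ * B + A * x) * y + NZ * D * z = 1)%Z.
Proof.
have Nd0 : 0 < N * d by rewrite muln_gt0 N0.
have [|x] := @exists_coprime_affine (- NZ * B)%Z A (N * d) Nd0.
  have -> : Z.abs_nat (Z.gcd (- NZ * B) A) = gcdn a (N * b).
    have -> : (- NZ * B = - Z.of_nat (N * b))%Z by lia.
    rewrite Z.gcd_opp_l Z.gcd_comm; move: (N * b) => c.
    by have := Z.gcd_nonneg A (Z.of_nat c); lia.
  rewrite Gauss_gcdr // coprimeMr /coprime cabd eqxx andbT.
  exact: coprime_dvdl (dvdn_gcdl a b) caN.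
case/coprime_bezout => y [z E]; exists x, y, z; rewrite -E Nat2Z.inj_mul; ring.
Qed.

Lemma xyz_spec : let '(x, y, z) := xyz NZ A B D in
  ((- NZ * B + A * x) * y + NZ * D * z = 1)%Z.
Proof.
have [x [y [z E]]] := xyz_exists; rewrite /xyz; set P := fun t : Z * Z * Z => _.
by have : P (epsilon (inhabits (0%Z, 0%Z, 0%Z)) P) by apply: epsilon_spec; exists (x, y, z).
Qed.

End HeckeMultiplier.

(** * Series indexed by the integers *)

Local Notation is_Cseries := (@is_series C_AbsRing C_NormedModule).

Lemma is_Cseries_zero : is_Cseries (fun _ => RtoC 0%R) (RtoC 0%R).
Proof.
apply: (filterlim_ext (fun _ : nat => RtoC 0%R)); last exact: filterlim_const.
move=> n; elim: n => [|n IH]; first by rewrite sum_O.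
by rewrite sum_Sn -IH (@plus_zero_r C_AbelianMonoid).
Qed.

Lemma is_Cseries_drop (k : nat) u s : (forall i, i < k -> u i = RtoC 0%R) ->
  is_Cseries u s <-> is_Cseries (fun i => u (k + i)) s.
Proof.
elim: k u => [|k IH] u u0; first by [].
have -> : is_Cseries u s <-> is_Cseries (fun i => u i.+1) s.
  split=> us.
    by apply: (@is_series_incr_1 C_AbsRing); rewrite u0 // (@plus_zero_r C_AbelianMonoid).
  apply: (@is_series_decr_1 C_AbsRing); rewrite u0 // (@opp_zero C_AbelianGroup).
  by rewrite (@plus_zero_r C_AbelianMonoid).
by apply: (IH (fun i => u i.+1)) => i ik; exact: u0.
Qed.

Lemma sum_n_sparse (q : nat) (u : nat -> C) n :
  0 < q -> (forall i, ~~ (q %| i) -> u i = RtoC 0%R) ->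
  sum_n u n = sum_n (fun j => u (q * j)) (n %/ q).
Proof.
move=> q0 u0; elim: n => [|n IH]; first by rewrite div0n !sum_O muln0.
rewrite sum_Sn divnS // IH; case: (boolP (q %| n.+1)) => [D|nD].
  rewrite add1n sum_Sn (_ : q * (n %/ q).+1 = n.+1) //.
  by have := divnK D; rewrite divnS // D add1n mulnC.
by rewrite add0n (u0 _ nD) (@plus_zero_r C_AbelianMonoid).
Qed.

Lemma is_Cseries_sparse (q : nat) (u : nat -> C) s :
  0 < q -> (forall i, ~~ (q %| i) -> u i = RtoC 0%R) ->
  is_Cseries u s <-> is_Cseries (fun j => u (q * j)) s.
Proof.
move=> q0 u0; split=> us.
  apply: (filterlim_ext (fun n => sum_n u (q * n))).
    by move=> n; rewrite (sum_n_sparse _ q0 u0) mulKn.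
  apply: (filterlim_comp _ _ _ (muln q) (sum_n u) eventually eventually) us.
  by move=> P [n0 Pn]; exists n0 => n n0n; apply: Pn; have := leq_pmull n q0; lia.
apply: (filterlim_ext (fun n => sum_n (fun j => u (q * j)) (n %/ q))).
  by move=> n; rewrite (sum_n_sparse _ q0 u0).
apply: (filterlim_comp _ _ _ (fun n => n %/ q) _ eventually eventually) us.
move=> P [n0 Pn]; exists (n0 * q) => n /leP n0n; apply: Pn.
by apply/leP; rewrite leq_divRL.
Qed.

Definition is_zseries (u : Z -> C) (s : C) : Prop := exists M,
  (forall j, (j < - M)%Z -> u j = RtoC 0%R) /\ is_Cseries (fun i => u (Z.of_nat i - M)%Z) s.

Lemma is_zseries_from M u s : (forall j, (j < - M)%Z -> u j = RtoC 0%R) ->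
  is_zseries u s <-> is_Cseries (fun i => u (Z.of_nat i - M)%Z) s.
Proof.
move=> uM.
have shift M1 M2 : (M1 <= M2)%Z -> (forall j, (j < - M1)%Z -> u j = RtoC 0%R) ->
    is_Cseries (fun i => u (Z.of_nat i - M2)%Z) s <->
    is_Cseries (fun i => u (Z.of_nat i - M1)%Z) s.
  move=> M12 uM1; rewrite (@is_Cseries_drop (Z.to_nat (M2 - M1))) => [|i ilt].
    by split; apply: is_series_ext => i; congr u; lia.
  by apply: uM1; lia.
split=> [[M' [uM' us]]|us]; last by exists M.
apply/(shift M (Z.max M M')); [lia|exact: uM|].
by apply/(shift M' (Z.max M M')) => //; lia.
Qed.

Lemma is_zseries_ext u v s : u =1 v -> is_zseries u s -> is_zseries v s.
Proof.
move=> uv [M [uM us]]; exists M; split=> [j jM|]; first by rewrite -uv uM.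
by apply: is_series_ext us => i; rewrite uv.
Qed.

Lemma is_zseries_scal c u s : is_zseries u s -> is_zseries (fun j => c * u j)%C (c * s)%C.
Proof.
move=> [M [uM us]]; exists M; split=> [j jM|]; first by rewrite uM // Cmult_0_r.
exact: (@is_series_scal_l C_AbsRing C_NormedModule c _ _ us).
Qed.

Lemma is_zseries_zero : is_zseries (fun _ => RtoC 0%R) (RtoC 0%R).
Proof. by exists 0%Z; split=> //; exact: is_Cseries_zero. Qed.

Lemma is_zseries_plus u v s s' : is_zseries u s -> is_zseries v s' ->
  is_zseries (fun j => u j + v j)%C (s + s')%C.
Proof.
move=> uz vz; have [M [uM _]] := uz; have [M' [vM' _]] := vz.
have uM2 j : (j < - Z.max M M')%Z -> u j = RtoC 0%R by move=> jM; apply: uM; lia.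
have vM2 j : (j < - Z.max M M')%Z -> v j = RtoC 0%R by move=> jM; apply: vM'; lia.
exists (Z.max M M'); split=> [j jM|]; first by rewrite uM2 // vM2 // Cplus_0_r.
apply: (@is_series_plus C_AbsRing C_NormedModule); exact/is_zseries_from.
Qed.

Lemma is_zseries_sumC (I : seq nat) (u : nat -> Z -> C) (s : nat -> C) :
  (forall i, i \in I -> is_zseries (u i) (s i)) ->
  is_zseries (fun j => sumC I (fun i => u i j)) (sumC I s).
Proof.
elim: I => [|i I IH] us; first exact: is_zseries_zero.
apply: is_zseries_plus; first by apply: us; rewrite mem_head.
by apply: IH => k kI; apply: us; rewrite inE kI orbT.
Qed.

Lemma is_zseries_progression (q : nat) (c : Z) u s : 0 < q ->
  (forall i, (forall j, i <> Z.of_nat q * j + c)%Z -> u i = RtoC 0%R) ->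
  is_zseries u s <-> is_zseries (fun j => u (Z.of_nat q * j + c)%Z) s.
Proof.
move=> q0 u0.
have low M : (forall j, (j < - M)%Z -> u (Z.of_nat q * j + c)%Z = RtoC 0%R) ->
    forall i, (i < - (Z.of_nat q * M - c))%Z -> u i = RtoC 0%R.
  move=> vM i iM; case: (excluded_middle_informative (exists j, i = (Z.of_nat q * j + c)%Z)).
    by case=> j jE; rewrite jE; apply: vM; nia.
  by move=> nj; apply: u0 => j jE; apply: nj; exists j.
have series M : (forall j, (j < - M)%Z -> u (Z.of_nat q * j + c)%Z = RtoC 0%R) ->
    is_zseries u s <-> is_zseries (fun j => u (Z.of_nat q * j + c)%Z) s.
  move=> vM; rewrite (is_zseries_from _ (low M vM)) (is_zseries_from _ vM).
  rewrite (is_Cseries_sparse _ q0) => [|i /negP qi].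
    by split; apply: is_series_ext => j; congr u; lia.
  apply: u0 => j E; apply: qi; rewrite -(Zabs2Nat.id i); apply/dvdn_abs_nat.
  by exists (j + M)%Z; lia.
split=> [[M [uM us]]|[M [vM vs]]]; last by apply/(series M) => //; exists M.
apply/(series (Z.abs M + Z.abs c)%Z); last by exists M.
by move=> j jM; apply: uM; nia.
Qed.

(* Both families are spread out over the integers along their progressions. *)
Lemma is_zseries_reindex (q q' : nat) (c c' : Z) u v s : 0 < q -> 0 < q' ->
  (forall i j, (Z.of_nat q * i + c = Z.of_nat q' * j + c')%Z -> u i = v j) ->
  (forall i, (forall j, Z.of_nat q * i + c <> Z.of_nat q' * j + c')%Z -> u i = RtoC 0%R) ->
  (forall j, (forall i, Z.of_nat q * i + c <> Z.of_nat q' * j + c')%Z -> v j = RtoC 0%R) ->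
  is_zseries u s -> is_zseries v s.
Proof.
move=> q0 q'0 uv u0 v0 us.
pose w k := if ((k - c) mod Z.of_nat q =? 0)%Z then u ((k - c) / Z.of_nat q)%Z else RtoC 0%R.
have wE i : w (Z.of_nat q * i + c)%Z = u i.
  rewrite /w Z.add_simpl_r Z.mul_comm Z.mod_mul; last lia.
  by rewrite Z.div_mul //; lia.
have w0 k : (forall i, k <> Z.of_nat q * i + c)%Z -> w k = RtoC 0%R.
  move=> nk; rewrite /w; case: Z.eqb_spec => // E; case: (nk ((k - c) / Z.of_nat q)%Z).
  by have := Z.div_mod (k - c) (Z.of_nat q); lia.
have wE' j : w (Z.of_nat q' * j + c')%Z = v j.
  case: (excluded_middle_informative (exists i, Z.of_nat q * i + c = Z.of_nat q' * j + c')%Z).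
    by case=> i E; rewrite -E wE; exact: uv.
  move=> nj; rewrite v0 ?w0 // => i E; apply: nj; exists i; lia.
have w0' k : (forall j, k <> Z.of_nat q' * j + c')%Z -> w k = RtoC 0%R.
  move=> nk; case: (excluded_middle_informative (exists i, k = Z.of_nat q * i + c)%Z).
    by case=> i E; rewrite E wE; apply: u0 => j; rewrite -E; exact: nk.
  by move=> ni; apply: w0 => i E; apply: ni; exists i.
apply: is_zseries_ext wE' _; apply/(is_zseries_progression _ q'0 w0').
apply/(is_zseries_progression _ q0 w0); exact: is_zseries_ext (fun i => esym (wE i)) us.
Qed.

Lemma is_Cseries_Re u s : is_Cseries u s -> is_series (fun i => Re (u i)) (Re s).
Proof.
move=> us; apply: (filterlim_ext (fun n => Re (sum_n u n))); last first.
  exact: filterlim_comp us (@continuous_fst R_UniformSpace R_UniformSpace s.1 s.2).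
by elim=> [|n IH]; rewrite ?sum_O // !sum_Sn -IH.
Qed.

Lemma is_Cseries_Im u s : is_Cseries u s -> is_series (fun i => Im (u i)) (Im s).
Proof.
move=> us; apply: (filterlim_ext (fun n => Im (sum_n u n))); last first.
  exact: filterlim_comp us (@continuous_snd R_UniformSpace R_UniformSpace s.1 s.2).
by elim=> [|n IH]; rewrite ?sum_O // !sum_Sn -IH.
Qed.

Lemma power_series_constant_eq0 (a : nat -> R) (w0 : R) : (0 < w0)%R ->
  ex_series (fun i => a i * w0 ^ i)%R ->
  (forall eta, (0 < eta)%R -> exists w, (0 < w < eta)%R /\ is_series (fun i => a i * w ^ i)%R 0%R) ->
  a 0 = 0%R.
Proof.
move=> w00 conv0 zeros.
have radius : Rbar_lt (Rabs 0) (CV_radius a).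
  rewrite Rabs_R0; apply: (Rbar_lt_le_trans (Rbar.Finite 0) (Rbar.Finite w0)) => //.
  apply: Rbar_not_lt_le => small; case: (@CV_disk_outside a w0); last exact: ex_series_lim_0.
  by rewrite Rabs_pos_eq //; lra.
case: (Req_dec (a 0) 0) => // a0; exfalso.
have [|eta [eta0 near]] := PSeries_continuity _ _ radius (Rabs (a 0)).
  exact: Rabs_pos_lt.
have [w [[w1 w2] ws]] := zeros _ eta0.
have : (Rabs (PSeries a w - PSeries a 0) < Rabs (a 0%N))%R.
  apply: near; split; first by split=> //; lra.
  by rewrite /= /Rdist Rminus_0_r Rabs_pos_eq; lra.
rewrite PSeries_0 (is_pseries_unique a w 0); last exact/is_pseries_R.
by rewrite Rminus_0_l Rabs_Ropp; lra.
Qed.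

Lemma power_Cseries_constant_eq0 (a : nat -> C) (w0 : R) s0 : (0 < w0)%R ->
  is_Cseries (fun i => a i * RtoC (w0 ^ i)%R)%C s0 ->
  (forall eta, (0 < eta)%R -> exists w, (0 < w < eta)%R
     /\ is_Cseries (fun i => a i * RtoC (w ^ i)%R)%C (RtoC 0%R)) ->
  a 0 = RtoC 0%R.
Proof.
move=> w00 conv0 zeros.
have re w i : Re (a i * RtoC (w ^ i)%R)%C = (Re (a i) * w ^ i)%R by rewrite /Re /=; ring.
have im w i : Im (a i * RtoC (w ^ i)%R)%C = (Im (a i) * w ^ i)%R by rewrite /Im /=; ring.
have Re0 : Re (a 0) = 0%R.
  apply: (@power_series_constant_eq0 (fun i => Re (a i)) w0) => // [|eta /zeros[w [w1 ws]]].
    by exists (Re s0); apply: is_series_ext (is_Cseries_Re conv0).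
  by exists w; split=> //; apply: is_series_ext (is_Cseries_Re ws).
have Im0 : Im (a 0) = 0%R.
  apply: (@power_series_constant_eq0 (fun i => Im (a i)) w0) => // [|eta /zeros[w [w1 ws]]].
    by exists (Im s0); apply: is_series_ext (is_Cseries_Im conv0).
  by exists w; split=> //; apply: is_series_ext (is_Cseries_Im ws).
by rewrite [a 0]surjective_pairing -/(Re _) Re0 -/(Im _) Im0.
Qed.

Lemma power_Cseries_coef_eq0 (a : nat -> C) (w0 : R) s0 : (0 < w0)%R ->
  is_Cseries (fun i => a i * RtoC (w0 ^ i)%R)%C s0 ->
  (forall eta, (0 < eta)%R -> exists w, (0 < w < eta)%R
     /\ is_Cseries (fun i => a i * RtoC (w ^ i)%R)%C (RtoC 0%R)) ->
  forall n, a n = RtoC 0%R.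
Proof.
move=> w00 conv0 zeros; elim/ltn_ind => n IH.
have divide (w : R) s : (0 < w)%R -> is_Cseries (fun i => a i * RtoC (w ^ i)%R)%C s ->
    is_Cseries (fun i => a (n + i)%N * RtoC (w ^ i)%R)%C (RtoC (/ w ^ n)%R * s)%C.
  move=> w1 ws; have wn : (w ^ n <> 0)%R by apply: pow_nonzero; lra.
  have /(@is_series_scal_l C_AbsRing C_NormedModule (RtoC (/ w ^ n)%R)) :
      is_Cseries (fun i => a (n + i)%N * RtoC (w ^ (n + i))%R)%C s.
    by move: ws; rewrite (@is_Cseries_drop n) // => i /IH ->; rewrite Cmult_0_l.
  apply: is_series_ext => i; rewrite pow_add RtoC_mult.
  change (RtoC (/ w ^ n) * (a (n + i)%N * (RtoC (w ^ n) * RtoC (w ^ i)))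
    = a (n + i)%N * RtoC (w ^ i))%C.
  by rewrite RtoC_inv //; field; move=> /RtoC_inj.
rewrite -(addn0 n); apply: (power_Cseries_constant_eq0 w00 (divide _ _ w00 conv0)).
move=> eta /zeros[w [w1 ws]]; exists w; split=> //.
by have := divide w _ (proj1 w1) ws; rewrite Cmult_0_r.
Qed.

(** * Expansions at infinity *)

Lemma Cminus_eq0 z w : (z - w)%C = RtoC 0%R -> z = w.
Proof. by move=> E; rewrite -[RHS]Cplus_0_l -E; ring. Qed.

Lemma Cmult_eq0 z w : (z * w)%C = RtoC 0%R -> z <> RtoC 0%R -> w = RtoC 0%R.
Proof.
move=> E z0; case: (excluded_middle_informative (w = RtoC 0%R)) => // w0.
by case: (Cmult_neq_0 _ _ z0 w0).
Qed.

Definition is_qseries (rho : Z -> R) (c : Z -> C) (tau s : C) : Prop :=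
  is_zseries (fun j => c j * e (RtoC (rho j) * tau))%C s.

Lemma is_qseries_bounded rho c tau s : is_qseries rho c tau s ->
  exists M, forall j, (j < - M)%Z -> c j = RtoC 0%R.
Proof.
case=> M [cM _]; exists M => j /cM; rewrite Cmult_comm => /Cmult_eq0; apply.
exact: e_neq0.
Qed.

Lemma is_qseries_series M rho c tau s : (forall j, (j < - M)%Z -> c j = RtoC 0%R) ->
  is_qseries rho c tau s <->
  is_Cseries (fun i => c (Z.of_nat i - M)%Z * e (RtoC (rho (Z.of_nat i - M)%Z) * tau))%C s.
Proof.
by move=> cM; rewrite /is_qseries (@is_zseries_from M) // => j /cM ->; rewrite Cmult_0_l.
Qed.

Lemma e_imaginary (rho t : R) : e (RtoC rho * (0%R, t))%C = RtoC (exp (- (2 * PI * rho * t))).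
Proof.
rewrite /e (_ : (RtoC (2 * PI) * Ci * (RtoC rho * (0%R, t)))%C = RtoC (- (2 * PI * rho * t))%R).
  by rewrite /cexp /RtoC /= cos_0 sin_0; f_equal; ring.
by rewrite /RtoC /Ci /Cmult /=; f_equal; ring.
Qed.

Lemma is_qseries_coef_eq0 rho (al be : R) c : (0 < be)%R ->
  (forall j, rho j = al + be * IZR j)%R ->
  (exists t s, is_qseries rho c (0%R, t) s) ->
  (forall T : R, exists t : R, (T < t)%R /\ is_qseries rho c (0%R, t) (RtoC 0%R)) ->
  forall j, c j = RtoC 0%R.
Proof.
move=> be0 rhoE [t0 [s0 conv0]] zeros; have [M cM] := is_qseries_bounded conv0.
pose w t := exp (- (2 * PI * be * t)).
have powers t s : is_qseries rho c (0%R, t) s ->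
    is_Cseries (fun i => c (Z.of_nat i - M)%Z * RtoC (w t ^ i)%R)%C
      (RtoC (exp (2 * PI * (al - be * IZR M) * t)) * s)%C.
  move/(is_qseries_series _ _ _ cM).
  move/(@is_series_scal_l C_AbsRing C_NormedModule (RtoC (exp (2 * PI * (al - be * IZR M) * t)))).
  apply: is_series_ext => i; rewrite rhoE e_imaginary.
  rewrite [LHS]Cmult_assoc (Cmult_comm (RtoC _)) -Cmult_assoc -RtoC_mult; congr (_ * RtoC _)%C.
  rewrite -exp_plus -Rpower_pow ?/Rpower ?ln_exp; last exact: exp_pos.
  by congr exp; rewrite minus_IZR -INR_IZR_INZ; ring.
have coef0 n : c (Z.of_nat n - M)%Z = RtoC 0%R.
  apply: (@power_Cseries_coef_eq0 (fun i => c (Z.of_nat i - M)%Z) (w t0) _ _ (powers _ _ conv0)).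
    exact: exp_pos.
  move=> eta eta0; have [t [t_gt ts]] := zeros (- ln eta / (2 * PI * be))%R.
  exists (w t); split; last by have := powers _ _ ts; rewrite Cmult_0_r.
  split; first exact: exp_pos.
  rewrite -[X in (_ < X)%R](exp_ln eta eta0); apply: exp_increasing.
  have piP := PI_RGT_0; have twopibe : (0 < 2 * PI * be)%R by apply: Rmult_lt_0_compat; lra.
  have := Rmult_lt_compat_l _ _ _ twopibe t_gt.
  have -> : (2 * PI * be * (- ln eta / (2 * PI * be)) = - ln eta)%R by field; lra.
  lra.
move=> j; case: (Z.lt_ge_cases j (- M)) => jM; first exact: cM.
have -> : j = (Z.of_nat (Z.to_nat (j + M)) - M)%Z by lia.
exact: coef0.
Qed.

Definition q_exponent (N : nat) (r : nat -> Z) (m : Z) : R := (IZR (xN N r) / 24 + IZR m)%R.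

Lemma qexp_is_qseries N r g c Y : qexp N r g c Y <->
  forall tau, (Y < Im tau)%R -> is_qseries (q_exponent N r) c tau (g tau).
Proof.
split=> [[M [cM gs]] tau tauY|gs]; first by apply/(is_qseries_series _ _ _ cM); exact: gs.
have [|M cM] := is_qseries_bounded (gs (0%R, (Y + 1)%R) _); first by rewrite /=; lra.
exists M; split=> // tau tauY.
exact: (proj1 (is_qseries_series (q_exponent N r) _ _ cM) (gs tau tauY)).
Qed.

Lemma qexp_unique N r g c c' (Y Y' : R) : qexp N r g c Y -> qexp N r g c' Y' -> c = c'.
Proof.
move=> /qexp_is_qseries gc /qexp_is_qseries gc'.
have diff t : (Rmax Y Y' < t)%R ->
    is_qseries (q_exponent N r) (fun j => c j + - RtoC 1%R * c' j)%C (0%R, t) (RtoC 0%R).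
  move=> tY; have tY1 := Rle_lt_trans _ _ _ (Rmax_l Y Y') tY.
  have tY2 := Rle_lt_trans _ _ _ (Rmax_r Y Y') tY.
  have := is_zseries_plus (gc (0%R, t) tY1) (is_zseries_scal (- RtoC 1%R)%C (gc' (0%R, t) tY2)).
  rewrite (_ : (g (0%R, t) + - RtoC 1%R * g (0%R, t))%C = RtoC 0%R); last by ring.
  by apply: is_zseries_ext => j; ring.
apply: functional_extensionality => j.
have E : (c j + - RtoC 1%R * c' j)%C = RtoC 0%R; last by apply: Cminus_eq0; rewrite -E; ring.
apply: (@is_qseries_coef_eq0 (q_exponent N r) (IZR (xN N r) / 24)%R 1%R
  (fun j => c j + - RtoC 1%R * c' j)%C).
- lra.
- by move=> m; rewrite /q_exponent; ring.
- by exists (Rmax Y Y' + 1)%R, (RtoC 0%R); apply: diff; lra.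
move=> T; exists (Rmax (Rmax Y Y') T + 1)%R.
have := Rmax_l (Rmax Y Y') T; have := Rmax_r (Rmax Y Y') T => T1 T2.
by split; [lra|apply: diff; lra].
Qed.

Lemma discrete_in_H_gap P (u v : R) : discrete_in_H P -> (0 < v)%R ->
  exists eps, (0 < eps)%R /\ forall t, (0 < t < eps)%R -> ~ P (u, v + t)%R.
Proof.
move=> [_ gap] v0; have [eps [eps0 far]] := gap (u, v) v0; exists eps; split=> // t [t0 t_eps] Pt.
have : (eps <= Cmod ((u, v + t)%R - (u, v))%C)%R by apply: far => // -[]; lra.
have -> : ((u, v + t)%R - (u, v))%C = (0%R, t).
  by rewrite /Cminus /Copp /Cplus /=; f_equal; ring.
rewrite /Cmod /= (_ : (0 * (0 * 1) + t * (t * 1) = t * t)%R); last by ring.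
by rewrite sqrt_square; lra.
Qed.

Lemma Cmult_1_div z : (z / RtoC 1%R)%C = z.
Proof. by field; move=> /RtoC_inj; lra. Qed.

Lemma Csqrt_1 : Csqrt (RtoC 1%R) = RtoC 1%R.
Proof.
rewrite /Csqrt Cmod_1 /=; case: Rlt_dec => [/= lt0|ge0]; first lra.
have -> : ((1 + 1) / 2 = 1)%R by field.
have -> : ((1 - 1) / 2 = 0)%R by field.
by rewrite sqrt_1 sqrt_0 Rmult_0_r.
Qed.

Lemma mob_translation b tau : mob 1 b 0 1 tau = (tau + RtoC (IZR b))%C.
Proof.
rewrite /mob (_ : (RtoC 0 * tau + RtoC 1 = RtoC 1)%C) ?Cmult_1_div; last by ring.
by ring.
Qed.

Lemma slash_translation K b f tau : slash K 1 b 0 1 1 f tau = f (tau + RtoC (IZR b))%C.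
Proof.
rewrite /slash mob_translation (_ : (RtoC 0 * tau + RtoC 1 = RtoC 1)%C); last by ring.
by rewrite Csqrt_1 (_ : (RtoC 1 * RtoC 1 = RtoC 1)%C) ?Cpowz_1 ?Cmult_1_l //; ring.
Qed.

Lemma chi_translation N r : chi N r 1 1 0 1 1 = zeta24 (xN N r).
Proof.
rewrite chi_eps1 /zeta24 /xN Rmult_comm; congr (eR (_ * _))%R.
rewrite /sumR /sumZ; elim: (divisors N) => //= n s ->.
by rewrite plus_IZR mult_IZR /Psi Zdiv_0_l /= Z.mul_1_l Rmult_comm.
Qed.

Section ModularForm.
Variables (N : nat) (r : nat -> Z) (K : Z) (f : C -> C).
Hypothesis f_modular : merom_modform N r K f.

Lemma modform_translation (T : R) : exists t, (T < t)%R /\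
  f ((0%R, t) + RtoC 1%R)%C = (zeta24 (xN N r) * f (0%R, t))%C.
Proof.
case: f_modular => P [[Pdisc _] [f_slash _]].
have v0 : (0 < Rmax T 0 + 1)%R by have := Rmax_r T 0; lra.
have [eps1 [eps10 gap1]] := discrete_in_H_gap 0 Pdisc v0.
have [eps2 [eps20 gap2]] := discrete_in_H_gap 1 Pdisc v0.
have eps0 : (0 < Rmin eps1 eps2)%R by apply: Rmin_glb_lt.
have [le1 le2] : (Rmin eps1 eps2 <= eps1)%R /\ (Rmin eps1 eps2 <= eps2)%R.
  by split; [exact: Rmin_l|exact: Rmin_r].
pose t := (Rmax T 0 + 1 + Rmin eps1 eps2 / 2)%R.
exists t; split; first by rewrite /t; have := Rmax_l T 0; lra.
have GT : Gamma0 N 1 1 0 1 by split=> //; exact: Z.divide_0_r.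
have := f_slash _ _ _ _ 1%Z GT (or_introl erefl) (0%R, t).
rewrite slash_translation chi_translation mob_translation; apply.
- by rewrite /inH /= /t; lra.
- by apply: gap1; lra.
have -> : ((0%R, t) + RtoC 1)%C = (1%R, t) by rewrite /RtoC /Cplus /=; f_equal; ring.
by apply: gap2; lra.
Qed.

Lemma modform_cusp_series : exists (h : nat) (c : Z -> C) (Y : R), 0 < h /\
  forall tau, (Y < Im tau)%R -> is_qseries (fun j => IZR j / INR h)%R c tau (f tau).
Proof.
case: f_modular => P [_ [_ cusps]].
have [h [c [M [Y [h0 [cM fs]]]]]] := cusps 1%Z 0%Z 0%Z 1%Z (erefl 1%Z).
exists h, c, Y; split=> //.
move=> tau tauY; apply/(is_qseries_series _ _ _ cM); move: (fs tau tauY).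
by rewrite slash_translation Cplus_0_r.
Qed.

Section CuspSeries.
Variables (h : nat) (c : Z -> C) (Y : R).
Hypothesis h0 : 0 < h.
Hypothesis f_series :
  forall tau, (Y < Im tau)%R -> is_qseries (fun j => IZR j / INR h)%R c tau (f tau).

Let hR : (0 < INR h)%R. Proof. by apply: lt_0_INR; apply/ltP. Qed.

Lemma modform_coef_translation j : (c j * (eR (IZR j / INR h) - zeta24 (xN N r)))%C = RtoC 0%R.
Proof.
set c' := fun j => (c j * (eR (IZR j / INR h) - zeta24 (xN N r)))%C.
have diff t : (Y < t)%R -> is_qseries (fun j => IZR j / INR h)%R c' (0%R, t)
    (f ((0%R, t) + RtoC 1%R) + - zeta24 (xN N r) * f (0%R, t))%C.
  move=> tY; have tY1 : (Y < Im ((0%R, t) + RtoC 1%R)%C)%R by rewrite /= Rplus_0_r.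
  have f0t := f_series (tY : (Y < Im (0%R, t))%R).
  have := is_zseries_plus (f_series tY1) (is_zseries_scal (- zeta24 (xN N r))%C f0t).
  apply: is_zseries_ext => i.
  by rewrite Cmult_plus_distr_l e_add Cmult_1_r -/(eR _) /c'; ring.
apply: (@is_qseries_coef_eq0 (fun j => IZR j / INR h)%R 0%R (/ INR h)%R c').
- exact: Rinv_0_lt_compat.
- by move=> i; rewrite /Rdiv; ring.
- by exists (Y + 1)%R; eexists; apply: diff; lra.
move=> T; have [t [tT ft]] := modform_translation (Rmax T Y).
have := Rmax_l T Y; have := Rmax_r T Y => T1 T2.
exists t; split; first lra.
by have := diff t; rewrite ft -Cmult_plus_distr_r Cplus_opp_r Cmult_0_l; apply; lra.
Qed.

Lemma modform_exponent j : c j <> RtoC 0%R ->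
  exists m, (24 * j = Z.of_nat h * xN N r + 24 * Z.of_nat h * m)%Z.
Proof.
move=> cj; have [n nE] : exists n, (IZR j / INR h + - (IZR (xN N r) / 24))%R = IZR n.
  apply: eR_eq1; rewrite eR_add -Cinv_eR.
  have -> : eR (IZR j / INR h) = zeta24 (xN N r).
    exact/Cminus_eq0/(Cmult_eq0 (modform_coef_translation j)).
  by rewrite Cinv_r //; exact: e_neq0.
exists n; apply: eq_IZR; rewrite !(plus_IZR, mult_IZR) -nE -INR_IZR_INZ.
by field; lra.
Qed.

Lemma modform_qexp_of_cusp_series : exists cf, qexp N r f cf Y.
Proof.
pose cf m := let j := (Z.of_nat h * (xN N r + 24 * m))%Z in
  if (j mod 24 =? 0)%Z then c (j / 24)%Z else RtoC 0%R.
exists cf; apply/qexp_is_qseries => tau /f_series.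
have h240 : 0 < 24 * h by rewrite muln_gt0.
apply: (@is_zseries_reindex 24 (24 * h) 0%Z (Z.of_nat h * xN N r)%Z _ _ _ isT h240).
- move=> i m E; rewrite /cf.
  have {}E : (24 * i = Z.of_nat h * xN N r + 24 * Z.of_nat h * m)%Z by lia.
  have -> : (Z.of_nat h * (xN N r + 24 * m) = i * 24)%Z by lia.
  rewrite Z.mod_mul // Z.div_mul //=; congr (_ * e (RtoC _ * _))%C.
  have := congr1 IZR E; rewrite /q_exponent !(plus_IZR, mult_IZR) -!INR_IZR_INZ => E'.
  apply: (Rmult_eq_reg_l (24 * INR h)); last by apply: Rmult_integral_contrapositive; split; lra.
  have -> : (24 * INR h * (IZR i / INR h) = 24 * IZR i)%R by field; lra.
  by rewrite E'; field.
- move=> i none; case: (excluded_middle_informative (c i = RtoC 0%R)) => [->|/modform_exponent[m mE]].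
    by rewrite Cmult_0_l.
  by case: (none m); lia.
move=> m none; rewrite /cf; case: Z.eqb_spec => E; last by rewrite Cmult_0_l.
case: (none (Z.of_nat h * (xN N r + 24 * m) / 24)%Z).
by have := Z.div_mod (Z.of_nat h * (xN N r + 24 * m)) 24; lia.
Qed.
End CuspSeries.

Lemma modform_qexp : exists Y cf, qexp N r f cf Y.
Proof.
have [h [c [Y [h0 fs]]]] := modform_cusp_series; exists Y.
exact: modform_qexp_of_cusp_series h0 fs.
Qed.
End ModularForm.

(** * Hecke operators *)

HB.instance Definition _ :=
  Monoid.isComLaw.Build C (RtoC 0%R) Cplus Cplus_assoc Cplus_comm Cplus_0_l.

Lemma sumCE s F : sumC s F = \big[Cplus/RtoC 0%R]_(i <- s) F i.
Proof. by elim: s => [|n s IH]; rewrite ?big_nil // big_cons -IH. Qed.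

Lemma eq_sumC s F G : (forall n, n \in s -> F n = G n) -> sumC s F = sumC s G.
Proof. by move=> FG; rewrite !sumCE; apply: eq_big_seq. Qed.

Lemma sumC_scal s F c : sumC s (fun n => c * F n)%C = (c * sumC s F)%C.
Proof. by rewrite !sumCE (big_morph (Cmult c) (Cmult_plus_distr_l c) (Cmult_0_r c)). Qed.

Lemma sumC_filter (p : pred nat) s F :
  sumC [seq n <- s | p n] F = sumC s (fun n => if p n then F n else RtoC 0%R).
Proof. by rewrite !sumCE big_filter big_mkcond. Qed.

(* The sum over a period is invariant under the shift by [g], which multiplies it by [w]. *)
Lemma periodic_sumC_eq0 (F : nat -> C) (d g : nat) (w : C) :
  (forall b, F (b + d) = F b) -> (forall b, F (b + g) = (w * F b)%C) ->
  w <> RtoC 1%R -> sumC (iota 0 d) F = RtoC 0%R.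
Proof.
move=> F_period F_shift w1.
have shift k : sumC (iota 0 d) (fun b => F (b + k)) = sumC (iota 0 d) F.
  elim: k => [|k <-]; first by apply: eq_sumC => b _; rewrite addn0.
  rewrite (eq_sumC (G := fun b => F (b.+1 + k))) => [|b _]; last by rewrite addSnnS.
  apply: Cminus_eq0; rewrite !sumCE -[X in iota 0 X]subn0 -/(index_iota 0 d).
  pose sum G := \big[Cplus/RtoC 0%R]_(0 <= b < d) G b.
  have recl : (F k + sum (fun b => F (b.+1 + k)%N))%C = (sum (fun b => F (b + k)%N) + F k)%C.
    by rewrite -{2}(F_period k) (addnC k) -(big_nat_recr d 0 (fun b => F (b + k))) // big_nat_recl.
  transitivity (F k + sum (fun b => F (b.+1 + k)%N) - (sum (fun b => F (b + k)%N) + F k))%C.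
    by rewrite /sum; ring.
  by rewrite recl; ring.
have := shift g; rewrite (eq_sumC (G := fun b => (w * F b)%C)) => [|b _]; last exact: F_shift.
rewrite sumC_scal => E; apply: (@Cmult_eq0 (w - RtoC 1%R)) => [|/Cminus_eq0 //].
have -> : ((w - RtoC 1) * sumC (iota 0 d) F = w * sumC (iota 0 d) F - sumC (iota 0 d) F)%C by ring.
by rewrite E; ring.
Qed.

Lemma powerRZ_sign_even u K : is_sign u -> Z.Even K -> powerRZ (IZR u) K = 1%R.
Proof. by case=> -> [w ->]; [exact: powerRZ_R1|exact: powerRZ_oppr1_double]. Qed.

Lemma cube_sqr_sub1 D : (D * D * D * (D * D - 1) ≡ 0 %[mod 24])%Z.
Proof.
have : (D * D * D * (D * D - 1) ≡ 0 %[mod 8])%Z.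
  have [[w ->]|/ZOdd_sqr_eqm8 DD] := Z.Even_or_Odd D; first by clear; zmod_lia.
  by rewrite DD Z.mul_0_r.
have : (D * D * D * (D * D - 1) ≡ 0 %[mod 3])%Z.
  have [D3|/sqr_eqm1_mod3 DD] := Z.eq_dec (D mod 3) 0; last by rewrite DD Z.mul_0_r.
  by rewrite (D3 : (D ≡ 0 %[mod 3])%Z).
by clear; move: (_ * (D * D - 1))%Z; zmod_lia.
Qed.

Lemma index_sqr_sub1 A D X : ((A * D - 1) * X ≡ 0 %[mod 24])%Z ->
  ((D * D - 1) * X ≡ 0 %[mod 24])%Z.
Proof.
move=> AD; have XE : (X ≡ A * D * X %[mod 24])%Z.
  by move: AD; rewrite Z.mul_sub_distr_r Z.mul_1_l; clear; move: (A * D * X)%Z; zmod_lia.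
rewrite XE XE XE.
have -> : ((D * D - 1) * (A * D * (A * D * (A * D * X)))
  = A * A * A * X * (D * D * D * (D * D - 1)))%Z by ring.
by rewrite cube_sqr_sub1 Z.mul_0_r.
Qed.

Section HeckeFactor.
Variables (N a d : nat) (r : nat -> Z) (K : Z).
Local Notation A := (Z.of_nat a).
Local Notation D := (Z.of_nat d).
Local Notation NZ := (Z.of_nat N).
Local Notation X := (xN N r).
Local Notation g := (gcdn a d).
Hypotheses (N0 : 0 < N) (a0 : 0 < a) (d0 : 0 < d) (caN : coprime a N).
Hypothesis weightE : (K ≡ sumr N r %[mod 4])%Z.
Hypothesis l_in_Lr : in_Lr N r (a * d).

Let g0 : 0 < g. Proof. by rewrite gcdn_gt0 a0. Qed.

Let index_X : ((A * D - 1) * X ≡ 0 %[mod 24])%Z.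
Proof. by have [] := in_Lr_index l_in_Lr; rewrite Nat2Z.inj_mul. Qed.

Let index_S : ((A * D - 1) * xN_dual N r ≡ 0 %[mod 24])%Z.
Proof. by have [] := in_Lr_index l_in_Lr; rewrite Nat2Z.inj_mul. Qed.

(* The [b]-th coefficient of the inner sum in [T_l f], up to the factor [(a / varpi)]. *)
Definition hecke_factor (b : nat) : C :=
  if gcdn (gcdn a b) d == 1 then
    (RtoC (powerRZ (IZR (kron (- NZ * Z.of_nat b) g)) K) *
     zeta24 (- (Z.of_nat b * D * X)) * psi N r K (a * d) a b)%C
  else RtoC 0%R.

Lemma gcdn_shift b : gcdn (gcdn a (b + g)) d = gcdn (gcdn a b) d.
Proof.
by rewrite !(gcdnC _ d) !gcdnA !(gcdnC d a) gcdnDr.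
Qed.

Lemma psi_shift b : psi N r K (a * d) a (b + g) = psi N r K (a * d) a b.
Proof.
rewrite !psi_zeta24 //; apply: zeta24_eqm; rewrite /psi24.
case: ifP => // /negbT el; case: ifP => // eN.
have NE : N = 2 * N./2 by lia.
have := psi24_period weightE index_X index_S N0 NE el; rewrite Nat2Z.inj_add.
by move: (_ * _ * _)%Z (3 * _ * _)%Z (Z.of_nat b) (Z.of_nat g); clear; zmod_lia.
Qed.

Lemma kron_shift b : gcdn (gcdn a b) d = 1 ->
  powerRZ (IZR (kron (- NZ * Z.of_nat (b + g)) g)) K
  = powerRZ (IZR (kron (- NZ * Z.of_nat b) g)) K.
Proof.
move=> cabd; case: (boolP (odd g)) => og.
  congr (powerRZ (IZR _) K); apply: kron_eqm => //; apply/eqm_divide; exists (- NZ)%Z.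
  by rewrite Nat2Z.inj_add; ring.
have ea : ~~ odd a by apply: contra og; exact: dvdn_odd (dvdn_gcdl a d).
have oN : odd N.
  by rewrite -coprime2n; apply: coprime_dvdl caN; rewrite dvdn2.
have el : ~~ odd (a * d) by rewrite oddM negb_and ea.
have eK : Z.Even K.
  have [w E] := even_weight_oddN index_S N0 oN el; move: weightE; rewrite E; clear.
  by move=> KE; exists (K / 2)%Z; move: KE; zmod_lia.
have sign b' : gcdn (gcdn a b') d = 1 -> is_sign (kron (- NZ * Z.of_nat b') g).
  move=> cab'd; apply: is_sign_kron => //.
  have -> : Z.abs_nat (- NZ * Z.of_nat b') = N * b' by lia.
  rewrite coprimeMl; apply/andP; split.
    by rewrite coprime_sym; exact: coprime_dvdl (dvdn_gcdl a d) caN.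
  by rewrite /coprime gcdnA (gcdnC b') cab'd.
by rewrite !powerRZ_sign_even //; apply: sign; rewrite ?gcdn_shift.
Qed.

Lemma hecke_factor_shift b :
  hecke_factor (b + g) = (zeta24 (- (Z.of_nat g * D * X)) * hecke_factor b)%C.
Proof.
rewrite /hecke_factor gcdn_shift; case: eqP => cabd; last by rewrite Cmult_0_r.
rewrite psi_shift kron_shift //.
have -> : (- (Z.of_nat (b + g) * D * X) = - (Z.of_nat g * D * X) + - (Z.of_nat b * D * X))%Z by lia.
by rewrite zeta24D; ring.
Qed.

Let dR : INR d <> 0%R. Proof. by apply: not_0_INR; lia. Qed.

Lemma e_affine (rho b : R) tau :
  e (RtoC rho * ((RtoC (INR a) * tau + RtoC b) / RtoC (INR d)))%C
  = (e (RtoC (rho * INR a / INR d)%R * tau) * eR (rho * b / INR d)%R)%C.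
Proof. by rewrite /eR -e_add; congr e; rewrite /Rdiv !RtoC_mult RtoC_inv // /Cdiv; ring. Qed.

Lemma Im_affine (b : R) tau :
  Im ((RtoC (INR a) * tau + RtoC b) / RtoC (INR d))%C = (INR a * Im tau / INR d)%R.
Proof.
by rewrite /Cdiv -RtoC_inv //; case: tau => u v; rewrite /Im /Cmult /Cplus /RtoC /=; field.
Qed.

Definition hecke_twist (m : Z) (b : nat) : C :=
  (hecke_factor b * eR (q_exponent N r m * INR b / INR d))%C.

Section TwistedSum.
Variables (s : nat) (w m : Z).
Hypotheses (dE : d = s * g) (wE : ((D * D - 1) * X = w * 24)%Z).

Lemma hecke_twist_shift b :
  hecke_twist m (b + g) = (eR (IZR (m - w) / INR s) * hecke_twist m b)%C.
Proof.
have s0 : INR s <> 0%R by apply: not_0_INR => s0; move: d0; rewrite dE s0.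
have gR : INR g <> 0%R by apply: not_0_INR; move: g0; lia.
rewrite /hecke_twist hecke_factor_shift /zeta24 plus_INR.
have -> : (q_exponent N r m * (INR b + INR g) / INR d
  = q_exponent N r m * INR b / INR d + q_exponent N r m * INR g / INR d)%R by field.
rewrite eR_add.
have -> : (IZR (m - w) / INR s
  = q_exponent N r m * INR g / INR d + IZR (- (Z.of_nat g * D * X)) / 24)%R.
  have := congr1 IZR wE; rewrite !(mult_IZR, minus_IZR) -!INR_IZR_INZ => wR.
  have dRE : INR d = (INR s * INR g)%R by rewrite {1}dE mult_INR.
  have -> : IZR w = ((INR d * INR d - 1) * IZR X / 24)%R by lra.
  by rewrite /q_exponent opp_IZR !mult_IZR -!INR_IZR_INZ dRE; field.
by rewrite eR_add; ring.
Qed.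

Lemma hecke_twist_period b : hecke_twist m (b + d) = hecke_twist m b.
Proof.
have s0 : INR s <> 0%R by apply: not_0_INR => s0; move: d0; rewrite dE s0.
have iter k : hecke_twist m (b + k * g)
    = (eR (INR k * (IZR (m - w) / INR s)) * hecke_twist m b)%C.
  elim: k => [|k IH]; first by rewrite mul0n addn0 Rmult_0_l eR_0 Cmult_1_l.
  rewrite mulSnr addnA hecke_twist_shift IH S_INR Rmult_plus_distr_r Rmult_1_l eR_add; ring.
rewrite {1}dE iter (_ : (INR s * (IZR (m - w) / INR s) = IZR (m - w))%R); last by field.
by rewrite eR_IZR Cmult_1_l.
Qed.

Lemma hecke_twist_sum_eq0 : ~ (Z.of_nat s | m - w)%Z ->
  sumC (iota 0 d) (hecke_twist m) = RtoC 0%R.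
Proof.
move=> ndiv; apply: (periodic_sumC_eq0 hecke_twist_period hecke_twist_shift).
have s0 : INR s <> 0%R by apply: not_0_INR => s0; move: d0; rewrite dE s0.
move=> /eR_eq1[n nE]; apply: ndiv; exists n; apply: eq_IZR.
by rewrite mult_IZR -nE -INR_IZR_INZ; field.
Qed.
End TwistedSum.

(* [m] and [m'] index the same exponent: [a (x/24 + m) / d = x/24 + m']. *)
Definition same_exponent (m m' : Z) : Prop := ((X + 24 * m) * A = (X + 24 * m') * D)%Z.

Lemma hecke_twist_sum_unmatched m : (forall m', ~ same_exponent m m') ->
  sumC (iota 0 d) (hecke_twist m) = RtoC 0%R.
Proof.
move=> unmatched; have [p aE] := dvdnP (dvdn_gcdl a d); have [s dE] := dvdnP (dvdn_gcdr a d).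
have [w wE] := (proj1 (eqm_divide _ _ _)) (index_sqr_sub1 index_X).
apply: (hecke_twist_sum_eq0 dE wE) => -[n nE].
have [v vE] := (proj1 (eqm_divide _ _ _)) index_X.
apply: (unmatched (n * Z.of_nat p + v)%Z); rewrite /same_exponent.
have AE : A = (Z.of_nat p * Z.of_nat g)%Z by rewrite {1}aE Nat2Z.inj_mul.
have DE : D = (Z.of_nat s * Z.of_nat g)%Z by rewrite {1}dE Nat2Z.inj_mul.
by move: wE vE nE AE DE; clear; nsatz.
Qed.

Lemma cf_at_matched (cf : Z -> C) m m' : same_exponent m m' -> cf_at N r cf (a * d) a m' = cf m.
Proof.
rewrite /same_exponent /cf_at => E; have A0 : (0 < A)%Z by lia.
have -> : (Z.of_nat (a * d) * (X + 24 * m') - A ^ 2 * X = m * (24 * A ^ 2))%Z.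
  rewrite Nat2Z.inj_mul Z.pow_2_r; move: E; clear; nsatz.
by rewrite Z_mod_mult Z_div_mult //; lia.
Qed.

Lemma cf_at_unmatched (cf : Z -> C) m' : (forall m, ~ same_exponent m m') ->
  cf_at N r cf (a * d) a m' = RtoC 0%R.
Proof.
move=> unmatched; rewrite /cf_at; case: Z.eqb_spec => // E; have A0 : (0 < A)%Z by lia.
have [q Q] : (24 * A ^ 2 | Z.of_nat (a * d) * (X + 24 * m') - A ^ 2 * X)%Z.
  by apply/Z.mod_divide => //; lia.
case: (unmatched q); rewrite /same_exponent.
by apply: (Z.mul_reg_l _ _ A); move: Q; rewrite Z.pow_2_r; lia.
Qed.

Lemma same_exponentE m m' : same_exponent m m' ->
  q_exponent N r m' = (q_exponent N r m * INR a / INR d)%R.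
Proof.
move=> /(congr1 IZR); rewrite !(plus_IZR, mult_IZR) -!INR_IZR_INZ => E.
apply: (Rmult_eq_reg_r (24 * INR d)); last by apply: Rmult_integral_contrapositive; split; [lra|].
by rewrite /q_exponent; transitivity ((IZR X + 24 * IZR m) * INR a)%R; [rewrite E|]; field.
Qed.

Definition hecke_inner (f : C -> C) (tau : C) : C :=
  sumC (iota 0 d) (fun b =>
    hecke_factor b * f ((RtoC (INR a) * tau + RtoC (INR b)) / RtoC (INR d)))%C.

Definition hecke_inner_coeff (m : Z) : C :=
  sumC (iota 0 d) (fun b => if gcdn (gcdn a b) d == 1 then
    RtoC (powerRZ (IZR (kron (- NZ * Z.of_nat b) g)) K) *
    eR (INR b * INR d * (q_exponent N r m / INR (a * d) - IZR X / 24)) *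
    psi N r K (a * d) a b else RtoC 0%R)%C.

Lemma hecke_inner_coeff_matched m m' : same_exponent m m' ->
  hecke_inner_coeff m' = sumC (iota 0 d) (hecke_twist m).
Proof.
move=> mm'; apply: eq_sumC => b _; rewrite /hecke_twist /hecke_factor.
case: eqP => _; last by rewrite Cmult_0_l.
rewrite (same_exponentE mm').
have aR : INR a <> 0%R by apply: not_0_INR; lia.
have -> : (INR b * INR d * (q_exponent N r m * INR a / INR d / INR (a * d) - IZR X / 24)
  = IZR (- (Z.of_nat b * D * X)) / 24 + q_exponent N r m * INR b / INR d)%R.
  by rewrite opp_IZR !mult_IZR -!INR_IZR_INZ mult_INR; field.
by rewrite eR_add -/(zeta24 _); ring.
Qed.

Lemma hecke_inner_qseries f cf Y tau : qexp N r f cf Y -> (Y < INR a * Im tau / INR d)%R ->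
  is_qseries (q_exponent N r) (fun m => cf_at N r cf (a * d) a m * hecke_inner_coeff m)%C
    tau (hecke_inner f tau).
Proof.
move=> /qexp_is_qseries f_series tauY.
have a240 : 0 < 24 * a by rewrite muln_gt0. have d240 : 0 < 24 * d by rewrite muln_gt0.
have relE m m' : (Z.of_nat (24 * a) * m + X * A = Z.of_nat (24 * d) * m' + X * D)%Z <->
    same_exponent m m' by rewrite /same_exponent; lia.
pose U m := (cf m * e (RtoC (q_exponent N r m * INR a / INR d)%R * tau)
  * sumC (iota 0 d) (hecke_twist m))%C.
apply: (is_zseries_reindex (u := U) a240 d240).
- move=> m m' /relE mm'; rewrite (cf_at_matched cf mm') (hecke_inner_coeff_matched mm').
  by rewrite (same_exponentE mm') /U; ring.
- move=> m unmatched; rewrite /U hecke_twist_sum_unmatched ?Cmult_0_r // => m' /relE.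
  exact: unmatched.
- move=> m' unmatched; rewrite cf_at_unmatched ?Cmult_0_l // => m /relE.
  exact: unmatched.
apply: (@is_zseries_ext (fun m => sumC (iota 0 d) (fun b => hecke_factor b *
   (cf m * e (RtoC (q_exponent N r m) * ((RtoC (INR a) * tau + RtoC (INR b)) / RtoC (INR d))))))%C).
  move=> m; rewrite /U -sumC_scal; apply: eq_sumC => b _.
  by rewrite e_affine /hecke_twist; ring.
apply: is_zseries_sumC => b _; apply: is_zseries_scal.
by apply: f_series; rewrite Im_affine.
Qed.

Lemma hecke_summand (f : C -> C) tau b : gcdn (gcdn a b) d = 1 ->
  (let '(x, y, z) := xyz NZ A (Z.of_nat b) D in
   Cinv (chi N r (- NZ * Z.of_nat b + A * x)%Z z (- NZ * D)%Z y 1%Z) *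
   Cinv (chi N r (A * y)%Z (Z.of_nat b * y - D * z)%Z NZ x 1%Z) *
   f ((RtoC (IZR A) * tau + RtoC (IZR (Z.of_nat b))) / RtoC (IZR D)))%C
  = (RtoC (IZR (kron A (varpi N r))) *
     (hecke_factor b * f ((RtoC (INR a) * tau + RtoC (INR b)) / RtoC (INR d))))%C.
Proof.
move=> cabd; have := xyz_spec N0 a0 d0 caN cabd; case: (xyz _ _ _ _) => [[x y] z] xyzE.
rewrite (chi_inv_pairE N0 a0 d0 caN weightE l_in_Lr xyzE) /hecke_factor cabd eqxx -!INR_IZR_INZ.
by ring.
Qed.
End HeckeFactor.

Lemma scaled_height_bound (a d : nat) (Y v : R) : 0 < a -> 0 < d ->
  (INR (a * d) * Rabs Y < v)%R -> (Y < INR a * v / INR d)%R.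
Proof.
move=> a0 d0; rewrite mult_INR => vY; have Y0 := Rabs_pos Y; have Y1 := Rle_abs Y.
have a1 : (1 <= INR a)%R by apply: (le_INR 1); apply/leP.
have d1 : (0 < INR d)%R by apply: lt_0_INR; apply/ltP.
apply: (Rmult_lt_reg_r (INR d)) => //.
have -> : (INR a * v / INR d * INR d = INR a * v)%R by field; lra.
have : (INR a * (INR a * INR d * Rabs Y) < INR a * v)%R by apply: Rmult_lt_compat_l; lra.
have : (Rabs Y * INR d * 1 <= Rabs Y * INR d * (INR a * INR a))%R.
  by apply: Rmult_le_compat_l; [apply: Rmult_le_pos; lra|nra].
have : (Y * INR d <= Rabs Y * INR d)%R by apply: Rmult_le_compat_r; lra.
lra.
Qed.

Lemma hecke_qexp N r K l f cf Y : 0 < N -> (K ≡ sumr N r %[mod 4])%Z -> in_Lr N r l ->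
  qexp N r f cf Y -> qexp N r (hecke N r K l f) (hecke_coeff N r K l cf) (INR l * Rabs Y).
Proof.
move=> N0 weightE l_in_Lr f_series; apply/qexp_is_qseries => tau tauY.
have l0 : 0 < l by case: l_in_Lr.
pose weight a := (RtoC (IZR (kron (Z.of_nat a) (varpi N r))) * RtoC (Rpower (INR a) (IZR K / 2)))%C.
apply: (@is_zseries_ext (fun m => RtoC (Rpower (INR l) (- (IZR K / 2) / 2)) *
   sumC [seq a <- divisors l | coprime a N] (fun a => weight a *
    (cf_at N r cf l a m * hecke_inner_coeff N a (l %/ a) r K m * e (RtoC (q_exponent N r m) * tau))))%C).
  move=> m; rewrite /hecke_coeff /= -[in RHS]Cmult_assoc; congr (_ * _)%C.
  rewrite [RHS]Cmult_comm -sumC_scal; apply: eq_sumC => a.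
  rewrite mem_filter -dvdn_divisors // => /andP[_ al].
  by rewrite sumC_filter /hecke_inner_coeff /q_exponent (mulnC a) divnK // /weight; ring.
apply: is_zseries_scal; apply: is_zseries_sumC => a.
rewrite mem_filter -dvdn_divisors // => /andP[caN /dvdnP[d lE]].
rewrite mulnC in lE; rewrite {}lE in l_in_Lr l0 tauY *.
have [a0 d0] : 0 < a /\ 0 < d by apply/andP; rewrite -muln_gt0.
cbv zeta; rewrite mulKn // sumC_filter.
rewrite (eq_sumC (G := fun b => (RtoC (IZR (kron (Z.of_nat a) (varpi N r))) *
    (hecke_factor N a d r K b * f ((RtoC (INR a) * tau + RtoC (INR b)) / RtoC (INR d))))%C)); last first.
  move=> b _; case: eqP => [cabd|ncop]; first exact: hecke_summand.
  by rewrite /hecke_factor; case: eqP => // _; rewrite Cmult_0_l Cmult_0_r.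
rewrite sumC_scal Cmult_assoc (Cmult_comm (RtoC (Rpower _ _))).
apply: is_zseries_scal; apply: (hecke_inner_qseries N0 a0 d0 caN weightE l_in_Lr f_series).
exact: scaled_height_bound.
Qed.

Lemma qexp_mono N r g c (Y Y' : R) : (Y <= Y')%R -> qexp N r g c Y -> qexp N r g c Y'.
Proof. by move=> YY' [M [cM gs]]; exists M; split=> // tau tauY; apply: gs; lra. Qed.

Theorem theorem9p15 (N : nat) (r : nat -> Z) (K : Z) (f : C -> C) (l : nat) :
  (0 < N)%nat ->
  ((K - sumr N r) mod 4 = 0)%Z ->
  merom_modform N r K f ->
  in_Lr N r l ->
  (exists Y0 : R, (0 <= Y0)%R /\ exists cf cT : Z -> C,
      qexp N r f cf Y0 /\ qexp N r (hecke N r K l f) cT Y0) /\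
  (forall (Y Y' : R) (cf cf' : Z -> C),
      qexp N r f cf Y -> qexp N r f cf' Y' -> cf = cf') /\
  (forall (Y Y' : R) (cT cT' : Z -> C),
      qexp N r (hecke N r K l f) cT Y -> qexp N r (hecke N r K l f) cT' Y' -> cT = cT') /\
  (forall (Y Y' : R) (cf cT : Z -> C),
      qexp N r f cf Y -> qexp N r (hecke N r K l f) cT Y' ->
      forall m : Z, cT m = hecke_coeff N r K l cf m).
Proof.
move=> N0 KR f_modular l_in_Lr.
have weightE : (K ≡ sumr N r %[mod 4])%Z by apply: eqm_sub0; rewrite /eqm KR.
have hecke_series cf Y := @hecke_qexp N r K l f cf Y N0 weightE l_in_Lr.
split; [|split; [|split]].
- have [Y [cf f_series]] := modform_qexp f_modular.
  exists (Rmax (Rabs Y) (INR l * Rabs Y)); split.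
    exact: Rle_trans (Rabs_pos Y) (Rmax_l _ _).
  exists cf, (hecke_coeff N r K l cf); split.
    by apply: qexp_mono f_series; apply: Rle_trans (Rle_abs Y) (Rmax_l _ _).
  by apply: qexp_mono (hecke_series _ _ f_series); exact: Rmax_r.
- by move=> Y Y' cf cf' fY fY'; exact: qexp_unique fY fY'.
- by move=> Y Y' cT cT' TY TY'; exact: qexp_unique TY TY'.
by move=> Y Y' cf cT fY TY' m; rewrite (qexp_unique TY' (hecke_series _ _ fY)).
Qed.
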